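(* Let $u\in H(\mathbb{D})$ and $\varphi,\psi\in S(\mathbb{D})$. Then $C_{u,\varphi}-C_{\psi}$ is compact on $H^2(\mathbb{D})$ if and only if both $C_{u',\varphi}:H^2(\mathbb{D})\to A_1^2(\mathbb{D})$ and $C_{u\varphi',\varphi}-C_{\psi',\psi}:A_1^2(\mathbb{D})\to A_1^2(\mathbb{D})$ are compact.
   Context: $\mathbb{D}$ is the open unit disc, $H(\mathbb{D})$ the analytic functions on $\mathbb{D}$, $S(\mathbb{D})$ the analytic self-maps of $\mathbb{D}$. $H^2(\mathbb{D})$ is the Hardy space. $dA=\frac1\pi dx\,dy$, $dA_1(z)=2(1-|z|^2)dA(z)$, and $A_1^2(\mathbb{D})$ is the space of $f\in H(\mathbb{D})$ with $\int_{\mathbb{D}}|f|^2dA_1<\infty$. For $w\in H(\mathbb{D})$ and $\varphi\in S(\mathbb{D})$, $C_{w,\varphi}f=w\cdot(f\circ\varphi)$ and $C_\psi f=f\circ\psi$. *)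

(* Defs.v *)
(* Complex numbers are `R[i]` (mathcomp-real-closed)
   over an arbitrary `R : realType`; we use the regular normed-module copy
   `(R[i])^o` so that `derivable f z 1` is complex differentiability. *)
From HB Require Import structures.
From mathcomp Require Import all_boot all_order all_algebra.
From mathcomp Require Import all_classical all_reals all_analysis.
From mathcomp Require Import complex.
Import Order.TTheory GRing.Theory Num.Theory.
Import numFieldNormedType.Exports.

Set Implicit Arguments.
Unset Strict Implicit.
Unset Printing Implicit Defensive.

Local Open Scope classical_set_scope.
Local Open Scope ring_scope.

Notation CC R := ((complex R)^o).

Section Defs.
Variable R : realType.

Definition cabs2 (z : CC R) : R := complex.Re z ^+ 2 + complex.Im z ^+ 2.

Definition in_disc (z : CC R) : Prop := cabs2 z < 1.

(* f ∈ H(D): complex differentiable at every point of D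
   (values outside D are irrelevant) *)
Definition holo (f : CC R -> CC R) : Prop :=
  forall z : CC R, in_disc z -> derivable f z 1.

Definition cderiv (f : CC R -> CC R) : CC R -> CC R := derive1 f.

Definition selfmap (phi : CC R -> CC R) : Prop :=
  holo phi /\ forall z, in_disc z -> in_disc (phi z).

Definition polar (r t : R) : CC R := ((r * cos t) +i* (r * sin t))%C.

Definition H2norm2 (f : CC R -> CC R) : \bar R :=
  ereal_sup [set ((((2 * pi)^-1 : R)%R)%:E *
                  \int[@lebesgue_measure R]_(t in `[0%R, (2 * pi)%R]%classic)
                     (cabs2 (f (polar r t)))%:E)%E
            | r in `[(0 : R)%R, (1 : R)%R[%classic].

Definition disc2 : set (R * R) := [set p | p.1 ^+ 2 + p.2 ^+ 2 < 1].

(* ||f||_{A_1^2}^2 = ∫_D |f|^2 dA_1, dA_1(z) = 2(1-|z|^2) dA(z),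
   dA = (1/π) dx dy *)
Definition A1norm2 (f : CC R -> CC R) : \bar R :=
  \int[((@lebesgue_measure R) \x (@lebesgue_measure R))%E]_(p in disc2)
     (cabs2 (f ((p.1 +i* p.2)%C)) * (2 * (1 - (p.1 ^+ 2 + p.2 ^+ 2))) / pi)%:E.

Definition inH2 (f : CC R -> CC R) : Prop := holo f /\ (H2norm2 f < +oo)%E.
Definition inA12 (f : CC R -> CC R) : Prop := holo f /\ (A1norm2 f < +oo)%E.

Definition wcomp (w phi : CC R -> CC R) (f : CC R -> CC R) : CC R -> CC R :=
  fun z => w z * f (phi z).

Definition cop (psi : CC R -> CC R) (f : CC R -> CC R) : CC R -> CC R :=
  fun z => f (psi z).

(* T is a compact operator from the space X = {f | inX f} (squared norm nX)
   to the space Y = {f | inY f} (squared norm nY): T maps X into Y and every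
   bounded sequence in X has a subsequence whose image converges in Y. *)
Definition compact_op (inX inY : (CC R -> CC R) -> Prop)
    (nX nY : (CC R -> CC R) -> \bar R)
    (T : (CC R -> CC R) -> (CC R -> CC R)) : Prop :=
  (forall f, inX f -> inY (T f)) /\
  (forall fs : nat -> (CC R -> CC R),
     (forall n, inX (fs n)) ->
     (exists M : R, forall n, (nX (fs n) <= M%:E)%E) ->
     exists (s : nat -> nat) (g : CC R -> CC R),
       (forall n, (s n < s n.+1)%N) /\ inY g /\
       (fun n => nY (fun z => T (fs (s n)) z - g z)) @ \oo --> 0%E).

End Defs.

(* Main.v *)
(* Write T = C_{u,phi} - C_psi and S = C_{u phi',phi} - C_{psi',psi}, so that
   (T f)' = u' f(phi) + S f'.  By Littlewood-Paley, convergence in H^2 is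
   convergence at 0 together with convergence of the derivatives in A^2_1; this
   gives sufficiency, and reduces necessity to the compactness of C_{u',phi}.

   Suppose T compact.  If g = e^L with Im L bounded and q = e^{iL}, then the
   three functions T g, T (g q), T (g q^2) allow one to eliminate every term but
   u' g(phi): the norm of u' g(phi) in A^2_1 is controlled by their H^2 norms.
   So u' g_n(phi) -> 0 whenever such g_n are bounded in H^2 and tend to 0
   pointwise.  By Herglotz, any f in H^2 is, up to a constant, a difference of
   two functions h in H^2 with Re h >= 1, and
     h = lam h / (h + lam) + h^2 / (h + lam).
   The first term is bounded by lam, and is handled by dominated convergence
   because u' lies in A^2_1; the second has a logarithm with bounded imaginary
   part and is dominated by |h|^2 / lam, so its image under C_{u',phi} is small
   for large lam, uniformly for h in a ball of H^2. *)

(* The obstacle is that compactness of T says nothing directly about u' f(phi): the derivative of T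
   f mixes it with terms in f'(phi) and f'(psi), and these may cancel. For f = g q^k with g = e^L
   and q = e^(iL), however, f' = (1 + k i) L' f, so at each point the only unknowns are u' g(phi), u
   phi' L'(phi) g(phi) and psi' L'(psi) g(psi), and the twists give linear relations between them.
   The coefficients are built from q(phi) and q(psi); the bound on Im L makes q and 1/q bounded,
   hence multipliers of both spaces. A general f in H^2 may vanish and then has no logarithm, which
   is why functions of positive real part are brought in. The function h^2/(h + lam) has the
   logarithm 2 log h - log(h + lam), whose imaginary part is at most 3 pi/2 for every lam, so a
   single constant in the estimate serves all lam. Uniformity over the ball is obtained by
   contradiction: a failure would give h_n, with lam = n + 1, whose twisted large parts tend to 0
   pointwise and stay bounded in H^2. Norms are compared only up to constants, through Taylor
   coefficients. *)
Require Import Defs.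
From HB Require Import structures.
From mathcomp Require Import all_boot all_order all_algebra.
From mathcomp Require Import all_classical all_reals all_analysis.
From mathcomp Require Import measurable_realfun complex ring lra.
Import Order.TTheory GRing.Theory Num.Theory.
Import numFieldNormedType.Exports.
Set Implicit Arguments.
Unset Strict Implicit.
Unset Printing Implicit Defensive.
Local Open Scope classical_set_scope.
Local Open Scope ring_scope.

(** * Complex differentiability *)

Section ComplexBasics.
Variable R : realType.
Implicit Types (z w : CC R) (f g : CC R -> CC R).

Definition cabs z : R := Num.sqrt (cabs2 z).

Lemma cabs2_ge0 z : 0 <= cabs2 z.
Proof. by rewrite addr_ge0 ?sqr_ge0. Qed.

Lemma cabs_ge0 z : 0 <= cabs z. Proof. exact: sqrtr_ge0. Qed.

Lemma cabsE z : `|z| = ((cabs z)%:C)%C.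
Proof. by rewrite normc_def. Qed.

Lemma sqr_cabs z : cabs z ^+ 2 = cabs2 z.
Proof. by rewrite sqr_sqrtr// cabs2_ge0. Qed.

Lemma cabsM z w : cabs (z * w) = cabs z * cabs w.
Proof. by apply: (@complexI R); rewrite rmorphM /= -!cabsE normrM. Qed.

Lemma cabsD z w : cabs (z + w) <= cabs z + cabs w.
Proof. by rewrite -lecR rmorphD /= -!cabsE ler_normD. Qed.

Lemma cabsN z : cabs (- z) = cabs z.
Proof. by apply: (@complexI R); rewrite -!cabsE normrN. Qed.

Lemma cabsB z w : cabs (z - w) <= cabs z + cabs w.
Proof. by rewrite -(cabsN w) cabsD. Qed.

Lemma cabs_distC z w : cabs (z - w) = cabs (w - z).
Proof. by rewrite -cabsN opprB. Qed.

Lemma cabs0 : cabs 0 = 0.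
Proof. by apply: (@complexI R); rewrite -cabsE normr0. Qed.

Lemma cabs1 : cabs 1 = 1.
Proof. by apply: (@complexI R); rewrite -cabsE normr1. Qed.

Lemma cabsX z n : cabs (z ^+ n) = cabs z ^+ n.
Proof. by apply: (@complexI R); rewrite rmorphXn /= -!cabsE normrX. Qed.

Lemma cabsV z : cabs (z^-1) = (cabs z)^-1.
Proof. by apply: (@complexI R); rewrite fmorphV /= -!cabsE normfV. Qed.

Lemma cabs_eq0 z : (cabs z == 0) = (z == 0).
Proof. by rewrite -(inj_eq (@complexI R)) -cabsE normr_eq0. Qed.

Lemma cabs_gt0 z : (0 < cabs z) = (z != 0).
Proof. by rewrite lt_neqAle cabs_ge0 andbT eq_sym cabs_eq0. Qed.

Lemma ler_dist_cabs z w : `|cabs z - cabs w| <= cabs (z - w).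
Proof.
rewrite ler_norml; apply/andP; split.
  rewrite lerNl opprB lerBlDr -(cabsN (z - w)) opprB.
  by rewrite -{1}(subrK z w) cabsD.
by rewrite lerBlDr -{1}(subrK w z) cabsD.
Qed.

Lemma cabs2M z w : cabs2 (z * w) = cabs2 z * cabs2 w.
Proof. by rewrite -!sqr_cabs cabsM exprMn. Qed.

Lemma cabs2N z : cabs2 (- z) = cabs2 z.
Proof. by rewrite -!sqr_cabs cabsN. Qed.

Lemma le_cabs2D z w : cabs2 (z + w) <= 2 * (cabs2 z + cabs2 w).
Proof.
rewrite /cabs2; case: z => a b; case: w => c d /=.
by have := sqr_ge0 (a - c); have := sqr_ge0 (b - d); lra.
Qed.

Lemma Re_le_cabs z : `|complex.Re z| <= cabs z.
Proof. by rewrite -lecR -cabsE normc_ge_Re. Qed.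

Lemma Im_le_cabs z : `|complex.Im z| <= cabs z.
Proof.
rewrite -sqrtr_sqr ler_wsqrtr// /cabs2 lerDr; exact: sqr_ge0.
Qed.

Lemma cabs_le_ReIm z : cabs z <= `|complex.Re z| + `|complex.Im z|.
Proof.
rewrite -(@ler_sqr R) ?nnegrE ?cabs_ge0 ?addr_ge0// sqr_cabs /cabs2.
rewrite -(real_normK (num_real (complex.Re z))).
rewrite -(real_normK (num_real (complex.Im z))) sqrrD.
have : 0 <= `|complex.Re z| * `|complex.Im z| by rewrite mulr_ge0.
lra.
Qed.

Lemma in_discP z : in_disc z <-> cabs z < 1.
Proof.
rewrite /in_disc -sqr_cabs; split => H.
  by rewrite -(@ltr_sqr R) ?nnegrE ?cabs_ge0// expr1n.
by rewrite -(expr1n _ 2) ltr_sqr ?nnegrE ?cabs_ge0.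
Qed.

(** The norm of [CC R] is itself complex-valued, so a ball has a complex radius; being positive in
    the order of [R[i]], this radius is real. *)
Lemma nbhs_CCP (z : CC R) (P : set (CC R)) :
  nbhs z P <-> exists2 d : R, 0 < d & forall w, cabs (w - z) < d -> P w.
Proof.
split.
  move=> /nbhs_ballP[[e e'] /=]; rewrite ltcE /= => /andP[/eqP e'0 e0] H.
  exists e => // w wz; apply: H; rewrite /ball /= -normrN opprB.
  by rewrite cabsE ltcE /= e'0 eqxx.
case=> d d0 H; apply/nbhs_ballP; exists ((d%:C)%C) => /=; first by rewrite ltcR.
move=> w; rewrite /ball /= -normrN opprB => wz; apply: H; move: wz.
by rewrite cabsE ltcR.
Qed.

Definition cdiff f z (c : CC R) := is_derive z (1 : CC R) f c.

(** Multiplying the difference quotient by w - z removes the division and the punctured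
    neighbourhood, so that later differentiability proofs become first-order estimates between real
    numbers. *)
Lemma cdiffP f z c : cdiff f z c <->
  forall e : R, 0 < e -> exists2 d : R, 0 < d &
    forall w, cabs (w - z) < d ->
      cabs (f w - f z - c * (w - z)) <= e * cabs (w - z).
Proof.
split.
  case=> dfz; rewrite /derive => cE e e0.
  have /cvgrPdist_le/(_ (e%:C)%C) : (fun h : CC R => h^-1 *: ((f \o shift z) (h *: 1) - f z)) @ 0^' --> c.
    by rewrite -cE; exact: dfz.
  rewrite ltcR => /(_ e0); rewrite near_withinE => /nbhs_CCP[d d0 H].
  exists d => // w wd.
  have [->|wz] := eqVneq w z; first by rewrite !subrr mulr0 subrr cabs0 mulr0.
  have := H (w - z); rewrite subr0 => /(_ wd).
  rewrite subr_eq0 => /(_ wz) /=.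
  rewrite [(w - z) *: (1 : CC R)]mulr1 subrK cabsE lecR -[_ *: _]/(_ * _).
  move=> Hc.
  have -> : f w - f z - c * (w - z) =
     - ((w - z) * (c - (w - z)^-1 * (f w - f z))).
    have : w - z != 0 by rewrite subr_eq0.
    move: (w - z) (f w - f z) => x y x0.
    by rewrite [x * (c - _)]mulrBr [x * (_ * _)]mulrA divff// mul1r opprB [x * c]mulrC.
  by rewrite cabsN cabsM mulrC ler_wpM2r ?cabs_ge0.
move=> H.
have F : (fun h : CC R => h^-1 *: ((f \o shift z) (h *: 1) - f z)) @ 0^' --> c.
  apply/cvgrPdist_le => -[e e'] /=; rewrite ltcE /= => /andP[/eqP e'0 e0].
  have [d d0 Hd] := H e e0.
  rewrite near_withinE; apply/nbhs_CCP; exists d => // h; rewrite subr0 => hd h0 /=.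
  rewrite [h *: (1 : CC R)]mulr1 -[_ *: _]/(_ * _).
  have := Hd (h + z); rewrite addrK => /(_ hd) Hc.
  rewrite cabsE lecE /= e'0 eqxx /=.
  rewrite -(ler_pM2r (_ : 0 < cabs h)) ?cabs_gt0// -cabsM.
  rewrite mulrBl mulrAC mulVf// mul1r -cabsN opprB.
  by [].
apply: DeriveDef; first exact: cvgP F.
by apply: cvg_lim => //; exact: F.
Qed.

Lemma cdiff_derivable f z c : cdiff f z c -> derivable f z 1.
Proof. by case. Qed.

Lemma cdiff_cderiv f z c : cdiff f z c -> cderiv f z = c.
Proof. by rewrite /cderiv derive1E; case. Qed.

Lemma derivable_cdiff f z : derivable f z 1 -> cdiff f z (cderiv f z).
Proof. by move=> H; rewrite /cderiv derive1E; apply/derivableP. Qed.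

Lemma cdiff_cst (c : CC R) z : cdiff (fun=> c) z 0.
Proof. exact: is_derive_cst. Qed.

Lemma cdiff_id z : cdiff (fun z => z) z 1.
Proof. exact: is_derive_id. Qed.

Lemma cdiffD f g z a b : cdiff f z a -> cdiff g z b ->
  cdiff (fun z => f z + g z) z (a + b).
Proof. by move=> fa gb; exact: is_deriveD. Qed.

Lemma cdiffN f z a : cdiff f z a -> cdiff (fun z => - f z) z (- a).
Proof. by move=> fa; exact: is_deriveN. Qed.

Lemma cdiffB f g z a b : cdiff f z a -> cdiff g z b ->
  cdiff (fun z => f z - g z) z (a - b).
Proof. by move=> fa gb; exact: (cdiffD fa (cdiffN gb)). Qed.

Lemma cdiffM f g z a b : cdiff f z a -> cdiff g z b ->
  cdiff (fun z => f z * g z) z (a * g z + f z * b).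
Proof.
move=> fa gb; have H := is_deriveM fa gb; apply: (is_derive_eq H).
by rewrite addrC; congr (_ + _); exact: mulrC.
Qed.

Lemma cdiffZ (k : CC R) f z a : cdiff f z a -> cdiff (fun z => k * f z) z (k * a).
Proof. by move=> fa; exact: is_deriveZ. Qed.

Lemma cdiffV f z a : f z != 0 -> cdiff f z a ->
  cdiff (fun z => (f z)^-1) z (- a / f z ^+ 2).
Proof.
move=> fz0 [dfa <-]; apply: DeriveDef; first exact: derivableV.
by rewrite deriveV// scaleNr -[_ *: _]/(_ * _) mulNr mulrC.
Qed.

Lemma cdiff_comp f g z a b : cdiff f (g z) a -> cdiff g z b ->
  cdiff (fun z => f (g z)) z (a * b).
Proof.
move=> /cdiffP fa /cdiffP gb; apply/cdiffP => e e0.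
(* K bounds |g w - g z| / |w - z| near z because e2 <= 1. The linearization error of f then costs e1
   K = e/2, and that of g costs |a| e2 <= e/2. *)
pose K := cabs b + 1.
have K0 : 0 < K by rewrite ltr_wpDl ?cabs_ge0.
pose e1 := e / 2 / K; pose e2 := Num.min 1 (e / 2 / (cabs a + 1)).
have a0 : 0 < cabs a + 1 by rewrite ltr_wpDl ?cabs_ge0.
have e10 : 0 < e1 by rewrite /e1 !divr_gt0.
have e20 : 0 < e2 by rewrite /e2 lt_min ltr01 !divr_gt0.
have [d1 d10 H1] := fa _ e10.
have [d2 d20 H2] := gb _ e20.
exists (Num.min d2 (d1 / K)); first by rewrite lt_min d20 divr_gt0.
move=> w; rewrite lt_min => /andP[wd2 wd1].
have gw := H2 w wd2.
have gK : cabs (g w - g z) <= K * cabs (w - z).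
  rewrite -(subrK (b * (w - z)) (g w - g z)) (le_trans (cabsD _ _))//.
  rewrite cabsM /K mulrDl mul1r addrC lerD2l (le_trans gw)// ler_piMl ?cabs_ge0//.
  by rewrite /e2 ge_min lexx.
have gd1 : cabs (g w - g z) < d1.
  by rewrite (le_lt_trans gK)// mulrC -ltr_pdivlMr.
have fw := H1 _ gd1.
have -> : f (g w) - f (g z) - a * b * (w - z) =
  (f (g w) - f (g z) - a * (g w - g z)) + a * (g w - g z - b * (w - z)) by ring.
rewrite (le_trans (cabsD _ _))// cabsM.
apply: (@le_trans _ _ (e1 * (K * cabs (w - z)) + cabs a * (e2 * cabs (w - z)))).
  rewrite lerD//; first by rewrite (le_trans fw)// ler_pM2l.
  by rewrite ler_wpM2l ?cabs_ge0.
rewrite !mulrA -mulrDl ler_wpM2r ?cabs_ge0// /e1 divfK ?gt_eqF//.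
rewrite [leRHS](splitr e) lerD2l.
apply: (@le_trans _ _ ((cabs a + 1) * (e / 2 / (cabs a + 1)))).
  apply: ler_pM; [exact: cabs_ge0|exact: ltW|by rewrite lerDl|].
  by rewrite /e2 ge_min lexx orbT.
by rewrite mulrC divfK ?gt_eqF.
Qed.

Lemma cdiff_continuous f z c : cdiff f z c ->
  forall e : R, 0 < e -> exists2 d : R, 0 < d &
    forall w, cabs (w - z) < d -> cabs (f w - f z) < e.
Proof.
move=> [/derivable1_diffP/differentiable_continuous cf _] e e0.
have /cvgrPdist_lt/(_ (e%:C)%C) := cf.
rewrite ltcR => /(_ e0)/nbhs_CCP[d d0 H]; exists d => // w /H.
by rewrite cabsE ltcR cabs_distC.
Qed.

Lemma cdiff_near f g z c (d : R) : 0 < d ->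
  (forall w, cabs (w - z) < d -> f w = g w) -> cdiff f z c -> cdiff g z c.
Proof.
move=> d0 fg /cdiffP fc; apply/cdiffP => e /fc[d' d'0 H].
exists (Num.min d d'); first by rewrite lt_min d0.
move=> w; rewrite lt_min => /andP[wd wd'].
by rewrite -!fg ?subrr ?cabs0// H.
Qed.

Lemma in_disc_ball z : in_disc z -> exists2 d : R, 0 < d &
  forall w, cabs (w - z) < d -> in_disc w.
Proof.
move=> /in_discP z1; exists (1 - cabs z); first by rewrite subr_gt0.
move=> w wz; apply/in_discP; rewrite -(subrK z w).
by rewrite (le_lt_trans (cabsD _ _))// -ltrBrDr.
Qed.

Lemma eq_holo f g : (forall z, in_disc z -> f z = g z) -> holo f -> holo g.
Proof.
move=> fg hf z zD; have [d d0 dD] := in_disc_ball zD.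
apply: cdiff_derivable; apply: (cdiff_near d0 _ (derivable_cdiff (hf z zD))).
by move=> w /dD /fg.
Qed.

Lemma eq_cderiv f g z : holo f -> (forall z, in_disc z -> f z = g z) ->
  in_disc z -> cderiv f z = cderiv g z.
Proof.
move=> hf fg zD; have [d d0 dD] := in_disc_ball zD.
apply/esym/cdiff_cderiv; apply: (cdiff_near d0 _ (derivable_cdiff (hf z zD))).
by move=> w /dD /fg.
Qed.

Lemma holo_cdiff f z : holo f -> in_disc z -> cdiff f z (cderiv f z).
Proof. by move=> hf zD; apply/derivable_cdiff/hf. Qed.

Lemma holo_cst (c : CC R) : holo (fun=> c).
Proof. by move=> z _; exact: cdiff_derivable (cdiff_cst c z). Qed.

Lemma holo_id : holo (fun z : CC R => z).
Proof. by move=> z _; exact: cdiff_derivable (cdiff_id z). Qed.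

Lemma holoD f g : holo f -> holo g -> holo (fun z => f z + g z).
Proof.
by move=> hf hg z zD; exact: cdiff_derivable (cdiffD (holo_cdiff hf zD) (holo_cdiff hg zD)).
Qed.

Lemma holoN f : holo f -> holo (fun z => - f z).
Proof. by move=> hf z zD; exact: cdiff_derivable (cdiffN (holo_cdiff hf zD)). Qed.

Lemma holoB f g : holo f -> holo g -> holo (fun z => f z - g z).
Proof. by move=> hf hg; exact: (holoD hf (holoN hg)). Qed.

Lemma holoM f g : holo f -> holo g -> holo (fun z => f z * g z).
Proof.
by move=> hf hg z zD; exact: cdiff_derivable (cdiffM (holo_cdiff hf zD) (holo_cdiff hg zD)).
Qed.

Lemma holoV f : holo f -> (forall z, in_disc z -> f z != 0) ->
  holo (fun z => (f z)^-1).
Proof.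
by move=> hf f0 z zD; exact: cdiff_derivable (cdiffV (f0 _ zD) (holo_cdiff hf zD)).
Qed.

Lemma holo_comp f g : holo f -> selfmap g -> holo (fun z => f (g z)).
Proof.
move=> hf [hg gD] z zD.
exact: cdiff_derivable (cdiff_comp (holo_cdiff hf (gD _ zD)) (holo_cdiff hg zD)).
Qed.

Lemma holoX f n : holo f -> holo (fun z => f z ^+ n).
Proof.
move=> hf; elim: n => [|n IH]; first exact: holo_cst.
have -> : (fun z => f z ^+ n.+1) = (fun z => f z * f z ^+ n).
  by apply/funext => z; rewrite exprS.
exact: (holoM hf IH).
Qed.

End ComplexBasics.

(** * Integrals over segments *)

Section Integrals.
Variable R : realType.
Local Notation mu := (@lebesgue_measure R).
Implicit Types (a b : R) (f g : R -> R) (F G : R -> CC R).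

Definition rcont a b f := {within `[a, b], continuous f}.

Lemma rcont_integrable a b f : rcont a b f -> mu.-integrable `[a, b] (EFin \o f).
Proof. by move=> cf; apply: continuous_compact_integrable => //; exact: segment_compact. Qed.

Lemma rcontS a b c d f : a <= c -> d <= b -> rcont a b f -> rcont c d f.
Proof.
move=> ac db; apply: continuous_subspaceW => x /=; rewrite !in_itv /= => /andP[cx xd].
by rewrite (le_trans ac) ?(le_trans xd).
Qed.

Definition rint a b f : R := Rintegral mu `[a, b] f.

Lemma eq_rint a b f g : (forall x, a <= x <= b -> f x = g x) ->
  rint a b f = rint a b g.
Proof. by move=> fg; apply: eq_Rintegral => x; rewrite inE /= in_itv /= => /fg. Qed.

Lemma rintD a b f g : rcont a b f -> rcont a b g ->
  rint a b (fun x => f x + g x) = rint a b f + rint a b g.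
Proof. by move=> cf cg; rewrite /rint RintegralD//; exact: rcont_integrable. Qed.

Lemma rintB a b f g : rcont a b f -> rcont a b g ->
  rint a b (fun x => f x - g x) = rint a b f - rint a b g.
Proof. by move=> cf cg; rewrite /rint RintegralB//; exact: rcont_integrable. Qed.

Lemma rintZ a b (k : R) f : rcont a b f ->
  rint a b (fun x => k * f x) = k * rint a b f.
Proof. by move=> cf; rewrite /rint RintegralZl//; exact: rcont_integrable. Qed.

Lemma rint_split a c b f : a <= c <= b -> rcont a b f ->
  rint a b f = rint a c f + rint c b f.
Proof.
move=> /andP[ac cb] cf; rewrite /rint.
have : `[a, b]%classic = `[a, c]%classic `|` `]c, b]%classic.
  by rewrite -itv_bndbnd_setU// bnd_simp.
move=> E; rewrite E Rintegral_setU//; last 2 first.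
- by rewrite -E; exact: rcont_integrable.
- by apply/disj_setPRL => x /=; rewrite !in_itv /= => /andP[cx _] /andP[_]; rewrite leNgt cx.
congr (_ + _); rewrite Rintegral_itv_obnd_cbnd//.
have : rcont c b f by exact: rcontS cf.
by move/rcont_integrable; apply: integrableS => //; exact: subset_itv_oc_cc.
Qed.

Lemma rint_le a b f g : rcont a b f -> rcont a b g ->
  (forall x, a <= x <= b -> f x <= g x) -> rint a b f <= rint a b g.
Proof.
move=> cf cg fg; apply: le_Rintegral; [by []|exact: rcont_integrable..|].
by move=> x; rewrite /= in_itv /=; exact: fg.
Qed.

Lemma rint_cst a b (k : R) : a <= b -> rint a b (fun=> k) = k * (b - a).
Proof.
move=> ab; rewrite /rint Rintegral_cst//= lebesgue_measure_itv /= lte_fin.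
by case: ltgtP ab => //= ->; rewrite subrr !mulr0.
Qed.

Lemma rcont_cst a b (k : R) : rcont a b (fun=> k).
Proof. by apply: continuous_subspaceT => x; exact: cst_continuous. Qed.

Lemma rint_abs_le a b f (M : R) : a <= b -> rcont a b f ->
  (forall x, a <= x <= b -> `|f x| <= M) -> `|rint a b f| <= M * (b - a).
Proof.
move=> ab cf fM; rewrite ler_norml -mulNr -!(rint_cst _ ab); apply/andP; split.
  apply: rint_le => //; first exact: rcont_cst.
  by move=> x /fM; rewrite ler_norml => /andP[].
apply: rint_le => //; first exact: rcont_cst.
by move=> x /fM; rewrite ler_norml => /andP[].
Qed.

Lemma rint_ftc a b f (df : R -> R) : a <= b ->
  (forall x : R, is_derive x (1 : R) f (df x)) -> continuous df ->
  rint a b df = f b - f a.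
Proof.
rewrite le_eqVlt => /predU1P[<- _ _|ab Df cdf].
  by rewrite /rint set_itv1 Rintegral_set1 subrr.
rewrite /rint /Rintegral (@continuous_FTC2 _ df f)//=.
- exact: continuous_subspaceT.
- split.
  + by move=> x _; case: (Df x).
  + by apply: cvg_at_right_filter; apply: differentiable_continuous;
      apply/derivable1_diffP; case: (Df a).
  + by apply: cvg_at_left_filter; apply: differentiable_continuous;
      apply/derivable1_diffP; case: (Df b).
- by move=> x _; rewrite derive1E; case: (Df x).
Qed.

Lemma rcontD a b f g : rcont a b f -> rcont a b g -> rcont a b (fun x => f x + g x).
Proof. by move=> cf cg x; apply: continuousD; [exact: cf|exact: cg]. Qed.

Lemma rcontN a b f : rcont a b f -> rcont a b (fun x => - f x).
Proof. by move=> cf x; apply: continuousN; exact: cf. Qed.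

Lemma rcontM a b f g : rcont a b f -> rcont a b g -> rcont a b (fun x => f x * g x).
Proof. by move=> cf cg x; apply: continuousM; [exact: cf|exact: cg]. Qed.

(** * Segment integrals of complex-valued functions, taken componentwise *)

Definition ccont a b F :=
  rcont a b (fun x => complex.Re (F x)) /\ rcont a b (fun x => complex.Im (F x)).

Definition cint a b F : CC R :=
  (rint a b (fun x => complex.Re (F x)) +i* rint a b (fun x => complex.Im (F x)))%C.

Lemma ccP (z w : CC R) : complex.Re z = complex.Re w -> complex.Im z = complex.Im w -> z = w.
Proof. by case: z w => [? ?] [? ?] /= -> ->. Qed.

Lemma ReD (z w : CC R) : complex.Re (z + w) = complex.Re z + complex.Re w.
Proof. by case: z w => [? ?] [? ?]. Qed.
Lemma ImD (z w : CC R) : complex.Im (z + w) = complex.Im z + complex.Im w.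
Proof. by case: z w => [? ?] [? ?]. Qed.
Lemma ReN (z : CC R) : complex.Re (- z) = - complex.Re z.
Proof. by case: z => [? ?]. Qed.
Lemma ImN (z : CC R) : complex.Im (- z) = - complex.Im z.
Proof. by case: z => [? ?]. Qed.
Lemma ReM (z w : CC R) : complex.Re (z * w) =
  complex.Re z * complex.Re w - complex.Im z * complex.Im w.
Proof. by case: z w => [? ?] [? ?]. Qed.
Lemma ImM (z w : CC R) : complex.Im (z * w) =
  complex.Re z * complex.Im w + complex.Im z * complex.Re w.
Proof. by case: z w => [? ?] [? ?]. Qed.
Definition ccE := (ReD, ImD, ReN, ImN, ReM, ImM).

Lemma ccont_cst a b (k : CC R) : ccont a b (fun=> k).
Proof. by split; exact: rcont_cst. Qed.

Lemma eq_rcont a b f g : f =1 g -> rcont a b f -> rcont a b g.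
Proof. by move=> /funext ->. Qed.

Lemma ccontD a b F G : ccont a b F -> ccont a b G -> ccont a b (fun x => F x + G x).
Proof.
move=> [? ?] [? ?]; split.
  by apply: (eq_rcont (fun x => esym (ReD _ _))); exact: rcontD.
by apply: (eq_rcont (fun x => esym (ImD _ _))); exact: rcontD.
Qed.

Lemma ccontN a b F : ccont a b F -> ccont a b (fun x => - F x).
Proof.
move=> [? ?]; split.
  by apply: (eq_rcont (fun x => esym (ReN _))); exact: rcontN.
by apply: (eq_rcont (fun x => esym (ImN _))); exact: rcontN.
Qed.

Lemma ccontM a b F G : ccont a b F -> ccont a b G -> ccont a b (fun x => F x * G x).
Proof.
move=> [? ?] [? ?]; split.
  apply: (eq_rcont (fun x => esym (ReM _ _))).
  by apply: rcontD; [exact: rcontM|apply: rcontN; exact: rcontM].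
by apply: (eq_rcont (fun x => esym (ImM _ _))); apply: rcontD; exact: rcontM.
Qed.

Lemma ccontB a b F G : ccont a b F -> ccont a b G -> ccont a b (fun x => F x - G x).
Proof. by move=> cF cG; apply: ccontD => //; exact: ccontN. Qed.

Lemma eq_cint a b F G : (forall x, a <= x <= b -> F x = G x) -> cint a b F = cint a b G.
Proof.
by move=> FG; congr (_ +i* _)%C; apply: eq_rint => x /FG ->.
Qed.

Lemma cintD a b F G : ccont a b F -> ccont a b G ->
  cint a b (fun x => F x + G x) = cint a b F + cint a b G.
Proof.
move=> [? ?] [? ?]; rewrite /cint; apply: ccP; rewrite ?ccE /= -rintD//;
by apply: eq_rint => x _; rewrite ccE.
Qed.

Lemma cintM (k : CC R) a b F : ccont a b F ->
  cint a b (fun x => k * F x) = k * cint a b F.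
Proof.
move=> [? ?]; rewrite /cint; apply: ccP; rewrite ?ccE /= -!rintZ//.
  rewrite -rintB; try by apply: rcontM => //; exact: rcont_cst.
  by apply: eq_rint => x _; rewrite ccE.
rewrite -rintD; try by apply: rcontM => //; exact: rcont_cst.
by apply: eq_rint => x _; rewrite ccE.
Qed.

Lemma cintN a b F : ccont a b F -> cint a b (fun x => - F x) = - cint a b F.
Proof.
move=> cF; rewrite -[RHS]mulN1r -cintM//; apply: eq_cint => x _; by rewrite mulN1r.
Qed.

Lemma cintB a b F G : ccont a b F -> ccont a b G ->
  cint a b (fun x => F x - G x) = cint a b F - cint a b G.
Proof. by move=> cF cG; rewrite cintD ?cintN//; exact: ccontN. Qed.

Lemma cint_split a c b F : a <= c <= b -> ccont a b F ->
  cint a b F = cint a c F + cint c b F.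
Proof.
move=> acb [? ?]; rewrite /cint; apply: ccP; rewrite ?ccE /=; exact: rint_split.
Qed.

Lemma cint_cst a b (k : CC R) : a <= b -> cint a b (fun=> k) = k * ((b - a)%:C)%C.
Proof.
by move=> ab; apply: ccP; rewrite ?ccE /= rint_cst//; ring.
Qed.

(* the factor 2 comes from bounding real and imaginary parts separately *)
Lemma cint_abs_le a b F (M : R) : a <= b -> ccont a b F ->
  (forall x, a <= x <= b -> cabs (F x) <= M) -> cabs (cint a b F) <= 2 * M * (b - a).
Proof.
move=> ab [cR cI] FM; rewrite (le_trans (cabs_le_ReIm _))//= -mulrA mulr_natl mulr2n lerD//.
  by apply: rint_abs_le => // x xab; rewrite (le_trans (Re_le_cabs _)) ?FM.
by apply: rint_abs_le => // x xab; rewrite (le_trans (Im_le_cabs _)) ?FM.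
Qed.

Lemma ccont_dist a b F :
  (forall x, a <= x <= b -> forall e : R, 0 < e -> exists2 d : R, 0 < d &
    forall y, a <= y <= b -> `|y - x| < d -> cabs (F y - F x) < e) -> ccont a b F.
Proof.
move=> H; suff P (p : CC R -> R) : (forall z w, `|p z - p w| <= cabs (z - w)) ->
    rcont a b (fun x => p (F x)).
  split; apply: P => z w.
    by rewrite -ReN -ReD Re_le_cabs.
  by rewrite -ImN -ImD Im_le_cabs.
move=> pL; apply/subspace_continuousP => x /= xab.
move: (xab); rewrite in_itv /= => /H{}H.
apply/cvgrPdist_lt => e /H[d d0 Hd].
near=> y; apply: (le_lt_trans (pL _ _)); rewrite cabs_distC; apply: Hd.
  by have : y \in `[a, b] by near: y; exact: withinT.
rewrite distrC; near: y; apply: cvg_within.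
exact: nbhsx_ballx.
Unshelve. all: by end_near.
Qed.

End Integrals.

(** * Goursat's theorem *)

Section Goursat.
Variable R : realType.
Implicit Types (a b c d s t : R) (g h : R -> R -> CC R).

Local Notation imag_i := ((0 +i* 1)%C : CC R).

(** The counterclockwise boundary integral of g d(s + i t). The coordinates s and t are kept as two
    real arguments because the rectangle will be one in logarithmic polar coordinates. *)
Definition rect_int g a b c d : CC R :=
  cint a b (fun x => g x c) - cint a b (fun x => g x d)
  + imag_i * (cint c d (fun y => g b y) - cint c d (fun y => g a y)).

(** Complex differentiability in s + i t with derivative k: the differential is multiplication by a
    complex number, not an arbitrary real-linear map. *)
Definition lin_approx g s t (k : CC R) := forall e : R, 0 < e ->
  exists2 r : R, 0 < r & forall s' t', `|s' - s| < r -> `|t' - t| < r ->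
    cabs (g s' t' - g s t - k * ((s' - s) +i* (t' - t))%C) <= e * (`|s' - s| + `|t' - t|).

Lemma cabs_pair_le (x y : R) : cabs ((x +i* y)%C : CC R) <= `|x| + `|y|.
Proof. exact: (cabs_le_ReIm ((x +i* y)%C : CC R)). Qed.

Lemma lin_approx_cont g s t k : lin_approx g s t k -> forall e : R, 0 < e ->
  exists2 r : R, 0 < r & forall s' t', `|s' - s| < r -> `|t' - t| < r ->
    cabs (g s' t' - g s t) < e.
Proof.
move=> H e e0; have [r r0 Hr] := H 1 ltr01.
pose M := cabs k + 1.
have M0 : 0 < M by rewrite ltr_wpDl ?cabs_ge0.
exists (Num.min r (e / M / 2)); first by rewrite lt_min r0 !divr_gt0.
move=> s' t'; rewrite !lt_min => /andP[s1 s2] /andP[t1 t2].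
have {}Hr := Hr _ _ s1 t1.
rewrite -(subrK (k * ((s' - s) +i* (t' - t))%C) (g s' t' - g s t)).
rewrite (le_lt_trans (cabsD _ _))// cabsM.
apply: (@le_lt_trans _ _ (M * (`|s' - s| + `|t' - t|))).
  rewrite /M mulrDl addrC lerD// ler_wpM2l ?cabs_ge0//; exact: cabs_pair_le.
by rewrite mulrC -ltr_pdivlMr// [ltRHS]splitr ltrD.
Qed.

Section Rect.
Variables (g : R -> R -> CC R) (a0 b0 c0 d0 : R).
Hypothesis Hg : forall s t, a0 <= s <= b0 -> c0 <= t <= d0 -> exists k, lin_approx g s t k.

Let conth a b t : a0 <= a -> b <= b0 -> c0 <= t <= d0 -> ccont a b (fun x => g x t).
Proof.
move=> a0a bb0 tcd; apply: ccont_dist => x /andP[ax xb] e e0.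
have xab : a0 <= x <= b0 by rewrite (le_trans a0a)// (le_trans xb).
have [k /lin_approx_cont/(_ e e0)[r r0 H]] := Hg xab tcd.
by exists r => // y _ yx; apply: H; rewrite // subrr normr0.
Qed.

Let contv c d s : c0 <= c -> d <= d0 -> a0 <= s <= b0 -> ccont c d (fun y => g s y).
Proof.
move=> c0c dd0 sab; apply: ccont_dist => x /andP[cx xd] e e0.
have xcd : c0 <= x <= d0 by rewrite (le_trans c0c)// (le_trans xd).
have [k /lin_approx_cont/(_ e e0)[r r0 H]] := Hg sab xcd.
by exists r => // y _ yx; apply: H; rewrite // subrr normr0.
Qed.

Lemma rect_int_split a m b c n d : a0 <= a -> a <= m <= b -> b <= b0 ->
  c0 <= c -> c <= n <= d -> d <= d0 ->
  rect_int g a b c d = rect_int g a m c n + rect_int g m b c n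
                     + rect_int g a m n d + rect_int g m b n d.
Proof.
move=> a0a amb bb0 c0c cnd dd0; rewrite /rect_int.
move/andP: (amb) => [am mb]; move/andP: (cnd) => [cn nd].
have cab : c0 <= c <= d0 by rewrite c0c (le_trans cn)// (le_trans nd).
have dab : c0 <= d <= d0 by rewrite dd0 andbT (le_trans c0c)// (le_trans cn).
have aab : a0 <= a <= b0 by rewrite a0a (le_trans am)// (le_trans mb).
have bab : a0 <= b <= b0 by rewrite bb0 andbT (le_trans a0a)// (le_trans am).
rewrite (cint_split amb (conth a0a bb0 cab)) (cint_split amb (conth a0a bb0 dab)).
rewrite (cint_split cnd (contv c0c dd0 aab)) (cint_split cnd (contv c0c dd0 bab)).
ring.
Qed.

(** The part of a linear approximation that drops out in Goursat's estimate; its four side integrals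
    are computed explicitly. *)
Let rect_int_aff (al k : CC R) a b c d : a <= b -> c <= d ->
  rect_int (fun s t => al + k * (s +i* t)%C) a b c d = 0.
Proof.
move=> ab cd.
have idh (p q y : R) : ccont p q (fun x => (x +i* y)%C).
  split; first by apply: continuous_subspaceT => x; exact: cvg_id.
  exact: rcont_cst.
have idv (p q x : R) : ccont p q (fun y => (x +i* y)%C).
  split; first exact: rcont_cst.
  by apply: continuous_subspaceT => ?; exact: cvg_id.
have rid (p q : R) : p <= q -> rint p q (fun x => x) = (q ^+ 2 - p ^+ 2) / 2.
  move=> pq.
  have H (x : R) : is_derive x (1 : R) (fun x : R => 2^-1 * x ^+ 2) x.
    have H1 : is_derive x (1 : R) (fun x : R => x ^+ 2) (2 * x).
      have H1 := is_deriveM (is_derive_id x (1 : R)) (is_derive_id x (1 : R)).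
      by apply: (is_derive_eq H1); rewrite mulr_natl mulr2n -[_ *: _]/(x * 1) mulr1.
    have := is_deriveZ 2^-1 H1.
    by rewrite (_ : 2^-1 *: (2 * x) = x)//; exact: mulKf.
  rewrite (rint_ftc pq H); last by move=> x; exact: cvg_id.
  by rewrite mulrC [2^-1 * _]mulrC mulrBl.
have inth (y : R) : cint a b (fun x => (x +i* y)%C) = ((b ^+ 2 - a ^+ 2) / 2 +i* (y * (b - a)))%C.
  by rewrite /cint /= rid// rint_cst.
have intv (x : R) : cint c d (fun y => (x +i* y)%C) = ((x * (d - c)) +i* ((d ^+ 2 - c ^+ 2) / 2))%C.
  by rewrite /cint /= rid// rint_cst.
have cM (p q : R) F : ccont p q F -> ccont p q (fun x => k * F x).
  by move=> cF; apply: ccontM => //; exact: ccont_cst.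
have ch (y : R) : cint a b (fun x => al + k * (x +i* y)%C) =
    al * ((b - a)%:C)%C + k * ((b ^+ 2 - a ^+ 2) / 2 +i* (y * (b - a)))%C.
  by rewrite (cintD (@ccont_cst R a b al) (cM _ _ _ (idh a b y))) (cint_cst _ ab) (cintM k (idh a b y)) inth.
have cv (x : R) : cint c d (fun y => al + k * (x +i* y)%C) =
    al * ((d - c)%:C)%C + k * ((x * (d - c)) +i* ((d ^+ 2 - c ^+ 2) / 2))%C.
  by rewrite (cintD (@ccont_cst R c d al) (cM _ _ _ (idv c d x))) (cint_cst _ cd) (cintM k (idv c d x)) intv.
rewrite /rect_int !ch !cv; clear ch cv cM; case: k => k1 k2; case: al => al1 al2.
by apply: ccP; rewrite ?ccE /=; field.
Qed.

(** Subtracting the affine approximation leaves at most M = e (b - a + d - c) on the sides. A side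
    of length l contributes at most 2 M l, and the four lengths add up to 2 (b - a + d - c), whence
    the constant 4. *)
Let rect_int_le (s0 t0 : R) (k : CC R) (e a b c d : R) : 0 <= e ->
  a0 <= a -> a <= b -> b <= b0 -> c0 <= c -> c <= d -> d <= d0 ->
  a <= s0 <= b -> c <= t0 <= d ->
  (forall s t, a <= s <= b -> c <= t <= d ->
    cabs (g s t - g s0 t0 - k * ((s - s0) +i* (t - t0))%C) <= e * (`|s - s0| + `|t - t0|)) ->
  cabs (rect_int g a b c d) <= 4 * e * (b - a + (d - c)) ^+ 2.
Proof.
move=> e0 a0a ab bb0 c0c cd dd0 /andP[as0 sb] /andP[ct0 tb] H.
pose A (s t : R) : CC R := g s0 t0 - k * (s0 +i* t0)%C + k * (s +i* t)%C.
have E : rect_int g a b c d = rect_int (fun s t => g s t - A s t) a b c d.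
  have RA : rect_int A a b c d = 0 := rect_int_aff _ k ab cd.
  have cAh (p q y : R) : ccont p q (fun x => A x y).
    apply: ccontD; first exact: ccont_cst.
    apply: ccontM; first exact: ccont_cst.
    split; last exact: rcont_cst.
    by apply: continuous_subspaceT => x; exact: cvg_id.
  have cAv (p q x : R) : ccont p q (fun y => A x y).
    apply: ccontD; first exact: ccont_cst.
    apply: ccontM; first exact: ccont_cst.
    split; first exact: rcont_cst.
    by apply: continuous_subspaceT => ?; exact: cvg_id.
  have lc : c0 <= c <= d0 by rewrite c0c (le_trans cd).
  have ld : c0 <= d <= d0 by rewrite dd0 (le_trans c0c).
  have la : a0 <= a <= b0 by rewrite a0a (le_trans ab).
  have lb : a0 <= b <= b0 by rewrite bb0 (le_trans a0a).
  rewrite -[LHS]subr0 -RA /rect_int.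
  rewrite (cintB (conth a0a bb0 lc) (cAh a b c)) (cintB (conth a0a bb0 ld) (cAh a b d)).
  rewrite (cintB (contv c0c dd0 la) (cAv c d a)) (cintB (contv c0c dd0 lb) (cAv c d b)).
  move: (cint a b _) (cint a b _) (cint a b _) (cint a b _) (cint c d _) (cint c d _) (cint c d _) (cint c d _) => *; ring.
have B (s t : R) : a <= s <= b -> c <= t <= d -> cabs (g s t - A s t) <= e * (b - a + (d - c)).
  move=> sab tcd; have -> : g s t - A s t = g s t - g s0 t0 - k * ((s - s0) +i* (t - t0))%C.
    have -> : ((s - s0) +i* (t - t0))%C = (s +i* t)%C - (s0 +i* t0)%C :> CC R by [].
    rewrite /A; ring.
  rewrite (le_trans (H _ _ sab tcd))// ler_wpM2l//.
  move/andP: sab => [? ?]; move/andP: tcd => [? ?].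
  by rewrite lerD// ler_norml; apply/andP; split; lra.
have cgAh (y : R) : c <= y <= d -> ccont a b (fun x => g x y - A x y).
  move=> /andP[cy yd]; apply: ccontB; first by apply: conth => //; rewrite (le_trans c0c)// (le_trans yd).
  apply: ccontD; first exact: ccont_cst.
  apply: ccontM; first exact: ccont_cst.
  split; last exact: rcont_cst.
  by apply: continuous_subspaceT => x; exact: cvg_id.
have cgAv (x : R) : a <= x <= b -> ccont c d (fun y => g x y - A x y).
  move=> /andP[ax xb]; apply: ccontB; first by apply: contv => //; rewrite (le_trans a0a)// (le_trans xb).
  apply: ccontD; first exact: ccont_cst.
  apply: ccontM; first exact: ccont_cst.
  split; first exact: rcont_cst.
  by apply: continuous_subspaceT => ?; exact: cvg_id.
have aab : a <= a <= b by rewrite lexx.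
have bab : a <= b <= b by rewrite lexx andbT.
have ccd : c <= c <= d by rewrite lexx.
have dcd : c <= d <= d by rewrite lexx andbT.
rewrite E /rect_int (le_trans (cabsD _ _))// cabsM.
have -> : cabs imag_i = 1 by rewrite /cabs /cabs2 /= expr0n expr1n add0r sqrtr1.
rewrite mul1r.
set M := e * (b - a + (d - c)) in B.
have h1 := cint_abs_le ab (cgAh _ ccd) (fun x xab => B _ _ xab ccd).
have h2 := cint_abs_le ab (cgAh _ dcd) (fun x xab => B _ _ xab dcd).
have h3 := cint_abs_le cd (cgAv _ aab) (fun x xcd => B _ _ aab xcd).
have h4 := cint_abs_le cd (cgAv _ bab) (fun x xcd => B _ _ bab xcd).
apply: le_trans (lerD (cabsB _ _) (cabsB _ _)) _.
apply: le_trans (lerD (lerD h1 h2) (lerD h4 h3)) _.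
by rewrite /M le_eqVlt; apply/orP; left; apply/eqP; ring.
Qed.

Lemma goursat : a0 <= b0 -> c0 <= d0 -> rect_int g a0 b0 c0 d0 = 0.
Proof.
move=> ab0 cd0.
pose S n := (b0 - a0) / 2 ^+ n; pose T n := (d0 - c0) / 2 ^+ n.
have S0 n : 0 <= S n by rewrite divr_ge0 ?subr_ge0 ?exprn_ge0.
have T0 n : 0 <= T n by rewrite divr_ge0 ?subr_ge0 ?exprn_ge0.
have SS n : S n = S n.+1 + S n.+1 by rewrite /S exprS invfM; field; rewrite expf_neq0.
have TT n : T n = T n.+1 + T n.+1 by rewrite /T exprS invfM; field; rewrite expf_neq0.
pose Phi0 := cabs (rect_int g a0 b0 c0 d0).
(* [p] is the lower left corner of a rectangle of the n-th bisection that still carries at least the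
   fraction 4^-n of the original integral. *)
pose P n (p : R * R) := [/\ a0 <= p.1, p.1 + S n <= b0, c0 <= p.2, p.2 + T n <= d0 &
  Phi0 / 4 ^+ n <= cabs (rect_int g p.1 (p.1 + S n) p.2 (p.2 + T n))].
(* The hypothesis [P n p] stands under the existential so that the axiom of choice yields a
   successor map defined on all pairs. *)
have step n (p : R * R) : exists p' : R * R, P n p -> [/\ P n.+1 p', p.1 <= p'.1,
    p'.1 + S n.+1 <= p.1 + S n, p.2 <= p'.2 & p'.2 + T n.+1 <= p.2 + T n].
  case: (pselect (P n p)) => [[pa pb pc pd pPhi]|]; last by exists p.
  pose Q s t := cabs (rect_int g s (s + S n.+1) t (t + T n.+1)).
  have S1 := S0 n.+1; have T1 := T0 n.+1.
  have /orP : (Phi0 / 4 ^+ n.+1 <= Q p.1 p.2) ||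
         ((Phi0 / 4 ^+ n.+1 <= Q (p.1 + S n.+1) p.2) ||
         ((Phi0 / 4 ^+ n.+1 <= Q p.1 (p.2 + T n.+1)) ||
         (Phi0 / 4 ^+ n.+1 <= Q (p.1 + S n.+1) (p.2 + T n.+1)))).
    apply: contraPT pPhi; rewrite !negb_or -!ltNge => /and4P[q1 q2 q3 q4].
    apply/negP; rewrite -ltNge (@rect_int_split _ (p.1 + S n.+1) _ _ (p.2 + T n.+1))//; last 2 first.
    - by rewrite (SS n) addrA !lerDl S1.
    - by rewrite (TT n) addrA !lerDl T1.
    have -> : p.1 + S n = p.1 + S n.+1 + S n.+1 by rewrite -addrA -SS.
    have -> : p.2 + T n = p.2 + T n.+1 + T n.+1 by rewrite -addrA -TT.
    have -> : Phi0 / 4 ^+ n = Phi0 / 4 ^+ n.+1 + Phi0 / 4 ^+ n.+1 + Phi0 / 4 ^+ n.+1 + Phi0 / 4 ^+ n.+1.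
      by rewrite exprS invfM; field; rewrite expf_neq0.
    apply: le_lt_trans (cabsD _ _) _; apply: ltrD => //.
    apply: le_lt_trans (cabsD _ _) _; apply: ltrD => //.
    by apply: le_lt_trans (cabsD _ _) _; apply: ltrD.
  have W s t : p.1 <= s <= p.1 + S n.+1 -> p.2 <= t <= p.2 + T n.+1 -> Phi0 / 4 ^+ n.+1 <= Q s t ->
      [/\ P n.+1 (s, t), p.1 <= s, s + S n.+1 <= p.1 + S n, p.2 <= t & t + T n.+1 <= p.2 + T n].
    move: pb pd; rewrite (SS n) (TT n) => pb pd /andP[s1 s2] /andP[t1 t2] q.
    by split; [split=> //=|..]; lra.
  have l1 : p.1 <= p.1 <= p.1 + S n.+1 by rewrite lexx lerDl.
  have l2 : p.1 <= p.1 + S n.+1 <= p.1 + S n.+1 by rewrite lexx lerDl S1.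
  have l3 : p.2 <= p.2 <= p.2 + T n.+1 by rewrite lexx lerDl.
  have l4 : p.2 <= p.2 + T n.+1 <= p.2 + T n.+1 by rewrite lexx lerDl T1.
  case=> [q|/orP[q|/orP[q|q]]].
  - by exists (p.1, p.2) => _; exact: W.
  - by exists (p.1 + S n.+1, p.2) => _; exact: W.
  - by exists (p.1, p.2 + T n.+1) => _; exact: W.
  - by exists (p.1 + S n.+1, p.2 + T n.+1) => _; exact: W.
have [F HF] : exists F : nat -> R * R -> R * R, forall n p, P n p ->
    [/\ P n.+1 (F n p), p.1 <= (F n p).1,
    (F n p).1 + S n.+1 <= p.1 + S n, p.2 <= (F n p).2 & (F n p).2 + T n.+1 <= p.2 + T n].
  have /choice[F HF] : forall np : nat * (R * R), exists p', P np.1 np.2 ->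
      [/\ P np.1.+1 p', np.2.1 <= p'.1,
    p'.1 + S np.1.+1 <= np.2.1 + S np.1, np.2.2 <= p'.2 & p'.2 + T np.1.+1 <= np.2.2 + T np.1].
    by case=> n p; exact: step.
  by exists (fun n p => F (n, p)) => n p; exact: HF (n, p).
pose p := fix p n := if n is m.+1 then F m (p m) else (a0, c0).
have S00 : S 0%N = b0 - a0 by rewrite /S expr0 divr1.
have T00 : T 0%N = d0 - c0 by rewrite /T expr0 divr1.
have Pp n : P n (p n).
  elim: n => [|n IH]; last by have [] := HF _ _ IH.
  by rewrite /P /= S00 T00 !subrKC !lexx expr0 divr1.
have mono n m : (n <= m)%N -> [/\ (p n).1 <= (p m).1, (p m).1 + S m <= (p n).1 + S n,
     (p n).2 <= (p m).2 & (p m).2 + T m <= (p n).2 + T n].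
  elim: m => [|m IH]; first by rewrite leqn0 => /eqP ->; rewrite !lexx.
  rewrite leq_eqVlt => /predU1P[->|]; first by rewrite !lexx.
  rewrite ltnS => /IH[i1 i2 i3 i4]; have [_ j1 j2 j3 j4] := HF _ _ (Pp m).
  by split; [exact: le_trans j1|exact: le_trans i2|exact: le_trans j3|exact: le_trans i4].
have lim_in (x U : nat -> R) : (forall n, 0 <= U n) ->
    (forall n m, (n <= m)%N -> x n <= x m /\ x m + U m <= x n + U n) ->
    exists l, forall n, x n <= l <= x n + U n.
  move=> U0 xU.
  have nd : nondecreasing_seq x by move=> n m /xU[].
  have ub n m : x m <= x n + U n.
    have [nm|/ltnW mn] := leqP n m.
      by rewrite (le_trans _ (xU _ _ nm).2)// lerDl.
    by rewrite (le_trans (xU _ _ mn).1)// lerDl.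
  have cx : cvgn x.
    by apply: nondecreasing_is_cvgn => //; exists (x 0%N + U 0%N) => _ [m _ <-]; exact: ub.
  exists (limn x) => n; rewrite nondecreasing_cvgn_le//=.
  by apply: limr_le => //; apply: nearW => m; exact: ub.
have [s0 Hs0] : exists l, forall n, (p n).1 <= l <= (p n).1 + S n.
  by apply: lim_in => // n m /mono[].
have [t0 Ht0] : exists l, forall n, (p n).2 <= l <= (p n).2 + T n.
  by apply: lim_in => // n m /mono[].
have s0ab : a0 <= s0 <= b0 by have := Hs0 0%N; rewrite /= S00 subrKC.
have t0cd : c0 <= t0 <= d0 by have := Ht0 0%N; rewrite /= T00 subrKC.
have [k Hk] := Hg s0ab t0cd.
apply/eqP; rewrite -cabs_eq0 -/Phi0; apply/eqP/le_anti; rewrite cabs_ge0 andbT.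
apply/ler_addgt0Pl => e e0; rewrite addr0.
pose L := b0 - a0 + (d0 - c0).
have L0 : 0 <= L by rewrite addr_ge0 ?subr_ge0.
(* Makes 4 e1 L^2 <= e, once the factors 4^-n of the retained integral and of the squared side
   lengths have cancelled. The summand 1 covers a rectangle reduced to a point. *)
pose e1 := e / (4 * (L ^+ 2 + 1)).
have L1 : 0 < L ^+ 2 + 1 by rewrite ltr_wpDl ?sqr_ge0.
have e10 : 0 < e1 by rewrite divr_gt0 ?mulr_gt0.
have [r r0 Hr] := Hk _ e10.
have [n Hn] : exists n, S n + T n < r.
  have : geometric L (2^-1 : R) @ \oo --> (0 : R).
    by apply: cvg_geometric; rewrite ger0_norm ?invr_ge0// invf_lt1 ?ltr1n.
  move=> /cvgrPdist_lt/(_ _ r0)[N _ /(_ N (leqnn _))].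
  rewrite sub0r normrN /= exprVn ger0_norm ?divr_ge0 ?exprn_ge0// => HN.
  by exists N; rewrite /S /T -mulrDl.
have [pa pb pc pd pPhi] := Pp n.
have S1 := S0 n; have T1 := T0 n.
have : Phi0 / 4 ^+ n <= 4 * e1 * (S n + T n) ^+ 2.
  apply: (le_trans pPhi).
  rewrite [X in 4 * e1 * X ^+ 2](_ : _ = (p n).1 + S n - (p n).1 + ((p n).2 + T n - (p n).2)); last by ring.
  apply: (rect_int_le (s0 := s0) (t0 := t0) (k := k)) => //; rewrite ?lerDl//; first exact: ltW.
  have := Hs0 n; have := Ht0 n => /andP[u1 u2] /andP[u3 u4].
  move=> s t /andP[v1 v2] /andP[v3 v4].
  by apply: Hr; rewrite (le_lt_trans _ Hn)// ler_norml; clear -u1 u2 u3 u4 v1 v2 v3 v4; apply/andP; split; lra.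
have -> : (S n + T n) ^+ 2 = L ^+ 2 / 4 ^+ n.
  rewrite /S /T -mulrDl expr_div_n -exprM mulnC exprM; congr (_ / _ ^+ _).
  by rewrite expr2 -natrM.
rewrite mulrA ler_pM2r ?invr_gt0 ?exprn_gt0// => /le_trans; apply.
have -> : 4 * e1 * L ^+ 2 = e * (L ^+ 2 / (L ^+ 2 + 1)).
  by rewrite /e1; field; rewrite gt_eqF.
rewrite ler_piMr//; first exact: ltW.
by rewrite ler_pdivrMr// mul1r lerDl.
Qed.
End Rect.
End Goursat.

(** * The complex exponential and circles *)

Section Exponential.
Variable R : realType.
Implicit Types (z w : CC R) (f g : CC R -> CC R).

Lemma rdiffP (f : R -> R) (x c : R) : is_derive x (1 : R) f c ->
  forall e : R, 0 < e -> exists2 d : R, 0 < d &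
    forall y, `|y - x| < d -> `|f y - f x - c * (y - x)| <= e * `|y - x|.
Proof.
case=> dfx; rewrite /derive => cE e e0.
have /cvgrPdist_le/(_ e e0) :
    (fun h : R => h^-1 *: ((f \o shift x) (h *: (1 : R)) - f x)) @ 0^' --> c.
  by rewrite -cE; exact: dfx.
rewrite near_withinE => /nbhs_ballP[d /= d0 H].
exists d => // y yd.
have [->|yx] := eqVneq y x; first by rewrite !subrr mulr0 subrr normr0 mulr0.
have := H (y - x); rewrite /ball /= sub0r normrN subr_eq0 => /(_ yd yx) /=.
rewrite [(y - x) *: (1 : R)]mulr1 subrK -[_ *: _]/(_ * _) => Hc.
have y0 : y - x != 0 by rewrite subr_eq0.
have -> : f y - f x - c * (y - x) = - ((y - x) * (c - (y - x)^-1 * (f y - f x))).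
  by field.
by rewrite normrN normrM mulrC ler_wpM2r.
Qed.

Definition cexp z : CC R :=
  ((expR (complex.Re z) * cos (complex.Im z)) +i* (expR (complex.Re z) * sin (complex.Im z)))%C.

Lemma cexpD z w : cexp (z + w) = cexp z * cexp w.
Proof.
by apply: ccP; rewrite ?ccE /= ?ccE expRD ?cosD ?sinD; ring.
Qed.

Lemma cexp0 : cexp 0 = 1.
Proof. by rewrite /cexp /= expR0 cos0 sin0 mulr0 mulr1. Qed.

Lemma cabs_cexp z : cabs (cexp z) = expR (complex.Re z).
Proof.
rewrite /cabs /cabs2 /= !exprMn -mulrDr cos2Dsin2 mulr1 sqrtr_sqr ger0_norm// expR_ge0.
Qed.

Lemma cexp_neq0 z : cexp z != 0.
Proof. by rewrite -cabs_eq0 cabs_cexp gt_eqF ?expR_gt0. Qed.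

Lemma cdiff_cexp0 : cdiff cexp 0 1.
Proof.
apply/cdiffP => e e0.
(* The four remainders below are at most 1, 3, 3 and 2 times e1 r, so 16 leaves room; e1 <= 1 gives
   |e^x - 1| <= 2 |x|. *)
have [e1 [e10 e1le1 e1le]] : exists e1 : R, [/\ 0 < e1, e1 <= 1 & e1 <= e / 16].
  exists (Num.min 1 (e / 16)); split; first by rewrite lt_min ltr01 divr_gt0.
  - by rewrite ge_min lexx.
  - by rewrite ge_min lexx orbT.
have [d1 d10 H1] := rdiffP (is_derive_expR (0 : R)) e10.
have [d2 d20 H2] := rdiffP (is_derive_cos (0 : R)) e10.
have [d3 d30 H3] := rdiffP (is_derive_sin (0 : R)) e10.
exists (Num.min (Num.min d1 d2) (Num.min d3 e1)); first by rewrite !lt_min d10 d20 d30 e10.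
move=> [x y]; rewrite subr0 !lt_min => /andP[/andP[h1 h2] /andP[h3 h4]].
have hx := Re_le_cabs ((x +i* y)%C : CC R).
have hy := Im_le_cabs ((x +i* y)%C : CC R).
rewrite /= in hx hy.
have D1 : `|x - 0| < d1 by rewrite subr0 (le_lt_trans hx).
have D2 : `|y - 0| < d2 by rewrite subr0 (le_lt_trans hy).
have D3 : `|y - 0| < d3 by rewrite subr0 (le_lt_trans hy).
have {D1} := H1 x D1; rewrite subr0 expR0 mul1r => {}H1.
have {D2} := H2 y D2; rewrite cos0 sin0 !oppr0 !addr0 mul0r subr0 => {}H2.
have {D3} := H3 y D3; rewrite sin0 cos0 mul1r !subr0 => {}H3.
set r := cabs _ in hx hy h1 h2 h3 h4 *.
rewrite cexp0 mul1r.
have -> : cexp (x +i* y)%C - 1 - (x +i* y)%C =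
   ((expR x * cos y - 1 - x) +i* (expR x * sin y - y))%C.
  by apply: ccP; rewrite ?ccE /=; ring.
rewrite (le_trans (cabs_le_ReIm _))//=.
have r0 : 0 <= r := cabs_ge0 _.
have r1 : r <= 1 by rewrite ltW// (lt_le_trans h4).
have x1 : `|x| <= 1 by rewrite (le_trans hx).
have e1r : e1 * `|x| <= e1 * r by rewrite ler_wpM2l// ltW.
have e1r' : e1 * `|y| <= e1 * r by rewrite ler_wpM2l// ltW.
have ex1 : `|expR x - 1| <= 2 * `|x|.
  rewrite -(subrK x (expR x - 1)) (le_trans (ler_normD _ _))//.
  rewrite [2 * _]mulr_natl mulr2n lerD2r (le_trans H1)// ler_piMl//.
have ex3 : expR x <= 3.
  move: ex1; rewrite ler_norml => /andP[_]; lra.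
have E0 := expR_ge0 x.
have -> : expR x * cos y - 1 - x = (expR x - 1 - x) + expR x * (cos y - 1) by ring.
have -> : expR x * sin y - y = expR x * (sin y - y) + (expR x - 1) * y by ring.
have A2 : `|expR x * (cos y - 1)| <= 3 * (e1 * r).
  by rewrite normrM (ger0_norm E0); apply: ler_pM => //; exact: le_trans H2 _.
have A3 : `|expR x * (sin y - y)| <= 3 * (e1 * r).
  by rewrite normrM (ger0_norm E0); apply: ler_pM => //; exact: le_trans H3 _.
have A4 : `|(expR x - 1) * y| <= 2 * (e1 * r).
  rewrite normrM; apply: (le_trans (ler_pM _ _ ex1 hy)) => //.
  by rewrite -mulrA ler_pM2l// ler_wpM2r// (le_trans hx)// ltW.
have B : 16 * (e1 * r) <= e * r.
  by rewrite mulrA ler_wpM2r// mulrC -ler_pdivlMr.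
have B0 : 0 <= e1 * r by rewrite mulr_ge0// ltW.
apply: le_trans (lerD (ler_normD _ _) (ler_normD _ _)) _.
have A1 : `|expR x - 1 - x| <= e1 * r by rewrite (le_trans H1).
apply: le_trans (lerD (lerD A1 A2) (lerD A3 A4)) _.
move: (e1 * r) (e * r) B B0 => a b; lra.
Qed.

Lemma cdiff_cexp z : cdiff cexp z (cexp z).
Proof.
have := cdiff_comp (f := cexp) (g := fun w => w - z) (z := z) (b := 1).
rewrite subrr => /(_ 1 cdiff_cexp0).
have cz : cdiff (fun w => w - z) z 1.
  by rewrite -[1]subr0; apply: cdiffB; [exact: cdiff_id|exact: cdiff_cst].
move=> /(_ cz) H.
have := cdiffZ (cexp z) H; rewrite !mulr1.
by congr cdiff; apply/funext => w; rewrite -cexpD addrC subrK.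
Qed.

(** * Polar coordinates and uniform estimates on circles *)

Lemma cabs_polar (r t : R) : 0 <= r -> cabs (polar r t) = r.
Proof.
move=> r0; rewrite /cabs /cabs2 /= !exprMn -mulrDr cos2Dsin2 mulr1 sqrtr_sqr.
by rewrite ger0_norm.
Qed.

Lemma polarX (r t : R) n : polar r t ^+ n = polar (r ^+ n) (t *+ n).
Proof.
elim: n => [|n IH]; first by rewrite !expr0 mulr0n /polar cos0 sin0 mulr1 mulr0.
rewrite exprS IH mulrS; apply: ccP; rewrite ?ccE /= ?cosD ?sinD exprS; ring.
Qed.

Lemma polar_neq0 (r t : R) : 0 < r -> polar r t != 0.
Proof. by move=> r0; rewrite -cabs_eq0 cabs_polar ?ltW// gt_eqF. Qed.

(** Kept apart from [cdiff] because Cauchy's theorem will be applied to a function known only to be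
    continuous at one point. *)
Definition ccts f z := forall e : R, 0 < e -> exists2 d : R, 0 < d &
  forall w, cabs (w - z) < d -> cabs (f w - f z) < e.

Lemma cdiff_ccts f z c : cdiff f z c -> ccts f z.
Proof. exact: cdiff_continuous. Qed.

Lemma cos_lip (x y : R) : `|cos x - cos y| <= `|x - y|.
Proof.
wlog xy : x y / y <= x.
  by move=> H; case: (leP y x) => [/H//|/ltW/H]; rewrite distrC [leRHS]distrC.
have [|c _ ->] := @MVT_segment R cos (fun x => - sin x) y x xy.
  by apply: continuous_subspaceT; exact: continuous_cos.
by rewrite normrM normrN ler_piMl// sin_max.
Qed.

Lemma sin_lip (x y : R) : `|sin x - sin y| <= `|x - y|.
Proof.
wlog xy : x y / y <= x.
  by move=> H; case: (leP y x) => [/H//|/ltW/H]; rewrite distrC [leRHS]distrC.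
have [|c _ ->] := @MVT_segment R sin cos y x xy.
  by apply: continuous_subspaceT; exact: continuous_sin.
by rewrite normrM ler_piMl// cos_max.
Qed.

Lemma polar_dist (r r' t t' : R) :
  cabs (polar r t - polar r' t') <= `|r - r'| + 2 * `|r'| * `|t - t'|.
Proof.
have -> : polar r t - polar r' t' = polar (r - r') t + (polar r' t - polar r' t').
  by apply: ccP; rewrite ?ccE /=; ring.
rewrite (le_trans (cabsD _ _))// lerD//.
  rewrite /cabs /cabs2 /= !exprMn -mulrDr cos2Dsin2 mulr1 sqrtr_sqr//.
rewrite (le_trans (cabs_le_ReIm _))//= -!mulrBr !normrM -mulrDr mulrAC [leRHS]mulrC.
rewrite ler_wpM2l// mulr_natl mulr2n lerD//; [exact: cos_lip|exact: sin_lip].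
Qed.

Lemma circle_near f (r0 t0 : R) : ccts f (polar r0 t0) ->
  forall e : R, 0 < e -> exists2 d : R, 0 < d &
    forall r t, `|r - r0| < d -> `|t - t0| < d ->
      cabs (f (polar r t) - f (polar r0 t0)) < e.
Proof.
move=> H e /H[d d0 Hd].
pose K := 1 + 2 * `|r0|; have K0 : 0 < K by rewrite ltr_wpDr// mulr_ge0.
exists (d / K); first by rewrite divr_gt0.
move=> r t rd td; apply: Hd; rewrite (le_lt_trans (polar_dist _ _ _ _))//.
have -> : d = d / K + 2 * `|r0| * (d / K).
  by rewrite -{1}[d / K]mul1r -mulrDl -/K mulrC divfK// gt_eqF.
by rewrite ltr_leD// ler_wpM2l ?mulr_ge0// ltW.
Qed.

Lemma ccont_circle f (r a b : R) : (forall z, cabs z = `|r| -> ccts f z) ->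
  ccont a b (fun t => f (polar r t)).
Proof.
move=> H; apply: ccont_dist => t _ e e0.
have : ccts f (polar r t).
  by apply: H; rewrite /cabs /cabs2 /= !exprMn -mulrDr cos2Dsin2 mulr1 sqrtr_sqr.
move=> /circle_near/(_ e e0)[d d0 Hd]; exists d => // y _ yt.
by apply: Hd => //; rewrite subrr normr0.
Qed.

(** Each t has its own admissible radius; compactness of the parameter segment makes the radius
    uniform. *)
Lemma circle_unif f (r0 a b : R) : (forall t, a <= t <= b -> ccts f (polar r0 t)) ->
  forall e : R, 0 < e -> exists2 d : R, 0 < d &
    forall r t, `|r - r0| < d -> a <= t <= b ->
      cabs (f (polar r t) - f (polar r0 t)) <= e.
Proof.
move=> H e e0.
have /compact_near_coveringP cp : compact (`[a, b]%classic : set R) by exact: segment_compact.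
have := cp R (nbhs r0) (fun r t => cabs (f (polar r t) - f (polar r0 t)) <= e).
have F (t : R) : `[a, b]%classic t -> \forall t' \near t & r \near nbhs r0,
    cabs (f (polar r t') - f (polar r0 t')) <= e.
  rewrite /= in_itv /= => /H/circle_near/(_ (e / 2))[|d d0 Hd]; first by rewrite divr_gt0.
  exists (ball t d, ball r0 d); first by split; exact: nbhsx_ballx.
  move=> [t' r] /= []; rewrite /ball /= distrC => td; rewrite distrC => rd.
  rewrite -(subrK (f (polar r0 t)) (f (polar r t'))) -addrA.
  rewrite (le_trans (cabsD _ _))// [leRHS]splitr lerD// ?ltW ?Hd//.
  by rewrite cabs_distC Hd// subrr normr0.
move=> /(_ _ F)/nbhs_ballP[d /= d0 Hd]; exists d => // r t rd tab.
by apply: Hd; rewrite ?in_itv//= /ball /= distrC.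
Qed.

Lemma circle_bounded f (r a b : R) : (forall t, a <= t <= b -> ccts f (polar r t)) ->
  exists2 M : R, 0 <= M & forall t, a <= t <= b -> cabs (f (polar r t)) <= M.
Proof.
move=> H.
have /compact_near_coveringP cp : compact (`[a, b]%classic : set R) by exact: segment_compact.
have := cp R (pinfty_nbhs R) (fun M t => cabs (f (polar r t)) <= M).
have F (t : R) : `[a, b]%classic t -> \forall t' \near t & M \near pinfty_nbhs R,
    cabs (f (polar r t')) <= M.
  rewrite /= in_itv /= => /H/circle_near/(_ 1)[//|d d0 Hd].
  exists (ball t d, [set M | cabs (f (polar r t)) + 1 < M]).
    split; first exact: nbhsx_ballx.
    by apply: nbhs_pinfty_gt; exact: num_real.
  move=> [t' M] /= []; rewrite /ball /= distrC => td /ltW MM.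
  rewrite (le_trans _ MM)// -{1}(subrK (f (polar r t)) (f (polar r t'))).
  by rewrite (le_trans (cabsD _ _))// addrC lerD2l ltW// Hd// subrr normr0.
move=> /(_ _ F) [M [_ HM]]; exists (Num.max 0 (M + 1)); first by rewrite le_max lexx.
move=> t tab; rewrite (le_trans (HM (M + 1) _ t _)) ?ltrDl// ?le_max ?lexx ?orbT//.
Qed.

End Exponential.

(** * Cauchy's formula and Taylor coefficients *)

Section Cauchy.
Variable R : realType.
Implicit Types (z w : CC R) (f g : CC R -> CC R).
Local Notation imag_i := ((0 +i* 1)%C : CC R).

(** Integration in dt is integration of f(z) dz / (i z). Hence the exponent n instead of n + 1 in
    [coef], and the condition f 0 = 0 in the form of Cauchy's theorem below. *)
Definition circ_int f (r : R) : CC R := cint 0 (2 * pi) (fun t => f (polar r t)).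

Lemma twopi_gt0 : 0 < 2 * pi :> R.
Proof. by rewrite mulr_gt0// pi_gt0. Qed.

(** Goursat's theorem for f(exp(s + i t)) on the rectangle [ln r1, ln r2] x [0, 2 pi]: the sides t =
    0 and t = 2 pi cancel by periodicity, the other two are the circles. *)
Lemma circ_int_const f (r1 r2 : R) : 0 < r1 -> r1 <= r2 ->
  (forall z, r1 <= cabs z <= r2 -> exists c, cdiff f z c) ->
  circ_int f r1 = circ_int f r2.
Proof.
move=> r10 r12 H; have r20 : 0 < r2 by exact: lt_le_trans r12.
pose g (s t : R) := f (polar (expR s) t).
have Hg (s t : R) : ln r1 <= s <= ln r2 -> 0 <= t <= 2 * pi -> exists k, lin_approx g s t k.
  move=> /andP[s1 s2] _.
  have [|c Hc] := H (polar (expR s) t).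
    by rewrite cabs_polar ?expR_ge0// -{1}(lnK r10) -(lnK r20) !ler_expR s1.
  have /cdiffP K := @cdiff_comp _ f (@cexp R) (s +i* t)%C _ _ Hc (cdiff_cexp _).
  exists (c * cexp (s +i* t)%C) => e e0; have [d d0 Hd] := K e e0.
  exists (d / 2); first by rewrite divr_gt0.
  move=> s' t' sd td; have E : (s' +i* t')%C - (s +i* t)%C = ((s' - s) +i* (t' - t))%C :> CC R by [].
  have := Hd (s' +i* t')%C; rewrite E => /(_ _)/le_trans; apply.
    by rewrite (le_lt_trans (cabs_pair_le _ _))// [ltRHS]splitr ltrD.
  by rewrite ler_wpM2l ?cabs_pair_le// ltW.
have l12 : ln r1 <= ln r2 by rewrite ler_ln.
have := goursat Hg l12 (ltW twopi_gt0).
have per (s : R) : g s (2 * pi) = g s 0.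
  by rewrite /g /polar mulr_natl cos2pi sin2pi cos0 sin0.
rewrite /rect_int (eq_cint (F := fun x => g x (2 * pi)) (G := fun x => g x 0))//.
rewrite subrr add0r => /eqP; rewrite mulf_eq0 => /orP[/eqP[/eqP]|].
  by rewrite oner_eq0.
by rewrite subr_eq0 /g !lnK// => /eqP/esym.
Qed.

Lemma circ_int_cts f (r0 : R) : 0 <= r0 -> r0 < 1 ->
  (forall z, cabs z < 1 -> ccts f z) ->
  forall e : R, 0 < e -> exists2 d : R, 0 < d &
    forall r, 0 <= r < 1 -> `|r - r0| < d -> cabs (circ_int f r - circ_int f r0) <= e.
Proof.
move=> r00 r01 H e e0.
pose e1 := e / (2 * (2 * pi)).
have e10 : 0 < e1 by rewrite divr_gt0// mulr_gt0// twopi_gt0.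
have H' t : 0 <= t <= 2 * pi -> ccts f (polar r0 t).
  by move=> _; apply: H; rewrite cabs_polar.
have [d d0 Hd] := circle_unif H' e10.
exists d => // r /andP[rr0 rr1] rd.
have cc (r' : R) : 0 <= r' -> r' < 1 -> ccont 0 (2 * pi) (fun t => f (polar r' t)).
  by move=> r'0 r'1; apply: ccont_circle => z zr; apply: H; rewrite zr ger0_norm.
rewrite /circ_int -cintB; try exact: cc.
apply: (le_trans (cint_abs_le (M := e1) (ltW twopi_gt0) _ _)).
- by apply: ccontB; exact: cc.
- by move=> t /Hd; apply.
- by rewrite /e1 subr0 mulrAC mulrC divfK// gt_eqF// mulr_gt0// twopi_gt0.
Qed.

(* The singularity at w is only removable in the continuous sense, so both
   circles |z| = r with r < |w| and r > |w| have to be compared with |z| = |w|. *)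
Lemma circ_int_punctured f w (rho : R) : cabs w < rho -> rho < 1 ->
  (forall z, cabs z < 1 -> ccts f z) -> f 0 = 0 ->
  (forall z, cabs z < 1 -> z != w -> exists c, cdiff f z c) ->
  circ_int f rho = 0.
Proof.
move=> wr r1 fc f0 fd; have w1 : cabs w < 1 by exact: lt_trans r1.
have rho0 : 0 < rho by rewrite (le_lt_trans (cabs_ge0 w)).
have c0 : circ_int f 0 = 0.
  rewrite /circ_int (eq_cint (G := fun=> 0)).
    by rewrite cint_cst ?mul0r// ltW// twopi_gt0.
  by move=> t _; rewrite (_ : polar 0 t = 0)// /polar !mul0r.
have small (x y : CC R) : (forall e, 0 < e -> cabs (x - y) <= e) -> x = y.
  move=> H; apply/eqP; rewrite -subr_eq0 -cabs_eq0; apply/eqP/le_anti.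
  rewrite cabs_ge0 andbT; apply/ler_addgt0Pl => e /H; by rewrite addr0.
have up : circ_int f rho = circ_int f (cabs w).
  apply: small => e e0; have [d d0 Hd] := circ_int_cts (cabs_ge0 w) w1 fc e0.
  pose r := Num.min rho (cabs w + d / 2).
  have wlr : cabs w < r by rewrite lt_min wr ltrDl divr_gt0.
  have rr : r <= rho by rewrite ge_min lexx.
  rewrite -(circ_int_const (r1 := r) _ rr).
  - apply: Hd; first by rewrite (le_trans (cabs_ge0 w) (ltW wlr)) (le_lt_trans rr).
    rewrite gtr0_norm ?subr_gt0// ltrBlDl (@le_lt_trans _ _ (cabs w + d / 2))//.
      by rewrite ge_min lexx orbT.
    by rewrite ltrD2l ltr_pdivrMr// ltr_pMr// ltr1n.
  - exact: le_lt_trans (cabs_ge0 w) wlr.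
  - move=> z /andP[rz zr]; apply: fd; first exact: le_lt_trans r1.
    by apply: contraTneq rz => ->; rewrite -ltNge.
rewrite up; have [->|w0] := eqVneq w 0; first by rewrite cabs0.
have wp : 0 < cabs w by rewrite cabs_gt0.
apply: small => e e0; rewrite -c0.
(* Between 0 and |w| the integral does not depend on the radius: at r2 it is close to its value at
   |w|, at r1' it is close to its value at radius 0, which vanishes since f 0 = 0. *)
have e20 : 0 < e / 2 by rewrite divr_gt0.
have [d d0 Hd] := circ_int_cts (cabs_ge0 w) w1 fc e20.
have [d' d'0 Hd'] := circ_int_cts (lexx 0) ltr01 fc e20.
pose h := Num.min (d / 2) (cabs w / 2).
have h0 : 0 < h by rewrite lt_min !divr_gt0.
have hw : h <= cabs w / 2 by rewrite ge_min lexx orbT.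
have hd : h < d by rewrite (@le_lt_trans _ _ (d / 2)) ?ge_min ?lexx// ltr_pdivrMr// ltr_pMr// ltr1n.
pose r2 := cabs w - h.
pose r1' := Num.min r2 (d' / 2).
have r20 : 0 < r2 by rewrite subr_gt0 (le_lt_trans hw)// ltr_pdivrMr// ltr_pMr// ltr1n.
have r1'0 : 0 < r1' by rewrite lt_min r20 divr_gt0.
have r12 : r1' <= r2 by rewrite ge_min lexx.
have r2w : r2 < cabs w by rewrite ltrBlDr ltrDl.
have E : circ_int f r1' = circ_int f r2.
  apply: circ_int_const => // z /andP[_ zr]; apply: fd.
    by rewrite (le_lt_trans zr)// (lt_trans r2w).
  by apply: contraTneq zr => ->; rewrite -ltNge.
rewrite -(subrK (circ_int f r2) (circ_int f (cabs w))) -addrA.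
rewrite (le_trans (cabsD _ _))// [leRHS]splitr lerD//.
  rewrite cabs_distC Hd ?(ltW r20) ?(lt_trans r2w)//.
  by rewrite /r2 addrAC subrr sub0r normrN gtr0_norm.
rewrite -E Hd' ?(ltW r1'0) ?(le_lt_trans r12) ?(lt_trans r2w)// subr0 gtr0_norm//.
by rewrite (@le_lt_trans _ _ (d' / 2)) ?ge_min ?lexx ?orbT// ltr_pdivrMr// ltr_pMr// ltr1n.
Qed.

Definition mean f (r : R) : CC R := (((2 * pi)^-1)%:C)%C * circ_int f r.

(** The radius 1/2 is a choice; [coefE] allows any radius in (0, 1). *)
Definition coef f n : CC R := mean (fun z => f z * z ^- n) 2^-1.

Lemma holo_ccts f z : holo f -> cabs z < 1 -> ccts f z.
Proof. by move=> hf /in_discP zD; exact: cdiff_ccts (holo_cdiff hf zD). Qed.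

Lemma ccont_holo f (r a b : R) : holo f -> 0 <= r < 1 -> ccont a b (fun t => f (polar r t)).
Proof.
move=> hf /andP[r0 r1]; apply: ccont_circle => z zr; apply: holo_ccts => //.
by rewrite zr ger0_norm.
Qed.

Lemma cdiffX z n : cdiff (fun z => z ^+ n) z (n%:R * z ^+ n.-1).
Proof.
elim: n => [|n IH]; first by rewrite mul0r; exact: cdiff_cst.
have -> : (fun z : CC R => z ^+ n.+1) = (fun z => z * z ^+ n).
  by apply/funext => x; rewrite exprS.
have := cdiffM (cdiff_id z) IH; congr cdiff.
case: n {IH} => [|n]; first by rewrite expr0 mul0r mulr0 addr0 mul1r.
by rewrite /= mul1r -[n.+2%:R]natr1 mulrDl mul1r addrC mulrCA -exprS.
Qed.

Lemma cdiff_monV z n : z != 0 -> exists c, cdiff (fun z => z ^- n) z c.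
Proof.
move=> z0; have zn : z ^+ n != 0 by rewrite expf_neq0.
have := @cdiffV _ (fun z => z ^+ n) z _ zn (cdiffX z n).
by exists (- (n%:R * z ^+ n.-1) / (z ^+ n) ^+ 2).
Qed.

Lemma coefE f n (r : R) : holo f -> 0 < r < 1 ->
  coef f n = mean (fun z => f z * z ^- n) r.
Proof.
move=> hf /andP[r0 rlt1].
have H (r1 r2 : R) : 0 < r1 -> r1 <= r2 -> r2 < 1 ->
    circ_int (fun z => f z * z ^- n) r1 = circ_int (fun z => f z * z ^- n) r2.
  move=> r10 r12 r21; apply: circ_int_const => // z /andP[z1 z2].
  have z0 : z != 0 by rewrite -cabs_gt0 (lt_le_trans r10).
  have [c Hc] := cdiff_monV n z0.
  have zD : in_disc z by apply/in_discP; rewrite (le_lt_trans z2).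
  by have := cdiffM (holo_cdiff hf zD) Hc; exists (cderiv f z * z ^- n + f z * c).
have h1 : (2^-1 : R) < 1 by rewrite invf_lt1// ltr1n.
suff E : circ_int (fun z => f z * z ^- n) 2^-1 = circ_int (fun z => f z * z ^- n) r.
  by rewrite /coef /mean E.
have [h|/ltW h] := leP r 2^-1; first by rewrite (H r 2^-1 r0 h h1).
by rewrite -(H 2^-1 r _ h rlt1)// invr_gt0.
Qed.

Lemma conjM z w : (z * w)^*%C = z^*%C * w^*%C :> CC R.
Proof. exact: rmorphM. Qed.

Lemma circ_int_conj f (r : R) : ccont 0 (2 * pi) (fun t => f (polar r t)) ->
  circ_int (fun z => (f z)^*%C) r = (circ_int f r)^*%C.
Proof.
move=> [cR cI]; rewrite /circ_int /cint /=; congr (_ +i* _)%C.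
  by apply: eq_rint => t _; case: (f _).
rewrite -mulN1r -rintZ//; apply: eq_rint => t _; case: (f _) => x y /=.
by rewrite mulN1r.
Qed.

Lemma circ_intX n (r : R) : 0 < r < 1 -> circ_int (fun z => z ^+ n.+1) r = 0.
Proof.
move=> /andP[r0 r1].
have cz z : cdiff (fun z => z ^+ n.+1) z (n.+1%:R * z ^+ n) := cdiffX z n.+1.
apply: (@circ_int_punctured _ 0) => //; rewrite ?cabs0 ?expr0n//.
- by move=> z _; apply: cdiff_ccts (cz z).
- by move=> z _ _; exists (n.+1%:R * z ^+ n); exact: cz.
Qed.

Lemma polar_conj (r t : R) : polar r t * (polar r t)^*%C = ((r ^+ 2)%:C)%C :> CC R.
Proof.
apply: ccP; rewrite ?ccE /=; last by ring.
have : cos t ^+ 2 + sin t ^+ 2 = 1 by exact: cos2Dsin2.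
by move=> E; rewrite -[RHS]mulr1 -E; ring.
Qed.

Lemma ccont_polarX (r a b : R) n : ccont a b (fun t => polar r t ^+ n).
Proof.
apply: (ccont_circle (f := fun z => z ^+ n)) => z _.
exact: cdiff_ccts (cdiffX z n).
Qed.

Lemma cabs_real (x : R) : cabs ((x%:C)%C : CC R) = `|x|.
Proof. by rewrite /cabs /cabs2 /= expr0n addr0 sqrtr_sqr. Qed.

Lemma circ_conjX (r t : R) n : 0 < r -> (polar r t ^+ n)^*%C = ((r ^+ n ^+ 2)%:C)%C * polar r t ^- n :> CC R.
Proof.
move=> r0; have z0 : polar r t ^+ n != 0 by rewrite expf_neq0// polar_neq0.
by rewrite polarX in z0 *; rewrite -(polar_conj (r ^+ n) (t *+ n)) mulrAC divff// mul1r.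
Qed.

(** On the circle a negative power is a positive multiple of the conjugate of the opposite power, so
    this is [circ_intX] conjugated. *)
Lemma circ_intNX n (r : R) : 0 < r < 1 -> circ_int (fun z => z ^- n.+1) r = 0.
Proof.
move=> /andP[r0 r1].
pose k : CC R := ((r ^+ n.+1 ^+ 2)%:C)%C.
have k0 : k != 0 by rewrite -cabs_gt0 cabs_real normr_gt0 !expf_neq0// gt_eqF.
have -> : circ_int (fun z => z ^- n.+1) r = circ_int (fun z => k^-1 * (z ^+ n.+1)^*%C) r.
  by apply: eq_cint => t _; rewrite circ_conjX// mulKf.
have cX := ccont_polarX r 0 (2 * pi) n.+1.
rewrite /circ_int cintM.
  by rewrite -/(circ_int (fun z => (z ^+ n.+1)^*%C) r) circ_int_conj// circ_intX ?r0// conjc0 mulr0.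
case: cX => c1 c2; split.
  by apply: eq_rcont c1 => t; case: (_ ^+ _).
apply: eq_rcont (rcontN c2) => t; by case: (_ ^+ _).
Qed.

Lemma mean_cst (k : CC R) (r : R) : mean (fun=> k) r = k.
Proof.
rewrite /mean /circ_int cint_cst ?(ltW twopi_gt0)// subr0 mulrCA -rmorphM /=.
by rewrite mulVf ?mulr1// gt_eqF// twopi_gt0.
Qed.

Lemma cabs_mean f (r M : R) : ccont 0 (2 * pi) (fun t => f (polar r t)) ->
  (forall t, 0 <= t <= 2 * pi -> cabs (f (polar r t)) <= M) -> cabs (mean f r) <= 2 * M.
Proof.
move=> cf fM; rewrite /mean cabsM cabs_real ger0_norm ?invr_ge0 ?(ltW twopi_gt0)//.
rewrite mulrC ler_pdivrMr ?twopi_gt0// -[X in _ * _ * X]subr0.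
by apply: cint_abs_le => //; exact/ltW/twopi_gt0.
Qed.

Lemma meanD f g (r : R) : ccont 0 (2 * pi) (fun t => f (polar r t)) ->
  ccont 0 (2 * pi) (fun t => g (polar r t)) ->
  mean (fun z => f z + g z) r = mean f r + mean g r.
Proof. by move=> cf cg; rewrite /mean /circ_int cintD// mulrDr. Qed.

Lemma meanZ (k : CC R) f (r : R) : ccont 0 (2 * pi) (fun t => f (polar r t)) ->
  mean (fun z => k * f z) r = k * mean f r.
Proof. by move=> cf; rewrite /mean /circ_int cintM// mulrCA. Qed.

Lemma eq_mean f g (r : R) : (forall t, f (polar r t) = g (polar r t)) -> mean f r = mean g r.
Proof. by move=> fg; rewrite /mean /circ_int (eq_cint (fun t _ => fg t)). Qed.

Lemma ccont_NX (r a b : R) n : 0 < r -> ccont a b (fun t => polar r t ^- n).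
Proof.
move=> r0; apply: (ccont_circle (f := fun z => z ^- n)) => z zr.
have z0 : z != 0 by rewrite -cabs_gt0 zr gtr0_norm.
by have [c /cdiff_ccts] := cdiff_monV n z0.
Qed.

Definition psum (a : nat -> CC R) N z : CC R := \sum_(n < N) a n * z ^+ n.

Section Expansion.
Variables (f : CC R -> CC R) (w : CC R) (rho : R).
Hypotheses (hf : holo f) (wr : cabs w < rho) (r1 : rho < 1).

Let rho0 : 0 < rho. Proof. exact: le_lt_trans (cabs_ge0 w) wr. Qed.
Let rho01 : 0 < rho < 1. Proof. by rewrite rho0. Qed.
Let w1 : cabs w < 1. Proof. exact: lt_trans r1. Qed.

(* Cauchy's theorem for F gives the integral formula at w, and the kernel is then expanded in powers of w / z. *)
Let F z := if z == w then w * cderiv f w else z * ((f z - f w) / (z - w)).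

Let F_cts z : cabs z < 1 -> ccts F z.
Proof.
move=> z1; have zD : in_disc z by apply/in_discP.
have [->|zw] := eqVneq z w; last first.
  have [c Hc] : exists c, cdiff (fun z => z * ((f z - f w) / (z - w))) z c.
    have d0 : z - w != 0 by rewrite subr_eq0.
    have A1 := cdiffB (holo_cdiff hf zD) (cdiff_cst (f w) z).
    have A2 := @cdiffV _ (fun z => z - w) z _ d0 (cdiffB (cdiff_id z) (cdiff_cst w z)).
    by have := cdiffM (cdiff_id z) (cdiffM A1 A2); exists (1 * ((f z - f w) / (z - w)) +
      z * ((cderiv f z - 0) / (z - w) + (f z - f w) * (- (1 - 0) / (z - w) ^+ 2))).
  apply: (@cdiff_ccts _ _ _ c).
  apply: (@cdiff_near _ _ _ _ _ (cabs (z - w)) _ _ Hc).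
    by rewrite cabs_gt0 subr_eq0.
  move=> x xz; rewrite /F; case: eqP => // xw; move: xz.
  by rewrite xw cabs_distC ltxx.
move=> e e0; have wD : in_disc w by apply/in_discP.
have /cdiffP Hw := holo_cdiff hf wD.
have [d d0 Hd] := Hw _ (divr_gt0 e0 (ltr0n _ 4)).
pose c := cderiv f w.
pose d1 := e / (2 * (cabs c + 1)).
have c0 : 0 < cabs c + 1 by rewrite ltr_wpDl ?cabs_ge0.
have d10 : 0 < d1 by rewrite divr_gt0// mulr_gt0.
exists (Num.min (Num.min 1 d) d1); first by rewrite !lt_min d10 d0 ltr01.
move=> x; rewrite !lt_min => /andP[/andP[x1 xd] xd1].
rewrite /F eqxx; case: eqP => [_|/eqP xw]; first by rewrite subrr cabs0.
have xw0 : x - w != 0 by rewrite subr_eq0.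
rewrite -/c.
(* The first summand is the linearization error quotient times x, with |x| <= 2, hence at most 2
   (e/4); the second is below e/2 by the choice of d1. *)
have -> : x * ((f x - f w) / (x - w)) - w * c =
    x * ((f x - f w - c * (x - w)) / (x - w)) + c * (x - w).
  rewrite [(f x - f w - _) / _]mulrBl mulfK// mulrBr mulrBr [w * c]mulrC [c * x]mulrC.
  by rewrite addrA subrK.
rewrite (le_lt_trans (cabsD _ _))// [ltRHS]splitr ler_ltD//.
  rewrite !cabsM cabsV.
  have x2 : cabs x <= 2.
    rewrite -(subrK w x) (le_trans (cabsD _ _))// -[2]/(1 + 1) lerD// ltW//.
  rewrite (@le_trans _ _ (2 * (e / 4)))//; last first.
    by rewrite le_eqVlt; apply/orP; left; apply/eqP; field.
  rewrite ler_pM ?cabs_ge0 ?mulr_ge0 ?invr_ge0 ?cabs_ge0//.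
  by rewrite ler_pdivrMr ?cabs_gt0// Hd.
rewrite cabsM; apply: (@le_lt_trans _ _ (cabs c * d1)).
  by rewrite ler_wpM2l ?cabs_ge0// ltW.
apply: (@lt_le_trans _ _ ((cabs c + 1) * d1)); first by rewrite ltr_pM2r// ltrDl.
by rewrite /d1 le_eqVlt; apply/orP; left; apply/eqP; field; rewrite gt_eqF.
Qed.

Let meanF : mean F rho = 0.
Proof.
rewrite /mean (circ_int_punctured wr r1 F_cts) ?mulr0//.
  by rewrite /F eq_sym; case: eqP => [->|_]; rewrite mul0r.
move=> z z1 zw; have zD : in_disc z by apply/in_discP.
have d0 : z - w != 0 by rewrite subr_eq0.
have A1 := cdiffB (holo_cdiff hf zD) (cdiff_cst (f w) z).
have A2 := @cdiffV _ (fun z => z - w) z _ d0 (cdiffB (cdiff_id z) (cdiff_cst w z)).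
have Hc := cdiffM (cdiff_id z) (cdiffM A1 A2); eexists.
apply: (@cdiff_near _ _ _ _ _ (cabs (z - w)) _ _ Hc).
  by rewrite cabs_gt0 subr_eq0.
move=> x xz; rewrite /F; case: eqP => // xw; move: xz.
by rewrite xw cabs_distC ltxx.
Qed.

Let E n z : CC R := w ^+ n * z ^- n * F z.

Let on_circ z : cabs z = rho -> (z != 0) * (z - w != 0) * (F z = z * ((f z - f w) / (z - w))).
Proof.
move=> zr; have zw : z != w by apply: contraTneq wr => <-; rewrite zr ltxx.
by rewrite -cabs_gt0 zr subr_eq0 /F (negbTE zw).
Qed.

Let ccE n : ccont 0 (2 * pi) (fun t => E n (polar rho t)).
Proof.
apply: ccontM; last first.
  apply: ccont_circle => z zr; apply: F_cts.
  by rewrite zr gtr0_norm.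
by apply: ccontM; [exact: ccont_cst|exact: ccont_NX].
Qed.

Let ccG n : ccont 0 (2 * pi) (fun t => (f (polar rho t) - f w) * polar rho t ^- n).
Proof.
apply: ccontM; last exact: ccont_NX.
by apply: ccontB; [apply: ccont_holo; rewrite ?ltW|exact: ccont_cst].
Qed.

(** One step of the geometric expansion of the Cauchy kernel: z / (z - w) = 1 + (w / z) z / (z -
    w). *)
Let ESn n t : E n (polar rho t) =
  w ^+ n * ((f (polar rho t) - f w) * polar rho t ^- n) + E n.+1 (polar rho t).
Proof.
have zr : cabs (polar rho t) = rho by rewrite cabs_polar// ltW.
move: (polar rho t) zr => z zr; have [[z0 zw0] FE] := on_circ zr.
rewrite /E FE !exprS invfM.
have zn : z ^+ n != 0 by rewrite expf_neq0.
move: (f z) (f w) (z ^+ n) (w ^+ n) zn => a b c d c0.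
field; by rewrite ?c0 ?z0 ?zw0.
Qed.

Let meanG n : mean (fun z => (f z - f w) * z ^- n) rho =
  coef f n - (if n == 0%N then f w else 0).
Proof.
have c1 : ccont 0 (2 * pi) (fun t => f (polar rho t) * polar rho t ^- n).
  apply: ccontM; last exact: ccont_NX.
  by apply: ccont_holo; rewrite ?ltW.
have c2 := ccont_NX 0 (2 * pi) n rho0.
have -> : mean (fun z => (f z - f w) * z ^- n) rho =
    mean (fun z => f z * z ^- n + (- f w) * z ^- n) rho.
  by apply: eq_mean => t; rewrite mulrBl mulNr.
rewrite meanD//; last by apply: ccontM => //; exact: ccont_cst.
rewrite (coefE n hf rho01) meanZ// mulNr; congr (_ - _).
case: n {c1 c2} => [|n] /=.
  rewrite (eq_mean (g := fun=> 1)); first by rewrite mean_cst mulr1.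
  by move=> t; rewrite expr0 invr1.
by rewrite /mean circ_intNX// !mulr0.
Qed.

(** The recursion [ESn] starts from mean (E 0) = mean F = 0, which is Cauchy's theorem; f w enters
    only at its first step, because z^-n has mean 0 for n > 0. *)
Let meanE n : mean (E n.+1) rho = f w - psum (coef f) n.+1 w.
Proof.
have S m : mean (E m) rho = w ^+ m * (coef f m - (if m == 0%N then f w else 0)) + mean (E m.+1) rho.
  have cG : ccont 0 (2 * pi) (fun t => w ^+ m * ((f (polar rho t) - f w) * polar rho t ^- m)).
    by apply: ccontM => //; exact: ccont_cst.
  rewrite -meanG -meanZ// -[RHS](meanD cG (ccE m.+1)).
  by apply: eq_mean => t; exact: ESn.
elim: n => [|n IH].
  have := S 0%N; rewrite (eq_mean (g := F)); last by move=> t; rewrite /E expr0 invr1 !mul1r.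
  rewrite meanF eqxx expr0 mul1r => /esym/eqP; rewrite addrC addr_eq0 => /eqP ->.
  by rewrite opprB /psum big_ord1 expr0 mulr1.
have H := S n.+1; rewrite IH /= subr0 in H.
have -> : psum (coef f) n.+2 w = psum (coef f) n.+1 w + coef f n.+1 * w ^+ n.+1.
  by rewrite /psum big_ord_recr.
by rewrite opprD addrA H [coef f _ * _]mulrC addrAC subrr add0r.
Qed.

(** The Taylor remainder is the mean of E, whose modulus on the circle is |F| (|w| / rho)^(n+1). *)
Lemma psum_coef_pt : exists C : R, forall n,
  cabs (f w - psum (coef f) n.+1 w) <= C * (cabs w / rho) ^+ n.+1.
Proof.
have [|M M0 HM] := @circle_bounded _ F rho 0 (2 * pi).
  by move=> t _; apply: F_cts; rewrite cabs_polar// ltW.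
exists (2 * M) => n; rewrite -meanE -mulrA [M * _]mulrC mulrC.
rewrite mulrC; apply: cabs_mean; first exact: ccE.
move=> t tp; rewrite /E cabsM cabsM cabsV !cabsX cabs_polar ?(ltW rho0)//.
rewrite -expr_div_n ler_wpM2l ?HM//.
by rewrite exprn_ge0// divr_ge0 ?cabs_ge0// ltW.
Qed.

End Expansion.
End Cauchy.

(** * Power series *)

Section PowerSeries.
Variable R : realType.
Implicit Types (z w : CC R) (f g : CC R -> CC R) (a b : nat -> CC R) (x : nat -> CC R).

Definition ccvg x (l : CC R) := forall e : R, 0 < e ->
  exists N, forall n, (N <= n)%N -> cabs (x n - l) <= e.

Lemma le_epsP (x y : R) : (forall e : R, 0 < e -> x <= y + e) -> x <= y.
Proof. by move=> H; apply/ler_addgt0Pl => e /H; rewrite addrC. Qed.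

Lemma ccvg_le x l (y : CC R) (B : R) N : ccvg x l ->
  (forall n, (N <= n)%N -> cabs (x n - y) <= B) -> cabs (l - y) <= B.
Proof.
move=> xl H; apply: le_epsP => e /xl[N' H'].
rewrite -(subrK (x (maxn N N')) l) -addrA addrC.
apply: le_trans (cabsD _ _) _; apply: lerD; first by apply: H; exact: leq_maxl.
by rewrite cabs_distC; apply: H'; exact: leq_maxr.
Qed.

Lemma ccvg_unique x l l' : ccvg x l -> ccvg x l' -> l = l'.
Proof.
move=> xl xl'; apply/eqP; rewrite -subr_eq0 -cabs_eq0; apply/eqP/le_anti.
rewrite cabs_ge0 andbT; apply: le_epsP => e /xl'[N H]; rewrite add0r.
exact: (ccvg_le xl H).
Qed.

Lemma ccauchy x : (forall e : R, 0 < e -> exists N, forall n, (N <= n)%N -> cabs (x n - x N) <= e) ->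
  exists l, ccvg x l.
Proof.
move=> H.
have P (p : CC R -> R) : (forall z w, `|p z - p w| <= cabs (z - w)) ->
    exists l, forall e : R, 0 < e -> exists N, forall n, (N <= n)%N -> `|p (x n) - l| <= e.
  move=> pL; have : cvgn (p \o x).
    apply: cauchy_cvg; apply: cauchy_exP => e e0.
    have [N HN] := H _ (divr_gt0 e0 (ltr0n _ 2)); exists (p (x N)).
    exists N => // n /= /HN Hn; rewrite /ball /= distrC.
    rewrite (le_lt_trans (pL _ _))// (le_lt_trans Hn)//.
    by rewrite ltr_pdivrMr// ltr_pMr// ltr1n.
  move=> cp; exists (limn (p \o x)) => e e0.
  have /cvgrPdist_le/(_ e e0)[N _ HN] := cp.
  by exists N => n /HN; rewrite distrC.
have [l1 H1] : exists l, forall e : R, 0 < e -> exists N, forall n, (N <= n)%N -> `|complex.Re (x n) - l| <= e.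
  by apply: P => z w; rewrite -ReN -ReD Re_le_cabs.
have [l2 H2] : exists l, forall e : R, 0 < e -> exists N, forall n, (N <= n)%N -> `|complex.Im (x n) - l| <= e.
  by apply: P => z w; rewrite -ImN -ImD Im_le_cabs.
exists (l1 +i* l2)%C => e e0.
have e2 : 0 < e / 2 by rewrite divr_gt0.
have [N1 {}H1] := H1 _ e2; have [N2 {}H2] := H2 _ e2.
exists (maxn N1 N2) => n; rewrite geq_max => /andP[/H1 h1 /H2 h2].
rewrite (le_trans (cabs_le_ReIm _))// ReD ReN ImD ImN /= [leRHS]splitr lerD//.
Qed.

(** The default value 0 is taken where the partial sums diverge. *)
Definition ps a z : CC R := xget 0 [set l | ccvg (fun N => psum a N z) l].

(** Says that the radius of convergence is at least 1. Unlike boundedness of the coefficients, it is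
    stable under differentiation. *)
Definition growth a := forall r : R, 0 < r < 1 -> exists M : R, forall n, cabs (a n) * r ^+ n <= M.

Lemma ler_expn (x y : R) n : 0 <= x -> x <= y -> x ^+ n <= y ^+ n.
Proof. by move=> x0 xy; rewrite lerXn2r// nnegrE// (le_trans x0). Qed.

Lemma le_mul1B (B q : R) n : 0 <= B -> 0 <= q -> B * (1 - q ^+ n) <= B.
Proof.
move=> B0 q0; rewrite ler_piMr//.
by rewrite lerBlDr lerDl exprn_ge0.
Qed.

Lemma psumS a N z : psum a N.+1 z = psum a N z + a N * z ^+ N.
Proof. by rewrite /psum big_ord_recr. Qed.

Lemma psum_tail a (q s M : R) z N k : 0 < s -> 0 <= q < 1 ->
  (forall n, cabs (a n) * s ^+ n <= M) -> cabs z <= q * s ->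
  cabs (psum a (N + k) z - psum a N z) <= M / (1 - q) * q ^+ N.
Proof.
move=> s0 /andP[q0 q1] aM zq.
have q10 : 0 < 1 - q by rewrite subr_gt0.
have M0 : 0 <= M by rewrite (le_trans _ (aM 0%N))// mulr_ge0 ?cabs_ge0 ?exprn_ge0// ltW.
have aq n : cabs (a n * z ^+ n) <= M * q ^+ n.
  rewrite cabsM cabsX (@le_trans _ _ (cabs (a n) * (q * s) ^+ n))//.
    by rewrite ler_wpM2l ?cabs_ge0// ler_expn ?cabs_ge0.
  by rewrite exprMn mulrCA mulrC ler_wpM2r// exprn_ge0.
(* The factor 1 - q^k makes the bound the exact sum of k geometric terms, so that the induction on k
   closes. *)
suff : cabs (psum a (N + k) z - psum a N z) <= M / (1 - q) * q ^+ N * (1 - q ^+ k).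
  move/le_trans; apply; apply: le_mul1B => //.
  by rewrite mulr_ge0 ?exprn_ge0// divr_ge0// ltW.
elim: k => [|k IH]; first by rewrite addn0 !subrr cabs0 mulr0.
rewrite addnS psumS addrAC (le_trans (cabsD _ _))//.
rewrite (le_trans (lerD IH (aq _)))//.
rewrite le_eqVlt; apply/orP; left; apply/eqP.
by rewrite exprD exprS; field; rewrite gt_eqF.
Qed.

Lemma expr_to0 (C q : R) : 0 <= q < 1 -> forall e : R, 0 < e ->
  exists N, forall n, (N <= n)%N -> C * q ^+ n <= e.
Proof.
move=> /andP[q0 q1] e e0.
have : geometric C q @ \oo --> (0 : R) by apply: cvg_geometric; rewrite ger0_norm.
move=> /cvgrPdist_le/(_ _ e0)[N _ HN]; exists N => n /HN /=.
by rewrite sub0r normrN; apply: le_trans; exact: ler_norm.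
Qed.

Lemma ps_cvg_bound a (s M : R) z : 0 < s -> (forall n, cabs (a n) * s ^+ n <= M) ->
  cabs z < s -> ccvg (fun N => psum a N z) (ps a z).
Proof.
move=> s0 aM zs.
have qs : cabs z <= cabs z / s * s by rewrite divfK// gt_eqF.
have q01 : 0 <= cabs z / s < 1.
  by rewrite divr_ge0 ?cabs_ge0 ?ltW//= ltr_pdivrMr// mul1r.
have [l Hl] : exists l, ccvg (fun N => psum a N z) l.
  apply: ccauchy => e e0.
  have [N HN] := expr_to0 (M / (1 - cabs z / s)) q01 e0.
  exists N => n Nn; rewrite -(subnKC Nn).
  by rewrite (le_trans (psum_tail _ _ s0 q01 aM qs))// HN.
by apply: (@xgetPex _ 0 [set l | ccvg (fun N => psum a N z) l]); exists l.
Qed.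

Lemma ps_tail a (q s M : R) z N : 0 < s -> 0 <= q < 1 ->
  (forall n, cabs (a n) * s ^+ n <= M) -> cabs z <= q * s ->
  cabs (ps a z - psum a N z) <= M / (1 - q) * q ^+ N.
Proof.
move=> s0 q01 aM zq; move/andP: (q01) => [q0 q1].
apply: (@ccvg_le (fun N => psum a N z) _ _ _ N).
  apply: (ps_cvg_bound s0 aM); rewrite (le_lt_trans zq)//.
  by rewrite -[ltRHS]mul1r ltr_pM2r.
by move=> n Nn; rewrite -(subnKC Nn); exact: (psum_tail _ _ s0 q01 aM zq).
Qed.

Lemma midpoint1 (r : R) : 0 <= r -> r < 1 -> 0 < (1 + r) / 2 /\ r < (1 + r) / 2 /\ (1 + r) / 2 < 1.
Proof. by move=> r0 r1; split; [|split]; lra. Qed.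

Lemma ps_cvg a z : growth a -> cabs z < 1 -> ccvg (fun N => psum a N z) (ps a z).
Proof.
move=> ga z1; have [s0 [zs s1]] := midpoint1 (cabs_ge0 z) z1.
have s01 : 0 < (1 + cabs z) / 2 < 1 by rewrite s0.
have [M HM] := ga _ s01.
exact: ps_cvg_bound s0 HM zs.
Qed.

Lemma ps_unif a (r : R) : growth a -> 0 <= r < 1 -> exists C q : R, [/\ 0 <= q, q < 1 &
  forall z N, cabs z <= r -> cabs (ps a z - psum a N z) <= C * q ^+ N].
Proof.
move=> ga /andP[r0 r1]; have [s0 [rs s1]] := midpoint1 r0 r1.
set s := (1 + r) / 2 in s0 rs s1 *.
have s01 : 0 < s < 1 by rewrite s0.
have [M HM] := ga s s01.
exists (M / (1 - r / s)), (r / s).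
have q1 : r / s < 1 by rewrite ltr_pdivrMr// mul1r.
have q0 : 0 <= r / s by rewrite divr_ge0// ltW.
split=> // z N zr; apply: (ps_tail _ s0 _ HM); first by rewrite q0.
by rewrite divfK ?gt_eqF.
Qed.

(** Each of the n terms of 1 + t + ... + t^(n-1) = (1 - t^n) / (1 - t) is at least t^n. *)
Lemma natX_le (t : R) n : 0 < t < 1 -> n%:R * t ^+ n <= (1 - t)^-1.
Proof.
move=> /andP[t0 t1]; have t10 : 0 < 1 - t by rewrite subr_gt0.
rewrite -[leRHS]mul1r ler_pdivlMr//.
suff : n%:R * t ^+ n * (1 - t) <= 1 - t ^+ n.
  by move/le_trans; apply; rewrite lerBlDr lerDl exprn_ge0// ltW.
elim: n => [|n IH]; first by rewrite mul0r mul0r expr0 subrr.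
rewrite -natr1 exprS; have tn : 0 <= t ^+ n by rewrite exprn_ge0// ltW.
have tn1 : t * t ^+ n <= 1 by rewrite -exprS exprn_ile1// ltW.
have : t * (n%:R * t ^+ n * (1 - t)) <= t * (1 - t ^+ n) by rewrite ler_pM2l.
move: (n%:R : R) (t ^+ n) tn tn1 => k x x0 x1 H.
have : 0 <= (1 - t) * (1 - t * x) by rewrite mulr_ge0 ?subr_ge0// ltW.
lra.
Qed.

Definition dcoef a n := n.+1%:R * a n.+1 : CC R.

Lemma cabs_nat n : cabs (n%:R : CC R) = n%:R.
Proof. by rewrite -(rmorph_nat (real_complex R)) cabs_real normr_nat. Qed.

(** With t = (1 + r) / 2 one has r <= t^2: one power of t is spent on the coefficient and the other
    on the factor n + 1. *)
Lemma growth_dcoef a : growth a -> growth (dcoef a).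
Proof.
move=> ga r /andP[r0 r1]; have [s0 [rs s1]] := midpoint1 (ltW r0) r1.
set t := (1 + r) / 2 in s0 rs s1 *.
have t01 : 0 < t < 1 by rewrite s0.
have [M HM] := ga t t01.
have M0 : 0 <= M by rewrite (le_trans _ (HM 0%N))// mulr_ge0 ?cabs_ge0 ?exprn_ge0// ltW.
exists (M * (1 - t)^-1 / t ^+ 2) => n.
rewrite ler_pdivlMr ?exprn_gt0// /dcoef cabsM cabs_nat.
have rt : r <= t ^+ 2.
  by have := sqr_ge0 (1 - r); rewrite /t; lra.
rewrite (@le_trans _ _ (n.+1%:R * cabs (a n.+1) * (t ^+ 2) ^+ n * t ^+ 2))//.
  rewrite ler_wpM2r ?exprn_ge0 ?(ltW s0)// ler_wpM2l ?mulr_ge0 ?cabs_ge0//.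
  by rewrite ler_expn// ltW.
have -> : n.+1%:R * cabs (a n.+1) * (t ^+ 2) ^+ n * t ^+ 2 =
    (cabs (a n.+1) * t ^+ n.+1) * (n.+1%:R * t ^+ n.+1).
  by rewrite !expr2 exprMn exprS; ring.
apply: ler_pM; [|by rewrite mulr_ge0 ?exprn_ge0// ltW|exact: HM|exact: natX_le].
by rewrite mulr_ge0 ?cabs_ge0 ?exprn_ge0// ltW.
Qed.

(** The assumption r >= 1/2 gives r^(n-1) <= 4 r^(n+1); this is the origin of the 4 and lets the
    bound carry r^n instead of r^(n-2). *)
Lemma pow_taylor (r : R) z w n : 2^-1 <= r -> cabs z <= r -> cabs w <= r ->
  cabs (w ^+ n - z ^+ n - n%:R * z ^+ n.-1 * (w - z)) <=
    4 * n%:R ^+ 2 * r ^+ n * cabs (w - z) ^+ 2.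
Proof.
move=> r2 zr wr; have r0 : 0 <= r by exact: le_trans r2; rewrite ?invr_ge0.
elim: n => [|n IH].
  rewrite !expr0 subrr [X in X - _]/= mul0r mul0r subr0 cabs0.
  apply: mulr_ge0; last exact: sqr_ge0.
  by rewrite mulr1 mulr_ge0// sqr_ge0.
have E : w ^+ n.+1 - z ^+ n.+1 - n.+1%:R * z ^+ n.+1.-1 * (w - z) =
   w * (w ^+ n - z ^+ n - n%:R * z ^+ n.-1 * (w - z)) + n%:R * z ^+ n.-1 * (w - z) ^+ 2.
  case: n {IH} => [|n] /=; first by rewrite !expr0 !expr1 !mul0r; ring.
  by rewrite !exprS -[n.+2%:R]natr1 -[n.+1%:R]natr1; ring.
rewrite E (le_trans (cabsD _ _))// cabsM.
have D0 : 0 <= cabs (w - z) ^+ 2 by rewrite sqr_ge0.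
apply: (@le_trans _ _ (r * (4 * n%:R ^+ 2 * r ^+ n * cabs (w - z) ^+ 2) +
    n%:R * (4 * r ^+ n.+1) * cabs (w - z) ^+ 2)).
  rewrite lerD// ?ler_pM ?cabs_ge0// !cabsM cabs_nat !cabsX ler_wpM2r//.
  case: n {IH E} => [|n]; first by rewrite !mul0r.
  rewrite ler_wpM2l//= (@le_trans _ _ (r ^+ n))//.
    by rewrite ler_expn ?cabs_ge0.
  rewrite !exprS !mulrA ler_peMl ?exprn_ge0//.
  have : 2^-1 * 2^-1 <= r * r by rewrite ler_pM ?invr_ge0.
  lra.
rewrite [r ^+ n.+1]exprS -[n.+1%:R]natr1.
have : (0 : R) <= n%:R by [].
have : 0 <= r * r ^+ n * cabs (w - z) ^+ 2.
  by apply: mulr_ge0 => //; apply: mulr_ge0 => //; exact: exprn_ge0.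
move: (n%:R : R) (r ^+ n) (cabs (w - z) ^+ 2) => k x d H k0.
rewrite -subr_ge0.
rewrite [X in 0 <= X](_ : _ = 4 * (k + 1) * (r * x * d)); last by ring.
by apply: mulr_ge0 => //; apply: mulr_ge0 => //; exact: addr_ge0.
Qed.

Lemma cdiff_ps a z : growth a -> cabs z < 1 -> cdiff (ps a) z (ps (dcoef a) z).
Proof.
have q3 (x : R) : 0 < x -> x / 4 + x / 4 + x / 4 <= x by move=> *; lra.
move=> ga z1; have [r0 [zr r1]] := midpoint1 (cabs_ge0 z) z1.
set r := (1 + cabs z) / 2 in r0 zr r1.
have r2 : 2^-1 <= r by have := cabs_ge0 z; rewrite /r; lra.
(* Chosen so that r <= t^4: of the four factors t^n, one bounds a_n, two absorb n^2, and the last is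
   summed as a geometric series. *)
pose t := 1 - (1 - r) / 4.
have t0 : 0 < t by rewrite /t; lra.
have t1 : t < 1 by rewrite /t; lra.
have t01 : 0 < t < 1 by rewrite t0.
have rt4 : r <= t ^+ 2 * t ^+ 2.
  have h : 1 - (1 - r) / 2 <= t ^+ 2 by have := sqr_ge0 (1 - r); rewrite /t; lra.
  apply: le_trans (ler_pM _ _ h h); [|lra..].
  by have := sqr_ge0 (1 - r); lra.
have [M HM] := ga t t01.
have M0 : 0 <= M by rewrite (le_trans _ (HM 0%N))// mulr_ge0 ?cabs_ge0 ?exprn_ge0// ltW.
pose K := 4 * M * (1 - t)^-1 ^+ 2.
have t10 : 0 < 1 - t by rewrite subr_gt0.
have K0 : 0 <= K by rewrite !mulr_ge0// ?exprn_ge0 ?invr_ge0 ltW.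
pose K' := K / (1 - t).
have K'0 : 0 <= K' by rewrite divr_ge0// ltW.
have B w N : cabs w <= r ->
  cabs (psum a N.+1 w - psum a N.+1 z - psum (dcoef a) N z * (w - z)) <= K' * cabs (w - z) ^+ 2.
  move=> wr.
  suff : cabs (psum a N.+1 w - psum a N.+1 z - psum (dcoef a) N z * (w - z)) <=
      K' * cabs (w - z) ^+ 2 * (1 - t ^+ N.+1).
    move/le_trans; apply; apply: le_mul1B; last exact: ltW.
    by rewrite mulr_ge0 ?sqr_ge0.
  have P n : cabs (a n * (w ^+ n - z ^+ n - n%:R * z ^+ n.-1 * (w - z))) <=
      K * t ^+ n * cabs (w - z) ^+ 2.
    rewrite cabsM; have := pow_taylor n r2 (ltW zr) wr.
    move=> /(ler_wpM2l (cabs_ge0 (a n)))/le_trans; apply.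
    rewrite mulrA ler_wpM2r ?sqr_ge0//.
    rewrite (@le_trans _ _ (cabs (a n) * (4 * n%:R ^+ 2 * (t ^+ 2 * t ^+ 2) ^+ n)))//.
      rewrite ler_wpM2l ?cabs_ge0// ler_wpM2l ?mulr_ge0 ?sqr_ge0//.
      by rewrite ler_expn// (le_trans _ r2)// invr_ge0.
    have -> : cabs (a n) * (4 * n%:R ^+ 2 * (t ^+ 2 * t ^+ 2) ^+ n) =
        4 * (cabs (a n) * t ^+ n) * (n%:R * t ^+ n) ^+ 2 * t ^+ n.
      rewrite !expr2 !exprMn; ring.
    rewrite ler_wpM2r ?exprn_ge0 ?(ltW t0)// /K ler_pM ?mulr_ge0 ?sqr_ge0 ?cabs_ge0 ?exprn_ge0 ?(ltW t0)//.
      by rewrite ler_pM2l.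
    by rewrite ler_expn ?natX_le// mulr_ge0 ?exprn_ge0 ?(ltW t0).
  elim: N => [|N IH].
    rewrite !psumS /psum !big_ord0 !expr0 mul0r subr0 subrr cabs0.
    apply: mulr_ge0; last exact: ltW.
    by rewrite mulr_ge0 ?sqr_ge0.
  have -> : psum a N.+2 w - psum a N.+2 z - psum (dcoef a) N.+1 z * (w - z) =
     (psum a N.+1 w - psum a N.+1 z - psum (dcoef a) N z * (w - z)) +
     a N.+1 * (w ^+ N.+1 - z ^+ N.+1 - N.+1%:R * z ^+ N.+1.-1 * (w - z)).
    by rewrite ![psum a N.+2 _]psumS [psum (dcoef a) N.+1 _]psumS /dcoef /=; ring.
  apply: le_trans (cabsD _ _) _; apply: le_trans (lerD IH (P _)) _.
  rewrite le_eqVlt; apply/orP; left; apply/eqP.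
  by rewrite /K' [t ^+ N.+2]exprS; field; rewrite gt_eqF.
(* Passage to the limit in [B]: replacing each of the three partial sums by its limit costs at most
   e/4. *)
have L w : cabs w <= r -> cabs (ps a w - ps a z - ps (dcoef a) z * (w - z)) <= K' * cabs (w - z) ^+ 2.
  move=> wr; apply: le_epsP => e e0.
  pose e1 := e / 4.
  have e10 : 0 < e1 by rewrite divr_gt0.
  pose e2 := e1 / (cabs (w - z) + 1).
  have d0 : 0 < cabs (w - z) + 1 by rewrite ltr_wpDl ?cabs_ge0.
  have e20 : 0 < e2 by rewrite divr_gt0.
  have [N1 H1] := ps_cvg ga (le_lt_trans wr r1) e10.
  have [N2 H2] := ps_cvg ga z1 e10.
  have [N3 H3] := ps_cvg (growth_dcoef ga) z1 e20.
  pose N := maxn N1 (maxn N2 N3).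
  have {}H1 := H1 N.+1 (leqW (leq_maxl _ _)).
  have {}H2 : cabs (psum a N.+1 z - ps a z) <= e1.
    by apply: H2; rewrite leqW// /N maxnCA leq_maxl.
  have {}H3 : cabs (psum (dcoef a) N z - ps (dcoef a) z) <= e2.
    by apply: H3; rewrite /N maxnA leq_maxr.
  have split3 (p1 p2 p3 s1 s2 s3 d : CC R) : p1 - p2 - p3 * d =
    (s1 - s2 - s3 * d) + ((s2 - p2) - (s1 - p1) + (s3 - p3) * d) by ring.
  rewrite (split3 _ _ _ (psum a N.+1 w) (psum a N.+1 z) (psum (dcoef a) N z)).
  apply: le_trans (cabsD _ _) _; apply: lerD; first exact: B.
  apply: le_trans (cabsD _ _) _; rewrite cabsM.
  have h : cabs (psum (dcoef a) N z - ps (dcoef a) z) * cabs (w - z) <= e1.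
    apply: (@le_trans _ _ (e2 * (cabs (w - z) + 1))).
      by rewrite ler_pM ?cabs_ge0// lerDl.
    by rewrite /e2 divfK// gt_eqF.
  apply: le_trans (lerD (cabsB _ _) h) _.
  apply: (@le_trans _ _ (e1 + e1 + e1)); first by rewrite lerD2r; exact: lerD H2 H1.
  exact: q3.
apply/cdiffP => e e0.
exists (Num.min (r - cabs z) (e / (K' + 1))).
  by rewrite lt_min subr_gt0 zr divr_gt0// ltr_wpDl.
move=> w; rewrite lt_min => /andP[w1 w2].
apply: le_trans (L w _) _.
  by rewrite -(subrK z w) (le_trans (cabsD _ _))// -lerBrDr ltW.
rewrite expr2 mulrA ler_wpM2r ?cabs_ge0//.
apply: (@le_trans _ _ ((K' + 1) * cabs (w - z))).
  by rewrite ler_wpM2r ?cabs_ge0// lerDl.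
by rewrite mulrC -ler_pdivlMr ?ltr_wpDl// ltW.
Qed.

Lemma holo_ps a : growth a -> holo (ps a).
Proof. by move=> ga z /in_discP z1; exact: cdiff_derivable (cdiff_ps ga z1). Qed.

Lemma growth_coef f : holo f -> growth (coef f).
Proof.
move=> hf r /andP[r0 r1].
have [|M M0 HM] := @circle_bounded _ f r 0 (2 * pi).
  by move=> t _; apply: holo_ccts => //; rewrite cabs_polar// ltW.
exists (2 * M) => n; rewrite (coefE n hf (r := r)) ?r0//.
rewrite -ler_pdivlMr ?exprn_gt0// -mulrA; apply: cabs_mean.
  apply: ccontM; last exact: ccont_NX.
  by apply: ccont_holo; rewrite ?(ltW r0).
move=> t /HM Ht; rewrite cabsM cabsV cabsX cabs_polar ?(ltW r0)//.
by rewrite ler_wpM2r// invr_ge0 exprn_ge0// ltW.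
Qed.

Lemma holo_psE f z : holo f -> in_disc z -> f z = ps (coef f) z.
Proof.
move=> hf /in_discP z1; have [s0 [zs s1]] := midpoint1 (cabs_ge0 z) z1.
have [C HC] := psum_coef_pt hf zs s1.
apply: (@ccvg_unique (fun N => psum (coef f) N z)); last first.
  by apply: ps_cvg => //; exact: growth_coef.
move=> e e0.
have [|N HN] := @expr_to0 C (cabs z / ((1 + cabs z) / 2)) _ e e0.
  by rewrite divr_ge0 ?cabs_ge0 ?(ltW s0)//= ltr_pdivrMr// mul1r.
exists N.+1 => -[//|n] /ltnW Nn; rewrite cabs_distC.
by rewrite (le_trans (HC n))// HN.
Qed.

(** * Orthogonality of monomials and uniqueness of coefficients *)

Lemma mean_mon n m (r : R) : 0 < r < 1 ->
  mean (fun z => z ^+ m * z ^- n) r = if m == n then 1 else 0 :> CC R.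
Proof.
move=> r01; move/andP: (r01) => [r0 r1].
case: ltngtP => mn.
- rewrite (eq_mean (g := fun z => z ^- (n - m.+1).+1)).
    by rewrite /mean circ_intNX// mulr0.
  move=> t; have z0 := polar_neq0 t r0.
  rewrite subnSK// -{1}(subnK (ltnW mn)) exprD invfM mulrCA divff ?mulr1//.
  by rewrite expf_neq0.
- rewrite (eq_mean (g := fun z => z ^+ (m - n.+1).+1)).
    by rewrite /mean circ_intX// mulr0.
  move=> t; have z0 := polar_neq0 t r0.
  by rewrite subnSK// -{1}(subnK (ltnW mn)) exprD mulfK// expf_neq0.
- rewrite mn (eq_mean (g := fun=> 1)) ?mean_cst// => t.
  by rewrite divff// expf_neq0// polar_neq0.
Qed.

Lemma ccont_psum a N (r p q : R) : ccont p q (fun t => psum a N (polar r t)).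
Proof.
elim: N => [|N IH].
  rewrite (_ : (fun _ => _) = fun=> 0); first exact: ccont_cst.
  by apply/funext => t; rewrite /psum big_ord0.
rewrite (_ : (fun _ => _) = fun t => psum a N (polar r t) + a N * polar r t ^+ N).
  by apply: ccontD => //; apply: ccontM; [exact: ccont_cst|exact: ccont_polarX].
by apply/funext => t; rewrite psumS.
Qed.

Lemma mean_psum a n N (r : R) : 0 < r < 1 ->
  mean (fun z => psum a N z * z ^- n) r = if (n < N)%N then a n else 0.
Proof.
move=> r01; have cp := ccont_psum a; have cN : ccont 0 (2 * pi) (fun t => polar r t ^- n).
  by apply: ccont_NX; case/andP: r01.
elim: N => [|N IH].
  rewrite (eq_mean (g := fun=> 0)) ?mean_cst// => t.
  by rewrite /psum big_ord0 mul0r.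
rewrite (eq_mean (g := fun z => psum a N z * z ^- n + a N * (z ^+ N * z ^- n))); last first.
  by move=> t; rewrite psumS mulrDl mulrA.
have cNn : ccont 0 (2 * pi) (fun t => polar r t ^+ N * polar r t ^- n).
  by apply: ccontM => //; exact: ccont_polarX.
rewrite meanD; [|by apply: ccontM|by apply: ccontM => //; exact: ccont_cst].
rewrite IH meanZ// mean_mon// [in RHS]ltnS [in RHS]leq_eqVlt [N == n]eq_sym.
have [nN|nN] /= := eqVneq n N; last by rewrite mulr0 addr0.
by rewrite -nN ltnn add0r mulr1.
Qed.

(** By orthogonality a partial sum with more than n terms already has the coefficient a_n; the rest
    is controlled by uniform convergence on |z| = 1/2. *)
Lemma coef_ps a n : growth a -> coef (ps a) n = a n.
Proof.
move=> ga; pose r : R := 2^-1.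
have r01 : 0 < r < 1 by rewrite invr_gt0 ltr0n invf_lt1// ltr1n.
move/andP: (r01) => [r0 r1].
have cN m : ccont 0 (2 * pi) (fun t => polar r t ^- m) by exact: ccont_NX.
have cs : ccont 0 (2 * pi) (fun t => ps a (polar r t)).
  by apply: ccont_holo; [exact: holo_ps|rewrite ltW].
have cp N := ccont_psum a N r 0 (2 * pi).
have mp N := mean_psum a n N r01.
have r01' : 0 <= r < 1 by rewrite (ltW r0).
have [C [q [q0 q1 Hq]]] := ps_unif ga r01'.
apply/eqP; rewrite -subr_eq0 -cabs_eq0; apply/eqP/le_anti; rewrite cabs_ge0 andbT.
apply: le_epsP => e e0; rewrite add0r.
have [|N HN] := @expr_to0 (2 * (C / r ^+ n)) q _ e e0; first by rewrite q0.
pose K := maxn N n.+1.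
rewrite (le_trans _ (HN K (leq_maxl _ _)))//.
have -> : coef (ps a) n - a n = mean (fun z => (ps a z - psum a K z) * z ^- n) r.
  rewrite (eq_mean (g := fun z => ps a z * z ^- n + (-1) * (psum a K z * z ^- n))); last first.
    by move=> t; rewrite mulrBl mulN1r.
  rewrite meanD ?meanZ; [|by apply: ccontM..|by apply: ccontM; [exact: ccont_cst|apply: ccontM]].
  by rewrite mp leq_maxr mulN1r.
rewrite -!mulrA; apply: cabs_mean.
  by apply: ccontM => //; exact: ccontB.
move=> t _; rewrite cabsM cabsV cabsX cabs_polar ?(ltW r0)//.
rewrite mulrCA mulrC ler_wpM2l ?invr_ge0 ?exprn_ge0 ?(ltW r0)//.
by apply: Hq; rewrite cabs_polar// ltW.
Qed.

Lemma eq_coef f g n : holo f -> (forall z, in_disc z -> f z = g z) -> coef f n = coef g n.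
Proof.
move=> hf fg; rewrite /coef; apply: eq_mean => t; rewrite fg//.
by apply/in_discP; rewrite cabs_polar ?invr_ge0// invf_lt1// ltr1n.
Qed.

Lemma cderivE f z : holo f -> in_disc z -> cderiv f z = ps (dcoef (coef f)) z.
Proof.
move=> hf zD; rewrite (eq_cderiv (g := ps (coef f)) hf) => [|w wD|//].
  by apply: cdiff_cderiv; apply: cdiff_ps; [exact: growth_coef|exact/in_discP].
exact: holo_psE.
Qed.

Lemma holo_cderiv f : holo f -> holo (cderiv f).
Proof.
move=> hf; apply: (eq_holo (f := ps (dcoef (coef f)))).
  by move=> z zD; rewrite -cderivE.
by apply/holo_ps/growth_dcoef/growth_coef.
Qed.

Lemma coef_cderiv f n : holo f -> coef (cderiv f) n = n.+1%:R * coef f n.+1.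
Proof.
move=> hf; rewrite (eq_coef (g := ps (dcoef (coef f)))).
- by rewrite coef_ps//; apply/growth_dcoef/growth_coef.
- exact: holo_cderiv.
- by move=> z zD; rewrite cderivE.
Qed.

Lemma coef0E f : holo f -> coef f 0 = f 0.
Proof.
move=> hf; have D0 : in_disc (0 : CC R) by apply/in_discP; rewrite cabs0.
have z1 : cabs (0 : CC R) < 1 by rewrite cabs0.
rewrite [RHS]holo_psE//; apply/esym.
apply: (@ccvg_unique (fun N => psum (coef f) N 0)).
  by apply: ps_cvg => //; exact: growth_coef.
move=> e e0; exists 1%N => -[//|n] _; rewrite /psum big_ord_recl expr0 mulr1 big1.
  by rewrite addr0 subrr cabs0 ltW.
by move=> i _; rewrite expr0n /= mulr0.
Qed.

End PowerSeries.

(** * The Hardy norm in terms of coefficients *)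

Section Hardy.
Variable R : realType.
Implicit Types (z w : CC R) (f g : CC R -> CC R) (a b : nat -> CC R).
Local Notation mu := (@lebesgue_measure R).

Lemma rcont_cabs2 (p q : R) (F : R -> CC R) : ccont p q F -> rcont p q (fun t => cabs2 (F t)).
Proof.
by move=> [cR cI]; apply: rcontD; [exact: (rcontM cR cR)|exact: (rcontM cI cI)].
Qed.

Definition rmean2 f (r : R) : R := (2 * pi)^-1 * rint 0 (2 * pi) (fun t => cabs2 (f (polar r t))).

Lemma integral_rint (p q : R) (h : R -> R) : rcont p q h ->
  (\int[mu]_(t in `[p, q]) (h t)%:E = (rint p q h)%:E)%E.
Proof.
move=> /rcont_integrable ih; rewrite /rint /Rintegral fineK//.
exact: integrable_fin_num.
Qed.

Lemma H2norm2E f : holo f ->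
  H2norm2 f = ereal_sup [set (rmean2 f r)%:E | r in `[(0 : R)%R, (1 : R)%R[%classic].
Proof.
move=> hf; congr ereal_sup; apply: eq_imagel => r /=; rewrite in_itv /= => r01.
rewrite integral_rint ?EFinM//.
by apply: rcont_cabs2; exact: ccont_holo.
Qed.

Lemma cabs2D z w : cabs2 (z + w) = cabs2 z + cabs2 w + 2 * complex.Re (z * w^*%C).
Proof. by case: z w => x y [u v]; rewrite /cabs2 /=; ring. Qed.

(** On the circle the conjugate of z^N is r^(2N) z^-N, so the cross term is the N-th Fourier mean of
    G. Iterating this identity yields both Parseval for polynomials and Bessel's inequality. *)
Lemma rmean2_addX G (c : CC R) N (r : R) : 0 < r < 1 -> ccont 0 (2 * pi) (fun t => G (polar r t)) ->
  rmean2 (fun z => G z + c * z ^+ N) r = rmean2 G r + cabs2 c * r ^+ N ^+ 2 +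
    2 * complex.Re (c^*%C * ((r ^+ N ^+ 2)%:C)%C * mean (fun z => G z * z ^- N) r).
Proof.
move=> r01 cG; move/andP: (r01) => [r0 r1].
have tp := ltW (twopi_gt0 R).
pose k : CC R := c^*%C * ((r ^+ N ^+ 2)%:C)%C.
pose X z := k * (G z * z ^- N).
have cX0 : ccont 0 (2 * pi) (fun t => G (polar r t) * polar r t ^- N).
  by apply: ccontM => //; exact: ccont_NX.
have cX : ccont 0 (2 * pi) (fun t => X (polar r t)).
  by apply: ccontM => //; exact: ccont_cst.
have E t : cabs2 (G (polar r t) + c * polar r t ^+ N) = cabs2 (G (polar r t)) +
    cabs2 c * r ^+ N ^+ 2 + 2 * complex.Re (X (polar r t)).
  rewrite cabs2D cabs2M -[cabs2 (_ ^+ _)]sqr_cabs cabsX cabs_polar ?(ltW r0)//.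
  congr (_ + 2 * complex.Re _).
  rewrite (conjM c) circ_conjX// /X /k.
  have gen (A B C D : CC R) : A * (B * (C * D)) = B * C * (A * D) by ring.
  exact: gen.
rewrite {1}/rmean2 (eq_rint (fun t _ => E t)).
have c1 : rcont 0 (2 * pi) (fun t => cabs2 (G (polar r t))) by exact: rcont_cabs2.
have c2 := @rcont_cst R 0 (2 * pi) (cabs2 c * r ^+ N ^+ 2).
have c3 : rcont 0 (2 * pi) (fun t => complex.Re (X (polar r t))) by case: cX.
have c4 : rcont 0 (2 * pi) (fun t => 2 * complex.Re (X (polar r t))).
  by apply: rcontM => //; exact: rcont_cst.
rewrite rintD//; last exact: rcontD.
rewrite rintD// rint_cst// subr0 (rintZ 2 c3) -/k -(@meanZ R k _ r cX0) -/X.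
rewrite mulrDr [(2 * pi)^-1 * (rint _ _ _ + _)]mulrDr [_ * (cabs2 c * _ * _)]mulrCA.
rewrite mulVf ?mulr1 ?gt_eqF// ?twopi_gt0// [(2 * pi)^-1 * (2 * _)]mulrCA.
by congr (_ + 2 * _); rewrite /mean ReM /= mul0r subr0.
Qed.

Lemma rmean2_psum a N (r : R) : 0 < r < 1 ->
  rmean2 (psum a N) r = \sum_(n < N) cabs2 (a n) * r ^+ n ^+ 2.
Proof.
move=> r01; have tp := ltW (twopi_gt0 R).
elim: N => [|N IH].
  rewrite big_ord0 /rmean2 (eq_rint (g := fun=> 0)).
    by rewrite rint_cst// mul0r mulr0.
  by move=> t _; rewrite /psum big_ord0 /cabs2 /= expr0n addr0.
rewrite big_ord_recr /= -IH.
have -> : psum a N.+1 = fun z => psum a N z + a N * z ^+ N by apply/funext => z; exact: psumS.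
rewrite (rmean2_addX _ _ r01 (ccont_psum a N r 0 (2 * pi))) mean_psum// ltnn mulr0 /=.
by rewrite mulr0 addr0.
Qed.

(** Stated for continuous G because it will be applied to the positive and negative parts of Re f.
    Subtracting d_N z^N turns the cross term into -2 |d_N|^2 r^(2N), a net loss of |d_N|^2
    r^(2N). *)
Lemma bessel G (r : R) N : 0 < r < 1 -> ccont 0 (2 * pi) (fun t => G (polar r t)) ->
  \sum_(n < N) cabs2 (mean (fun z => G z * z ^- n) r) * r ^+ n ^+ 2 <= rmean2 G r.
Proof.
move=> r01 cG; move/andP: (r01) => [r0 r1].
pose d n := mean (fun z => G z * z ^- n) r.
suff E : rmean2 (fun z => G z - psum d N z) r = rmean2 G r - \sum_(n < N) cabs2 (d n) * r ^+ n ^+ 2.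
  rewrite -subr_ge0 -E mulr_ge0 ?invr_ge0 ?(ltW (twopi_gt0 R))//.
  by apply: Rintegral_ge0 => x _; exact: cabs2_ge0.
elim: N => [|N IH].
  rewrite big_ord0 subr0 /rmean2; congr (_ * _); apply: eq_rint => t _.
  by rewrite /psum big_ord0 subr0.
rewrite big_ord_recr /= opprD addrA -IH.
have -> : (fun z => G z - psum d N.+1 z) = (fun z => (G z - psum d N z) + (- d N) * z ^+ N).
  by apply/funext => z; rewrite psumS opprD addrA mulNr.
have cP := ccont_psum d N r 0 (2 * pi).
have cN := @ccont_NX R r 0 (2 * pi) N r0.
rewrite (rmean2_addX _ _ r01 (ccontB cG cP)).
have -> : mean (fun z => (G z - psum d N z) * z ^- N) r = d N.
  have -> : (fun z => (G z - psum d N z) * z ^- N) =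
      (fun z => G z * z ^- N + (- 1) * (psum d N z * z ^- N)).
    by apply/funext => z; rewrite mulN1r mulrBl.
  have c1 := ccontM cG cN; have c2 := ccontM cP cN.
  rewrite (@meanD R (fun z => G z * z ^- N) (fun z => -1 * (psum d N z * z ^- N)) r c1).
    by rewrite (@meanZ R (-1) _ r c2) mean_psum// ltnn mulr0 addr0.
  by apply: ccontM => //; exact: ccont_cst.
move: (d N) => [x y]; rewrite -addrA; congr (_ + _); rewrite /cabs2 !ReM /=; ring.
Qed.

Lemma dist_cabs2 z w (e B : R) : 0 <= e -> cabs (z - w) <= e -> cabs z <= B ->
  `|cabs2 z - cabs2 w| <= e * (2 * B + e).
Proof.
move=> e0 ze zB; rewrite -!sqr_cabs subr_sqr normrM.
have h := le_trans (ler_dist_cabs z w) ze.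
rewrite ler_pM// ger0_norm ?addr_ge0 ?cabs_ge0//.
by move: h; rewrite ler_norml; lra.
Qed.

Lemma rmean2_cvg f (r : R) : holo f -> 0 < r < 1 -> forall e : R, 0 < e ->
  exists N, forall n, (N <= n)%N ->
    `|rmean2 f r - \sum_(k < n) cabs2 (coef f k) * r ^+ k ^+ 2| <= e.
Proof.
move=> hf r01 e e0; move/andP: (r01) => [r0 r1].
have [|B B0 HB] := @circle_bounded _ f r 0 (2 * pi).
  by move=> t _; apply: holo_ccts => //; rewrite cabs_polar// ltW.
have [d [d0 dl]] : exists d : R, 0 < d /\ d * (2 * B + d) <= e.
  exists (Num.min 1 (e / (2 * B + 1))).
  have K0 : 0 < 2 * B + 1 by rewrite ltr_wpDl// mulr_ge0.
  have m0 : 0 < Num.min 1 (e / (2 * B + 1)) by rewrite lt_min ltr01 divr_gt0.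
  split=> //; apply: (@le_trans _ _ (e / (2 * B + 1) * (2 * B + 1))); last by rewrite divfK ?gt_eqF.
  apply: ler_pM; [exact: ltW|by rewrite addr_ge0 ?mulr_ge0// ltW|by rewrite ge_min lexx orbT|].
  by rewrite lerD2l ge_min lexx.
have r01' : 0 <= r < 1 by rewrite (ltW r0).
have [C [q [q0 q1 Hq]]] := ps_unif (growth_coef hf) r01'.
have [|N HN] := @expr_to0 _ C q _ d d0; first by rewrite q0.
exists N => n Nn; rewrite -rmean2_psum// /rmean2 -mulrBr.
have tp := twopi_gt0 R.
have cf : ccont 0 (2 * pi) (fun t => f (polar r t)) by exact: ccont_holo.
have cp := ccont_psum (coef f) n r 0 (2 * pi).
rewrite -rintB; [|exact: rcont_cabs2..].
rewrite normrM ger0_norm ?invr_ge0 ?(ltW tp)// mulrC ler_pdivrMr//.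
rewrite -[X in _ <= _ * X]subr0; apply: rint_abs_le; first exact: ltW.
  by apply: rcontD; [|apply: rcontN]; exact: rcont_cabs2.
move=> t t01; apply: le_trans dl.
apply: dist_cabs2; [exact: ltW| |exact: HB].
have zD : cabs (polar r t) = r by rewrite cabs_polar// ltW.
have pD : in_disc (polar r t) by apply/in_discP; rewrite zD.
rewrite (holo_psE hf pD).
by apply: le_trans (HN n Nn); apply: Hq; rewrite zD.
Qed.

Lemma sum_cabs2_nd a (c : nat -> R) n m : (forall k, 0 <= c k) -> (n <= m)%N ->
  \sum_(k < n) cabs2 (a k) * c k <= \sum_(k < m) cabs2 (a k) * c k.
Proof.
move=> c0 nm; rewrite -(subnKC nm) -!(big_mkord xpredT (fun k => cabs2 (a k) * c k)).
rewrite (big_cat_nat (leq0n n) (leq_addr _ _)) /= lerDl.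
by apply: sumr_ge0 => k _; rewrite mulr_ge0// cabs2_ge0.
Qed.

Lemma parseval_le f (r : R) n : holo f -> 0 < r < 1 ->
  \sum_(k < n) cabs2 (coef f k) * r ^+ k ^+ 2 <= rmean2 f r.
Proof.
move=> hf r01; apply: le_epsP => e /(rmean2_cvg hf r01)[N HN].
have := HN (maxn N n) (leq_maxl _ _); rewrite ler_norml => /andP[+ _].
rewrite lerBrDl lerBlDr; apply: le_trans.
apply: (@sum_cabs2_nd (coef f) (fun k => r ^+ k ^+ 2) n (maxn N n)); last exact: leq_maxr.
by move=> k; rewrite sqr_ge0.
Qed.

Lemma parseval_ge f (r M : R) : holo f -> 0 < r < 1 ->
  (forall n, \sum_(k < n) cabs2 (coef f k) * r ^+ k ^+ 2 <= M) -> rmean2 f r <= M.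
Proof.
move=> hf r01 H; apply: le_epsP => e /(rmean2_cvg hf r01)[N HN].
have := HN N (leqnn _); rewrite ler_norml => /andP[_].
by rewrite lerBlDl => /le_trans; apply; rewrite lerD2r.
Qed.

Lemma bernoulli1 (d : R) n : 0 <= d <= 1 -> 1 - n%:R * d <= (1 - d) ^+ n.
Proof.
move=> /andP[d0 d1]; elim: n => [|n IH]; first by rewrite mul0r subr0 expr0.
rewrite exprS -natr1; have d10 : 0 <= 1 - d by rewrite subr_ge0.
apply: le_trans (ler_wpM2l d10 IH).
have : 0 <= n%:R * d * d by rewrite !mulr_ge0.
lra.
Qed.

Lemma H2norm2_leP f (M : R) : holo f ->
  (H2norm2 f <= M%:E)%E <-> forall n, \sum_(k < n) cabs2 (coef f k) <= M.
Proof.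
move=> hf; rewrite H2norm2E//; split => [H n|H].
  pose S := \sum_(k < n) cabs2 (coef f k).
  have S0 : 0 <= S by apply: sumr_ge0 => k _; exact: cabs2_ge0.
  apply: le_epsP => e e0; rewrite -/S.
  (* With r = 1 - d and k < n, r^(2k) >= (1 - d)^m >= 1 - m d by Bernoulli; d is then taken so small
     that m S d <= e. *)
  pose m := (2 * n)%N.
  have D0 : 0 < m%:R * S + 1 by rewrite ltr_wpDl ?mulr_ge0.
  pose d := Num.min (1 / 2) (e / (m%:R * S + 1)).
  have d0 : 0 < d by rewrite lt_min !divr_gt0.
  have d1 : d <= 1 / 2 by rewrite ge_min lexx.
  have d01 : 0 <= d <= 1 by rewrite ltW//= (le_trans d1)//; lra.
  have r01 : 0 < 1 - d < 1 by rewrite subr_gt0 gtrBl d0 andbT (le_lt_trans d1)//; lra.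
  have mS : m%:R * S * d <= e.
    apply: (@le_trans _ _ ((m%:R * S + 1) * (e / (m%:R * S + 1)))).
      apply: ler_pM; [by rewrite mulr_ge0|exact: ltW|by rewrite lerDl|].
      by rewrite /d ge_min lexx orbT.
    by rewrite mulrC divfK// gt_eqF.
  have h1 : rmean2 f (1 - d) <= M.
    rewrite -lee_fin; apply: le_trans H; apply: ereal_sup_ubound.
    by exists (1 - d) => //=; rewrite in_itv /=; case/andP: r01 => /ltW -> ->.
  have h2 := parseval_le n hf r01.
  have h3 : S * (1 - d) ^+ m <= \sum_(k < n) cabs2 (coef f k) * (1 - d) ^+ k ^+ 2.
    rewrite mulr_suml; apply: ler_sum => k _; rewrite ler_wpM2l ?cabs2_ge0//.
    rewrite -exprM mulnC; case/andP: r01 => r0 /ltW r1.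
    by rewrite ler_wiXn2l ?(ltW r0)// leq_mul2l /= ltnW.
  have h4 := ler_wpM2l S0 (bernoulli1 m d01).
  have := le_trans h4 (le_trans h3 (le_trans h2 h1)).
  move: mS; rewrite mulrBr mulr1; move: (m%:R) => x.
  by have -> : S * (x * d) = x * S * d by [ring]; lra.
apply: ge_ereal_sup => _ [r + <-]; rewrite /= in_itv /= => /andP[r0 r1].
(* Parseval uses negative powers of z and hence r > 0; at r = 0 the mean is |f 0|^2, the first
   partial sum. *)
rewrite lee_fin; move: r0; rewrite le_eqVlt => /predU1P[<-|r0].
  rewrite /rmean2 (eq_rint (g := fun=> cabs2 (f 0))).
    rewrite rint_cst ?(ltW (twopi_gt0 R))// subr0 mulrCA mulVf ?mulr1 ?gt_eqF ?twopi_gt0//.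
    by have := H 1%N; rewrite big_ord1 coef0E.
  by move=> t _; rewrite (_ : polar 0 t = 0)// /polar !mul0r.
apply: parseval_ge => // [|n]; first by rewrite r0.
apply: le_trans (H n); apply: ler_sum => k _.
by rewrite ler_piMr ?cabs2_ge0// -exprM exprn_ile1// ltW.
Qed.

Lemma H2norm2_ge0 f : holo f -> (0 <= H2norm2 f)%E.
Proof.
move=> hf; rewrite H2norm2E//; apply: (@le_trans _ _ (rmean2 f 0)%:E); last first.
  by apply: ereal_sup_ubound; exists 0 => //=; rewrite in_itv /= lexx ltr01.
rewrite lee_fin mulr_ge0 ?invr_ge0 ?(ltW (twopi_gt0 R))//.
by apply: Rintegral_ge0 => x _; exact: cabs2_ge0.
Qed.

Lemma eq_H2norm2 f g : holo f -> (forall z, in_disc z -> f z = g z) -> H2norm2 f = H2norm2 g.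
Proof.
move=> hf fg; have hg := eq_holo fg hf; rewrite !H2norm2E//.
congr ereal_sup; apply: eq_imagel => r /=; rewrite in_itv /= => /andP[r0 r1].
rewrite /rmean2; congr (_ * _)%:E; apply: eq_rint => t _; rewrite fg//.
by apply/in_discP; rewrite cabs_polar.
Qed.

Lemma coef_le f (M : R) n : holo f -> (H2norm2 f <= M%:E)%E -> cabs (coef f n) <= Num.sqrt M.
Proof.
move=> hf /(H2norm2_leP M hf)/(_ n.+1); rewrite big_ord_recr /= => H.
rewrite /cabs ler_wsqrtr// (le_trans _ H)// lerDr.
by apply: sumr_ge0 => k _; exact: cabs2_ge0.
Qed.

(** Every coefficient is at most the square root of M, so the power series is dominated by a
    geometric one; this is cruder than Cauchy-Schwarz. *)
Lemma point_eval f z (M : R) : holo f -> (H2norm2 f <= M%:E)%E -> in_disc z ->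
  cabs (f z) <= Num.sqrt M / (1 - cabs z).
Proof.
move=> hf fM zD; rewrite (holo_psE hf zD); move/in_discP: zD => z1.
have aM n : cabs (coef f n) * 1 ^+ n <= Num.sqrt M by rewrite expr1n mulr1 coef_le.
have := ps_tail (q := cabs z) (s := 1) (z := z) 0 ltr01 _ aM.
rewrite cabs_ge0 z1 mulr1 lexx expr0 mulr1 /psum big_ord0 subr0; exact.
Qed.

Lemma bounded_growth a (M : R) : (forall n, cabs (a n) <= M) -> growth a.
Proof.
move=> aM r /andP[r0 r1]; exists M => n; rewrite (le_trans _ (aM n))//.
by rewrite ler_piMr ?cabs_ge0// exprn_ile1// ltW.
Qed.

Lemma H2norm2_Mle f g (B M : R) : holo f -> holo g -> (forall z, in_disc z -> cabs2 (g z) <= B) ->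
  (H2norm2 f <= M%:E)%E -> (H2norm2 (fun z => g z * f z)%R <= (B * M)%:E)%E.
Proof.
move=> hf hg gB; have hgf := holoM hg hf; rewrite !H2norm2E// => fM.
have B0 : 0 <= B.
  by rewrite (le_trans _ (gB 0 _)) ?cabs2_ge0//; apply/in_discP; rewrite cabs0.
apply: ge_ereal_sup => _ [r /= r01 <-].
have {}fM : rmean2 f r <= M.
  by rewrite -lee_fin (le_trans _ fM)//; apply: ereal_sup_ubound; exists r.
move: r01; rewrite in_itv /= => r01; rewrite lee_fin.
apply: le_trans (ler_wpM2l B0 fM); rewrite /rmean2 mulrCA ler_wpM2l ?invr_ge0 ?(ltW (twopi_gt0 R))//.
have cf : rcont 0 (2 * pi) (fun t => cabs2 (f (polar r t))) by apply/rcont_cabs2/ccont_holo.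
rewrite -rintZ//; apply: rint_le; first by apply/rcont_cabs2/(ccont_holo _ _ hgf).
  by apply: rcontM => //; exact: rcont_cst.
move=> t _; rewrite cabs2M ler_wpM2r ?cabs2_ge0// gB//; apply/in_discP.
by move/andP: r01 => [? ?]; rewrite cabs_polar.
Qed.

Lemma H2norm2_Dle f g (M N : R) : holo f -> holo g ->
  (H2norm2 f <= M%:E)%E -> (H2norm2 g <= N%:E)%E ->
  (H2norm2 (fun z => f z + g z)%R <= (2 * (M + N))%:E)%E.
Proof.
move=> hf hg; have hfg := holoD hf hg; rewrite !H2norm2E// => fM gN.
apply: ge_ereal_sup => _ [r /= r01 <-].
have {}fM : rmean2 f r <= M.
  by rewrite -lee_fin (le_trans _ fM)//; apply: ereal_sup_ubound; exists r.
have {}gN : rmean2 g r <= N.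
  by rewrite -lee_fin (le_trans _ gN)//; apply: ereal_sup_ubound; exists r.
move: r01; rewrite in_itv /= => r01; rewrite lee_fin.
have cf : rcont 0 (2 * pi) (fun t => cabs2 (f (polar r t))) by apply/rcont_cabs2/ccont_holo.
have cg : rcont 0 (2 * pi) (fun t => cabs2 (g (polar r t))) by apply/rcont_cabs2/ccont_holo.
apply: (@le_trans _ _ (2 * (rmean2 f r + rmean2 g r))); last by rewrite ler_pM2l// lerD.
rewrite /rmean2 -mulrDr mulrCA ler_wpM2l ?invr_ge0 ?(ltW (twopi_gt0 R))//.
rewrite -rintD// -rintZ//; last exact: rcontD.
apply: rint_le; first by apply/rcont_cabs2/(ccont_holo _ _ hfg).
  by apply: rcontM; [exact: rcont_cst|exact: rcontD].
by move=> t _; exact: le_cabs2D.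
Qed.

End Hardy.

(** * Rotation invariance of plane Lebesgue measure *)

Section PlaneMeasure.
Variable R : realType.
Local Notation mu := (@lebesgue_measure R).
Local Notation mu2 := ((@lebesgue_measure R) \x (@lebesgue_measure R))%E.
Local Notation RR := (measurableTypeR R).
Implicit Types (h : RR * RR -> \bar R).

Definition affine (a c : R) : measurableTypeR R -> measurableTypeR R := fun x => a * x + c.

Lemma measurable_affine (a c : R) : measurable_fun setT (affine a c).
Proof.
have : measurable_fun [set: R] (fun x : R => a * x + c).
  by apply: measurable_funD => //; apply: measurable_funM.
exact.
Qed.

(** The right-hand side is a measure that gives half-open intervals their length, which
    characterizes Lebesgue measure. *)
Lemma lebesgue_measure_affine (a c : R) (A : set R) : 0 < a -> measurable A ->
  mu A = (a%:E * pushforward mu (affine a c) A)%E.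
Proof.
move=> a0 mA.
pose k : {nonneg R} := NngNum (ltW a0).
pose nu := mscale k (pushforward mu (affine a c)).
rewrite -[RHS]/(nu (measurable_affine a c) A); apply: lebesgue_measure_unique => //=.
move=> _ [[p q]] _ <- /=.
rewrite /mscale /= /pushforward.
rewrite (_ : _ @^-1` _ = `](p - c) / a, (q - c) / a]%classic); last first.
  apply/seteqP; split => x /=; rewrite /affine !in_itv /= ltr_pdivrMr// ler_pdivlMr// ltrBlDr lerBrDr mulrC//.
rewrite !lebesgue_measure_itv /= !lte_fin ltr_pM2r ?invr_gt0// ltrD2r.
case: ifPn => _; last by rewrite mule0.
by rewrite -EFinM; congr EFin; field; rewrite gt_eqF.
Qed.

Lemma integral_affine (a c : R) (g : R -> \bar R) : 0 < a -> measurable_fun setT g ->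
  (forall x, 0 <= g x)%E ->
  (\int[mu]_x g x = a%:E * \int[mu]_x g (a * x + c)%R)%E.
Proof.
move=> a0 mg g0.
pose k : {nonneg R} := NngNum (ltW a0).
have mphi := measurable_affine a c.
pose nu := mscale k (pushforward mu (affine a c)).
transitivity (\int[nu mphi]_x g x)%E.
  by apply: eq_measure_integral => A mA _; exact: lebesgue_measure_affine.
rewrite ge0_integral_mscale//.
by rewrite ge0_integral_pushforward.
Qed.

Lemma integral_translate (c : R) (g : R -> \bar R) : measurable_fun setT g ->
  (forall x, 0 <= g x)%E -> (\int[mu]_x g (x + c)%R = \int[mu]_x g x)%E.
Proof.
move=> mg g0; rewrite [RHS](integral_affine c ltr01)// mul1e.
by apply: eq_integral => x _; rewrite mul1r.
Qed.

Lemma measurable_lin (a b c d : R) :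
  measurable_fun setT (fun p : RR * RR => ((a * p.1 + b * p.2, c * p.1 + d * p.2) : RR * RR)).
Proof.
have m1 (x y : R) : measurable_fun setT (fun p : R * R => x * p.1 + y * p.2).
  by apply: measurable_funD; apply: measurable_funM.
by have := measurable_fun_pair (m1 a b) (m1 c d).
Qed.

(** Invariance under the matrix with rows (a, b) and (c, d), tested on nonnegative functions so that
    composition becomes matrix multiplication. *)
Definition inv_under (a b c d : R) := forall h, measurable_fun setT h -> (forall p, 0 <= h p)%E ->
  (\int[mu2]_p h (a * p.1 + b * p.2, c * p.1 + d * p.2)%R = \int[mu2]_p h p)%E.

Lemma inv_comp a b c d a' b' c' d' : inv_under a b c d -> inv_under a' b' c' d' ->
  inv_under (a * a' + b * c') (a * b' + b * d') (c * a' + d * c') (c * b' + d * d').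
Proof.
move=> H H' h mh h0; rewrite -(H h)//.
pose k p := h (a * p.1 + b * p.2, c * p.1 + d * p.2).
have mk : measurable_fun setT k by exact: (measurableT_comp mh (measurable_lin a b c d)).
rewrite -[RHS](H' k mk (fun p => h0 _)).
by apply: eq_integral => p _; rewrite /k /=; congr h; congr pair; ring.
Qed.

Lemma inv_shear1 (t : R) : inv_under 1 t 0 1.
Proof.
move=> h mh h0.
have mh' := measurableT_comp mh (measurable_lin 1 t 0 1).
transitivity (\int[mu]_y fubini_G mu (h \o (fun p : RR * RR => ((1 * p.1 + t * p.2, 0 * p.1 + 1 * p.2)%R : RR * RR))) y)%E.
  exact: (fubini_tonelli2 _ mh' (fun p => h0 _)).
transitivity (\int[mu]_y fubini_G mu h y)%E; last exact/esym/fubini_tonelli2.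
apply: eq_integral => y _; rewrite /fubini_G /=.
rewrite -[RHS](integral_translate (t * y))//; last exact: (measurableT_comp mh (pair2_measurable y)).
by apply: eq_integral => x _; rewrite mul0r add0r !mul1r.
Qed.

Lemma inv_shear2 (t : R) : inv_under 1 0 t 1.
Proof.
move=> h mh h0.
have mh' := measurableT_comp mh (measurable_lin 1 0 t 1).
transitivity (\int[mu]_x fubini_F mu (h \o (fun p : RR * RR => ((1 * p.1 + 0 * p.2, t * p.1 + 1 * p.2)%R : RR * RR))) x)%E.
  exact: (fubini_tonelli1 _ mh' (fun p => h0 _)).
transitivity (\int[mu]_x fubini_F mu h x)%E; last exact/esym/fubini_tonelli1.
apply: eq_integral => x _; rewrite /fubini_F /=.
rewrite -[RHS](integral_translate (t * x))//; last exact: (measurableT_comp mh (pair1_measurable x)).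
by apply: eq_integral => y _; rewrite mul0r addr0 !mul1r addrC.
Qed.

(* A rotation with c != -1 is a product of three shears; the half-turn is the
   square of a quarter-turn. *)
Lemma inv_rot (c s : R) : c ^+ 2 + s ^+ 2 = 1 -> inv_under c (- s) s c.
Proof.
have rot1 (x y : R) : x ^+ 2 + y ^+ 2 = 1 -> x != -1 -> inv_under x (- y) y x.
  (* The tangent of half the rotation angle: the rotation is the shear by -t, then by y in the other
     direction, then by -t again. *)
  move=> xy xN1; pose t := y / (1 + x).
  have x0 : 1 + x != 0 by rewrite addrC addr_eq0.
  have ty : t * y = 1 - x.
    by rewrite /t mulrAC -expr2; apply: (mulIf x0); rewrite divfK//; move: xy; lra.
  have tx : t * (1 + x) = y by rewrite /t divfK.
  have := inv_comp (inv_comp (inv_shear1 (- t)) (inv_shear2 y)) (inv_shear1 (- t)).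
  have -> : (1 * 1 + - t * y) * 1 + (1 * 0 + - t * 1) * 0 = x by move: ty; lra.
  have -> : (1 * 1 + - t * y) * - t + (1 * 0 + - t * 1) * 1 = - y.
    rewrite (_ : _ + _ = - (t * (1 + (1 - t * y)))); last by ring.
    by rewrite ty subKr tx.
  have -> : (0 * 1 + 1 * y) * 1 + (0 * 0 + 1 * 1) * 0 = y by ring.
  have -> // : (0 * 1 + 1 * y) * - t + (0 * 0 + 1 * 1) * 1 = x by move: ty; lra.
move=> cs; have [c1|] := eqVneq c (-1); last exact: rot1.
have s0 : s = 0.
  by apply/eqP; rewrite -sqrf_eq0; apply/eqP; move: cs; rewrite c1 sqrrN expr1n; lra.
have q : inv_under 0 (- 1) 1 0.
  by apply: rot1; [rewrite expr0n expr1n add0r|rewrite eq_sym oppr_eq0 oner_eq0].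
have := inv_comp q q; rewrite c1 s0.
rewrite (_ : 0 * 0 + -1 * 1 = -1); last by ring.
rewrite (_ : 0 * -1 + -1 * 0 = - 0); last by ring.
rewrite (_ : 1 * 0 + 0 * 1 = 0); last by ring.
by rewrite (_ : 1 * -1 + 0 * 0 = -1)//; ring.
Qed.

(** The planar integral is unfolded into two line integrals, so that t is exchanged with one
    coordinate at a time. *)
Lemma tonelli3 (F : (RR * RR) * RR -> \bar R) : measurable_fun setT F -> (forall x, 0 <= F x)%E ->
  (\int[mu]_t \int[mu2]_p F (p, t) = \int[mu2]_p \int[mu]_t F (p, t))%E.
Proof.
move=> mF F0.
have m1 t : measurable_fun setT (fun p => F (p, t)).
  exact: (measurableT_comp mF (pair2_measurable t)).
under eq_integral => t _ do rewrite (fubini_tonelli1 (fun p => F (p, t)))//.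
have mr : measurable_fun setT (fun q : (RR * RR) * RR => ((q.1.1, q.2), q.1.2)).
  apply: measurable_fun_pair; first apply: measurable_fun_pair.
  - exact: (measurableT_comp measurable_fst measurable_fst).
  - exact: measurable_snd.
  - exact: (measurableT_comp measurable_snd measurable_fst).
have mF' := measurableT_comp mF mr.
have mG := measurable_fun_fubini_tonelli_F (m2 := mu) _ mF' (fun q => F0 _).
have G0 (q : RR * RR) : (0 <= \int[mu]_y F ((q.1, y), q.2))%E by exact: integral_ge0.
have := @fubini_tonelli _ _ _ _ R mu mu (fun q => \int[mu]_y F ((q.1, y), q.2))%E mG G0.
move=> /= <-.
have mT := measurable_fun_fubini_tonelli_F (m2 := mu) _ mF F0.
have T0 (p : RR * RR) : (0 <= \int[mu]_t F (p, t))%E by exact: integral_ge0.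
transitivity (\int[mu]_x fubini_F mu (fun p => \int[mu]_t F (p, t))%E x)%E; last first.
  by have := fubini_tonelli1 (m1 := mu) (m2 := mu) _ mT T0.
apply: eq_integral => x _; rewrite /fubini_F /=.
have mx : measurable_fun setT (fun q : RR * RR => ((x, q.2), q.1)).
  apply: measurable_fun_pair; last exact: measurable_fst.
  apply: measurable_fun_pair => //; exact: measurable_snd.
by have := @fubini_tonelli _ _ _ _ R mu mu _ (measurableT_comp mF mx) (fun q => F0 _).
Qed.

End PlaneMeasure.

(** * Reduction of the weighted Bergman norm to radial moments *)

Section DiscIntegrals.
Variable R : realType.
Local Notation mu := (@lebesgue_measure R).
Local Notation mu2 := ((@lebesgue_measure R) \x (@lebesgue_measure R))%E.
Local Notation RR := (measurableTypeR R).
Implicit Types (p : RR * RR) (f g : CC R -> CC R).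

Definition cpoint p : CC R := ((p.1 : R) +i* (p.2 : R))%C.
Definition sqnorm p : R := p.1 ^+ 2 + p.2 ^+ 2.
Definition plane_disc : set (RR * RR) := @disc2 R.

Lemma plane_discP p : plane_disc p <-> sqnorm p < 1. Proof. by []. Qed.

Lemma plane_disc_in_disc p : plane_disc p <-> in_disc (cpoint p). Proof. by []. Qed.

Lemma cabs2_cpoint p : cabs2 (cpoint p) = sqnorm p. Proof. by []. Qed.

Lemma sqnorm_ge0 p : 0 <= sqnorm p. Proof. by rewrite /sqnorm addr_ge0 ?sqr_ge0. Qed.

Lemma measurable_p1 : measurable_fun setT (fun p : RR * RR => (p.1 : R)).
Proof. exact: (@measurable_fst _ _ R R). Qed.

Lemma measurable_p2 : measurable_fun setT (fun p : RR * RR => (p.2 : R)).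
Proof. exact: (@measurable_snd _ _ R R). Qed.

Lemma measurable_sqnorm : measurable_fun setT sqnorm.
Proof.
by apply: measurable_funD; [exact: (measurable_funX 2 measurable_p1)|exact: (measurable_funX 2 measurable_p2)].
Qed.

Lemma measurable_sqnorm_lt (s : R) : measurable [set p | sqnorm p < s].
Proof.
rewrite (_ : [set p | sqnorm p < s] = setT `&` sqnorm @^-1` `]-oo, s[).
  exact: measurable_sqnorm.
by apply/seteqP; split => p /=; rewrite in_itv /=; [split|case].
Qed.

Lemma measurable_plane_disc : measurable plane_disc. Proof. exact: measurable_sqnorm_lt. Qed.

Definition cmeasurable (F : RR * RR -> CC R) :=
  measurable_fun setT (fun p => complex.Re (F p)) /\ measurable_fun setT (fun p => complex.Im (F p)).

Lemma cmeasurable_psum a N : cmeasurable (fun p => psum a N (cpoint p)).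
Proof.
have mD F G : cmeasurable F -> cmeasurable G -> cmeasurable (fun p => F p + G p).
  move=> [? ?] [? ?]; split.
    by rewrite (_ : (fun _ => _) = fun p => complex.Re (F p) + complex.Re (G p));
      [exact: measurable_funD|apply/funext => p; rewrite ReD].
  by rewrite (_ : (fun _ => _) = fun p => complex.Im (F p) + complex.Im (G p));
    [exact: measurable_funD|apply/funext => p; rewrite ImD].
have mM F G : cmeasurable F -> cmeasurable G -> cmeasurable (fun p => F p * G p).
  move=> [? ?] [? ?]; split.
    rewrite (_ : (fun _ => _) = fun p => complex.Re (F p) * complex.Re (G p) - complex.Im (F p) * complex.Im (G p)).
      by apply: measurable_funB; exact: measurable_funM.
    by apply/funext => p; rewrite ReM.
  rewrite (_ : (fun _ => _) = fun p => complex.Re (F p) * complex.Im (G p) + complex.Im (F p) * complex.Re (G p)).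
    by apply: measurable_funD; exact: measurable_funM.
  by apply/funext => p; rewrite ImM.
have mK (k : CC R) : cmeasurable (fun=> k) by split; exact: measurable_cst.
have mz : cmeasurable cpoint by split; [exact: measurable_p1|exact: measurable_p2].
have mX n : cmeasurable (fun p => cpoint p ^+ n).
  elim: n => [|n IH]; first exact: mK.
  by rewrite (_ : (fun _ => _) = fun p => cpoint p * cpoint p ^+ n); [exact: mM|apply/funext => p; rewrite exprS].
elim: N => [|N IH].
  by rewrite (_ : (fun _ => _) = fun=> 0); [exact: mK|apply/funext => p; rewrite /psum big_ord0].
rewrite (_ : (fun _ => _) = fun p => psum a N (cpoint p) + a N * cpoint p ^+ N).
  by apply: mD => //; apply: mM.
by apply/funext => p; rewrite psumS.
Qed.

Lemma cvg_cabs2 (x : nat -> CC R) l : ccvg x l -> (fun n => cabs2 (x n)) @ \oo --> cabs2 l.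
Proof.
move=> xl; apply/cvgrPdist_le => e e0.
pose B := cabs l; have B0 : 0 <= B := cabs_ge0 l.
have K0 : 0 < 2 * B + 1 by rewrite ltr_wpDl// mulr_ge0.
have [d [d0 dl]] : exists d : R, 0 < d /\ d * (2 * B + d) <= e.
  exists (Num.min 1 (e / (2 * B + 1))).
  have m0 : 0 < Num.min 1 (e / (2 * B + 1)) by rewrite lt_min ltr01 divr_gt0.
  split=> //; apply: (@le_trans _ _ (e / (2 * B + 1) * (2 * B + 1))); last by rewrite divfK ?gt_eqF.
  apply: ler_pM; [exact: ltW|by rewrite addr_ge0 ?mulr_ge0// ltW|by rewrite ge_min lexx orbT|].
  by rewrite lerD2l ge_min lexx.
have [N HN] := xl d d0; exists N => // n /= /HN Hn.
apply: le_trans dl; apply: dist_cabs2; [exact: ltW| |exact: lexx].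
by rewrite cabs_distC.
Qed.

(** f is arbitrary outside the disc; inside, it is the pointwise limit of its Taylor polynomials. *)
Lemma measurable_cabs2 f : holo f -> measurable_fun plane_disc (fun p => cabs2 (f (cpoint p))).
Proof.
move=> hf; apply: (measurable_fun_cvg (h := fun N p => cabs2 (psum (coef f) N (cpoint p)))).
  move=> N; have [mR mI] := cmeasurable_psum (coef f) N.
  by apply: measurable_funTS; apply: measurable_funD; exact: measurable_funX.
move=> p /plane_disc_in_disc pD; rewrite (holo_psE hf pD).
by apply/cvg_cabs2/ps_cvg; [exact: growth_coef|exact/in_discP].
Qed.

Definition A1_weight p : R := 2 * (1 - sqnorm p) / pi.

Lemma A1_weight_ge0 p : plane_disc p -> 0 <= A1_weight p.
Proof. by move=> /plane_discP /ltW V1; rewrite /A1_weight divr_ge0 ?pi_ge0// mulr_ge0// subr_ge0. Qed.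

Lemma measurable_A1_weight : measurable_fun setT A1_weight.
Proof.
apply: measurable_funM => //; apply: measurable_funM => //.
by apply: measurable_funB => //; exact: measurable_sqnorm.
Qed.

(** Extended by 0 to the plane, where rotation invariance was proved. *)
Definition A1_density f : RR * RR -> \bar R := (fun p => (cabs2 (f (cpoint p)) * A1_weight p)%:E) \_ plane_disc.

Lemma A1norm2E f : A1norm2 f = (\int[mu2]_p A1_density f p)%E.
Proof.
rewrite /A1norm2 integral_mkcond; apply: eq_integral => p _; rewrite /A1_density !patchE.
by case: ifP => // _; rewrite /A1_weight /sqnorm !mulrA.
Qed.

Lemma A1_density_ge0 f p : (0 <= A1_density f p)%E.
Proof.
rewrite /A1_density patchE; case: ifPn => // /set_mem pD.
by rewrite lee_fin mulr_ge0 ?cabs2_ge0 ?A1_weight_ge0.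
Qed.

Lemma measurable_A1_density f : holo f -> measurable_fun setT (A1_density f).
Proof.
move=> hf; apply/(measurable_restrictT _ measurable_plane_disc).
apply/measurable_EFinP; apply: measurable_funM; first exact: measurable_cabs2.
by apply: measurable_funTS; exact: measurable_A1_weight.
Qed.

Definition rotp p (t : R) : RR * RR :=
  ((cos t * p.1 + - sin t * p.2)%R, (sin t * p.1 + cos t * p.2)%R).

Lemma sqnorm_rotp p t : sqnorm (rotp p t) = sqnorm p.
Proof.
rewrite /sqnorm /rotp /=; have : cos t ^+ 2 + sin t ^+ 2 = 1 by exact: cos2Dsin2.
move: (cos t) (sin t) (p.1 : R) (p.2 : R) => c s x y E.
rewrite -[RHS]mul1r -E; ring.
Qed.

Lemma cpoint_rotp p t : cpoint (rotp p t) = polar 1 t * cpoint p.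
Proof. by rewrite /cpoint /rotp; apply: ccP; rewrite ?ccE /=; ring. Qed.

Lemma measurable_rotp : measurable_fun setT (fun q : (RR * RR) * RR => rotp q.1 q.2).
Proof.
have m1 : measurable_fun setT (fun q : (RR * RR) * RR => (q.1.1 : R)).
  exact: (measurableT_comp measurable_p1 measurable_fst).
have m2 : measurable_fun setT (fun q : (RR * RR) * RR => (q.1.2 : R)).
  exact: (measurableT_comp measurable_p2 measurable_fst).
have mt : measurable_fun setT (fun q : (RR * RR) * RR => (q.2 : R)).
  exact: (@measurable_snd _ _ (RR * RR)%type RR).
have mc : measurable_fun setT (fun q : (RR * RR) * RR => cos (q.2 : R)).
  exact: (measurableT_comp (continuous_measurable_fun (@continuous_cos R)) mt).
have ms : measurable_fun setT (fun q : (RR * RR) * RR => sin (q.2 : R)).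
  exact: (measurableT_comp (continuous_measurable_fun (@continuous_sin R)) mt).
have A : measurable_fun setT (fun q : (RR * RR) * RR => cos (q.2 : R) * q.1.1 + - sin (q.2 : R) * q.1.2).
  apply: measurable_funD; apply: measurable_funM => //.
  exact: measurable_funN.
have B : measurable_fun setT (fun q : (RR * RR) * RR => sin (q.2 : R) * q.1.1 + cos (q.2 : R) * q.1.2).
  by apply: measurable_funD; apply: measurable_funM.
by have := measurable_fun_pair A B.
Qed.

Lemma integral_rotp (h : RR * RR -> \bar R) t : measurable_fun setT h -> (forall p, 0 <= h p)%E ->
  (\int[mu2]_p h (rotp p t) = \int[mu2]_p h p)%E.
Proof. by move=> mh h0; have := inv_rot (cos2Dsin2 t) mh h0. Qed.

Lemma eseries_lim (u : nat -> R) (l : R) : (forall k, 0 <= u k) ->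
  (forall e : R, 0 < e -> exists N, forall n, (N <= n)%N -> `|l - \sum_(k < n) u k| <= e) ->
  (\sum_(k <oo) (u k)%:E = l%:E)%E.
Proof.
move=> u0 H; apply: cvg_lim => //.
rewrite (_ : (fun n => _) = EFin \o (fun n => \sum_(k < n) u k)); last first.
  by apply/funext => n /=; rewrite big_mkord sumEFin.
apply: cvg_EFin; first by apply: nearW.
by apply/cvgrPdist_le => e /H[N HN]; exists N => // n /= /HN.
Qed.

Lemma circle_average f z : holo f -> in_disc z ->
  (\sum_(k <oo) (cabs2 (coef f k) * cabs2 z ^+ k)%:E =
   ((2 * pi)^-1 * rint 0 (2 * pi) (fun t => cabs2 (f (polar 1 t * z))))%:E)%E.
Proof.
move=> hf /in_discP z1; have [r0 [zr r1]] := midpoint1 (cabs_ge0 z) z1.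
set r := (1 + cabs z) / 2 in r0 zr r1.
have rC : (r%:C)%C != 0 :> CC R by rewrite -cabs_gt0 cabs_real normr_gt0 gt_eqF.
(* Parseval is available on circles of radius below 1, so e^(it) z is rewritten as (r e^(it)) w with
   |z| < r < 1, and the powers of w are absorbed into the coefficients. *)
pose w : CC R := z / (r%:C)%C.
have w1 : cabs w <= 1.
  by rewrite /w cabsM cabsV cabs_real gtr0_norm// ler_pdivrMr// mul1r ltW.
pose b n := coef f n * w ^+ n.
have gb : growth b.
  move=> s s01; have [M HM] := growth_coef hf s01; exists M => n.
  apply: le_trans (HM n); rewrite ler_wpM2r ?exprn_ge0//; first by case/andP: s01 => /ltW.
  by rewrite cabsM cabsX ler_piMr ?cabs_ge0// exprn_ile1 ?cabs_ge0.
have bE t : f (polar 1 t * z) = ps b (polar r t).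
  have E : polar 1 t * z = polar r t * w.
    have gen (a c d : CC R) : d != 0 -> a * c = (d * a) * (c / d).
      by move=> d0; field.
    have -> : polar r t = (r%:C)%C * polar 1 t by apply: ccP; rewrite ?ccE /=; ring.
    exact: gen.
  have tD : in_disc (polar 1 t * z).
    by apply/in_discP; rewrite cabsM cabs_polar// mul1r.
  have pE : (fun N => psum (coef f) N (polar r t * w)) = (fun N => psum b N (polar r t)).
    by apply/funext => N; apply: eq_bigr => i _; rewrite exprMn mulrA mulrAC.
  by have := holo_psE hf tD; rewrite E /ps pE.
have r01 : 0 < r < 1 by rewrite r0.
apply: eseries_lim; first by move=> k; rewrite mulr_ge0 ?cabs2_ge0 ?exprn_ge0 ?cabs2_ge0.
move=> e e0; have [N HN] := rmean2_cvg (holo_ps gb) r01 e0.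
exists N => n /HN.
rewrite /rmean2 (eq_rint (g := fun t => cabs2 (f (polar 1 t * z)))); last by move=> t _; rewrite bE.
congr (`|_ - _| <= _); apply: eq_bigr => k _.
rewrite coef_ps// /b cabs2M -mulrA; congr (_ * _).
have cw : cabs2 w = cabs2 z / r ^+ 2.
  by rewrite -!sqr_cabs /w cabsM cabsV cabs_real gtr0_norm// expr_div_n.
rewrite -sqr_cabs cabsX -exprM mulnC exprM sqr_cabs cw expr_div_n.
by rewrite -[r ^+ k ^+ 2]exprM mulnC exprM divfK// expf_neq0// expf_neq0// gt_eqF.
Qed.

Definition moment k : \bar R := (\int[mu2]_(p in plane_disc) (sqnorm p ^+ k * A1_weight p)%:E)%E.

(** Averaging the density over all rotations preserves its integral. After Tonelli the angular
    integral is done first, and [circle_average] turns it into the series of |a_k|^2 |p|^(2k); this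
    replaces a change to polar coordinates. *)
Lemma A1norm2_moment f : holo f ->
  (A1norm2 f = \sum_(k <oo) (cabs2 (coef f k))%:E * moment k)%E.
Proof.
move=> hf; have tp := twopi_gt0 R.
pose I : set RR := `[0%R, (2 * pi)%R]%classic.
pose F (q : (RR * RR) * RR) : \bar R := (A1_density f (rotp q.1 q.2) * (\1_I q.2)%:E)%E.
have mI : measurable_fun setT (\1_I : RR -> R) by apply: measurable_indic; exact: measurable_itv.
have mF : measurable_fun setT F.
  apply: emeasurable_funM; first exact: (measurableT_comp (measurable_A1_density hf) measurable_rotp).
  apply/measurable_EFinP.
  exact: (measurableT_comp mI (@measurable_snd _ _ (RR * RR)%type RR)).
have F0 q : (0 <= F q)%E by rewrite mule_ge0 ?A1_density_ge0// lee_fin.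
have T := tonelli3 mF F0.
have R1 t : (\int[mu2]_p A1_density f (rotp p t) = A1norm2 f)%E.
  by rewrite A1norm2E; exact: (integral_rotp t (measurable_A1_density hf) (A1_density_ge0 f)).
have mr t : measurable_fun setT (fun p => A1_density f (rotp p t)).
  exact: (measurableT_comp (measurable_A1_density hf) (measurableT_comp measurable_rotp (pair2_measurable t))).
have I0 t : (0 <= (\1_I t)%:E :> \bar R)%E by rewrite lee_fin.
have LI : (mu I = (2 * pi)%:E)%E.
  by rewrite [LHS](lebesgue_measure_itv `[0%R, (2 * pi)%R]) /= lte_fin tp -EFinB subr0.
have L : (\int[mu]_t \int[mu2]_p F (p, t) = (2 * pi)%:E * A1norm2 f)%E.
  transitivity (\int[mu]_t ((\1_I t)%:E * A1norm2 f))%E.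
    apply: eq_integral => t _.
    rewrite /F /= ge0_integralZr; [|by []|exact: mr|by move=> p _; exact: A1_density_ge0|exact: I0].
    by rewrite R1 muleC.
  rewrite ge0_integralZr; [|by []|exact/measurable_EFinP|by move=> t _; exact: I0|]; last first.
    by rewrite A1norm2E; apply: integral_ge0 => p _; exact: A1_density_ge0.
  rewrite integral_indic//; last exact: measurable_itv.
  by rewrite setIT; congr (_ * _)%E; exact: LI.
pose G k p : \bar R := ((cabs2 (coef f k))%:E * ((fun p => (sqnorm p ^+ k * A1_weight p)%:E) \_ plane_disc) p)%E.
have P p : (\int[mu]_t F (p, t) = (2 * pi)%:E * \sum_(k <oo) G k p)%E.
  have [pD|pD] := pselect (plane_disc p); last first.
    rewrite integral0_eq; last first.
      move=> t _; rewrite /F /A1_density patchE memNset ?mul0e//= => /plane_discP.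
      by rewrite sqnorm_rotp => /plane_discP.
    rewrite eseries0 ?mule0// => k _ _; rewrite /G patchE memNset// mule0//.
  have E t : F (p, t) = ((cabs2 (f (polar 1 t * cpoint p)) * A1_weight p)%:E * (\1_I t)%:E)%E.
    rewrite /F /A1_density patchE /= mem_set ?cpoint_rotp; last by apply/plane_discP; rewrite sqnorm_rotp; exact/plane_discP.
    by rewrite /A1_weight sqnorm_rotp.
  pose c (t : R) := cabs2 (f (polar 1 t * cpoint p)).
  have p1 := iffLR (plane_disc_in_disc p) pD.
  have cc : rcont 0 (2 * pi) c.
    apply/rcont_cabs2/(ccont_circle (f := fun w => f (w * cpoint p))) => w w1.
    have wD : in_disc (w * cpoint p).
      by apply/in_discP; rewrite cabsM w1 normr1 mul1r; exact/in_discP.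
    have := @cdiff_comp _ f (fun w => w * cpoint p) w _ _ (holo_cdiff hf wD) (cdiffM (cdiff_id w) (cdiff_cst (cpoint p) w)).
    exact: cdiff_ccts.
  transitivity (\int[mu]_(t in I) (A1_weight p * c t)%:E)%E.
    rewrite [RHS]integral_mkcond; apply: eq_integral => t _.
    rewrite E patchE indicE mulrC; by case: ifPn => tI; rewrite ?mule1 ?mule0.
  rewrite integral_rint; last by apply: rcontM => //; exact: rcont_cst.
  rewrite rintZ//.
  have -> : (\sum_(k <oo) G k p = (A1_weight p)%:E * \sum_(k <oo) (cabs2 (coef f k) * cabs2 (cpoint p) ^+ k)%:E)%E.
    rewrite -nneseriesZl; last by move=> k _; rewrite lee_fin mulr_ge0 ?cabs2_ge0// exprn_ge0// cabs2_ge0.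
    apply: eq_eseriesr => k _; rewrite /G patchE mem_set// -!EFinM cabs2_cpoint.
    by congr EFin; ring.
  rewrite circle_average// -!EFinM; congr EFin.
  by rewrite mulrCA mulVKf// gt_eqF.
have mG k : measurable_fun setT (G k).
  apply: emeasurable_funM; first exact: measurable_cst.
  apply/(measurable_restrictT _ measurable_plane_disc)/measurable_EFinP/measurable_funTS.
  by apply: measurable_funM; [exact: (measurable_funX k measurable_sqnorm)|exact: measurable_A1_weight].
have G0 k p : (0 <= G k p)%E.
  rewrite mule_ge0 ?lee_fin ?cabs2_ge0// patchE; case: ifPn => // /set_mem pD.
  by rewrite lee_fin mulr_ge0 ?A1_weight_ge0// exprn_ge0// sqnorm_ge0.
move: T; rewrite L (eq_integral _ _ (fun p _ => P p)).
rewrite ge0_integralZl//; last 3 first.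
- exact: ge0_emeasurable_sum.
- by move=> p _; exact: nneseries_ge0.
- by rewrite lee_fin ltW.
move=> /(congr1 (fun x => ((2 * pi)^-1)%:E * x)%E).
rewrite !muleA -!EFinM mulVf ?gt_eqF// !mul1e => ->.
rewrite integral_nneseries//; apply: eq_eseriesr => k _.
rewrite /G ge0_integralZl//; last 3 first.
- apply/(measurable_restrictT _ measurable_plane_disc)/measurable_EFinP/measurable_funTS.
  by apply: measurable_funM; [exact: (measurable_funX k measurable_sqnorm)|exact: measurable_A1_weight].
- move=> p _; rewrite patchE; case: ifPn => // /set_mem pD.
  by rewrite lee_fin mulr_ge0 ?A1_weight_ge0// exprn_ge0// sqnorm_ge0.
- by rewrite lee_fin cabs2_ge0.
by rewrite /moment [in RHS]integral_mkcond.
Qed.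

End DiscIntegrals.

(** * Radial moments *)

Section Moments.
Variable R : realType.
Local Notation mu := (@lebesgue_measure R).
Local Notation mu2 := ((@lebesgue_measure R) \x (@lebesgue_measure R))%E.
Local Notation RR := (measurableTypeR R).
Implicit Types (p : RR * RR) (f g : CC R -> CC R).

Definition area (s : R) : \bar R := (\int[mu2]_p (\1_[set p | sqnorm p < s] p)%:E)%E.

Let h (s : R) : RR * RR -> \bar R := fun p => (\1_[set p : RR * RR | sqnorm p < s] p)%:E.

Let mh s : measurable_fun setT (h s).
Proof. by apply/measurable_EFinP; apply: measurable_indic; exact: measurable_sqnorm_lt. Qed.

Let h0 s p : (0 <= h s p)%E. Proof. by rewrite lee_fin. Qed.

(** The dilation by the square root of s is applied to x and to y in turn, each contributing one
    such factor. *)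
Lemma area_scale (s : R) : 0 < s -> (area s = s%:E * area 1)%E.
Proof.
move=> s0; have q0 : 0 < Num.sqrt s by rewrite sqrtr_gt0.
rewrite /area; transitivity (\int[mu]_x \int[mu]_y h s (x, y))%E.
  exact: (fubini_tonelli1 (m1 := mu) (m2 := mu) _ (mh s) (h0 s)).
have -> : (\int[mu2]_p (\1_[set p | sqnorm p < (1 : R)] p)%:E = \int[mu]_x \int[mu]_y h 1 (x, y))%E.
  exact: (fubini_tonelli1 (m1 := mu) (m2 := mu) _ (mh 1) (h0 1)).
have mF t := measurable_fun_fubini_tonelli_F (m2 := mu) _ (mh t) (h0 t).
have F0 t (x : RR) : (0 <= \int[mu]_y h t (x, y))%E by exact: integral_ge0.
rewrite (integral_affine 0 q0 (mF s) (F0 s)).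
have my t x : measurable_fun setT (fun y : RR => h t (x, y)).
  exact: (measurableT_comp (mh t) (pair1_measurable x)).
have HV (x y : R) : (sqnorm ((Num.sqrt s * x + 0 : RR), (Num.sqrt s * y + 0 : RR)) < s) = (sqnorm ((x : RR), (y : RR)) < 1).
  rewrite /sqnorm /= !addr0 !exprMn sqr_sqrtr ?ltW// -mulrDr.
  by rewrite -[X in _ < X]mulr1 ltr_pM2l.
have E x : (\int[mu]_y h s ((Num.sqrt s * x + 0)%R : RR, y) =
    (Num.sqrt s)%:E * \int[mu]_y h 1 (x, y))%E.
  rewrite (integral_affine 0 q0 (my s _))//; congr (_ * _)%E.
  apply: eq_integral => y _; rewrite /h !indicE; congr (_%:R)%:E.
  by congr nat_of_bool; apply/idP/idP => /set_mem /= H; apply/mem_set => /=; [rewrite -HV|rewrite HV].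
transitivity ((Num.sqrt s)%:E * \int[mu]_x ((Num.sqrt s)%:E * \int[mu]_y h 1 (x, y)))%E.
  by congr (_ * _)%E; apply: eq_integral => x _; exact: E.
rewrite ge0_integralZl; [|by []|exact: mF|by move=> x _; exact: F0|by rewrite lee_fin ltW].
by rewrite muleA -EFinM -expr2 sqr_sqrtr// ltW.
Qed.

Lemma area_mu (s : R) : area s = (mu2 [set p : RR * RR | (sqnorm p < s)%R])%E.
Proof.
by rewrite /area integral_indic ?setIT//; exact: measurable_sqnorm_lt.
Qed.

(** The disc lies between a square of side 1/2 and one of side 2. *)
Lemma area1_fin : exists2 k : R, 0 < k & area 1 = k%:E.
Proof.
have L : ((1 / 4)%:E <= area 1)%E.
  rewrite area_mu; pose S : set (RR * RR) := `[0%R, (1 / 2)%R]%classic `*` `[0%R, (1 / 2)%R]%classic.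
  have mI : measurable (`[0%R, (1 / 2)%R]%classic : set RR) by exact: measurable_itv.
  have -> : (1 / 4)%:E = (mu2 S)%E.
    rewrite product_measure1E// [X in (X * _)%E](lebesgue_measure_itv `[0%R, (1 / 2)%R]).
    rewrite [X in (_ * X)%E](lebesgue_measure_itv `[0%R, (1 / 2)%R]) /= lte_fin ifT; last by lra.
    by rewrite -EFinB -EFinM; congr EFin; field.
  apply: le_measure.
  - by rewrite inE; exact: measurableX.
  - by rewrite inE; exact: measurable_sqnorm_lt.
  - move=> [x y] [xI yI].
    have /andP[x0 x1] : 0 <= (x : R) <= 1 / 2 by have : (x : R) \in `[0, (1 / 2)%R] := xI; rewrite in_itv.
    have /andP[y0 y1] : 0 <= (y : R) <= 1 / 2 by have : (y : R) \in `[0, (1 / 2)%R] := yI; rewrite in_itv.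
    have hx : x ^+ 2 <= 1 / 4 by have := ler_pM x0 x0 x1 x1; rewrite expr2; lra.
    have hy : y ^+ 2 <= 1 / 4 by have := ler_pM y0 y0 y1 y1; rewrite expr2; lra.
    by rewrite /sqnorm /=; lra.
have U : (area 1 <= 4%:E)%E.
  rewrite area_mu; pose S : set (RR * RR) := `[(- 1)%R, 1%R]%classic `*` `[(- 1)%R, 1%R]%classic.
  have mI : measurable (`[(- 1)%R, 1%R]%classic : set RR) by exact: measurable_itv.
  have -> : 4%:E = (mu2 S)%E.
    rewrite product_measure1E// [X in (X * _)%E](lebesgue_measure_itv `[(- 1)%R, 1%R]).
    rewrite [X in (_ * X)%E](lebesgue_measure_itv `[(- 1)%R, 1%R]) /= lte_fin ifT; last by lra.
    by rewrite -EFinB -EFinM; congr EFin; ring.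
  apply: le_measure.
  - by rewrite inE; exact: measurable_sqnorm_lt.
  - by rewrite inE; exact: measurableX.
  - have sq (a b : R) : a ^+ 2 + b ^+ 2 < 1 -> -1 <= a <= 1.
      move=> ab; rewrite -ler_norml -(@ler_sqr R) ?nnegrE// real_normK ?num_real// expr1n.
      by have := sqr_ge0 b; lra.
    move=> [x y] H; split.
      by suff : (x : R) \in `[-1, 1] by []; rewrite in_itv; exact: sq H.
    by suff : (y : R) \in `[-1, 1] by []; rewrite in_itv; apply: (sq y x); rewrite addrC.
move: L U; case: (area 1) => [k| |]//; rewrite !lee_fin => L U; exists k => //.
by apply: lt_le_trans L; lra.
Qed.

Lemma rint_pow (a b : R) k : a <= b ->
  rint a b (fun x => k.+1%:R * x ^+ k) = b ^+ k.+1 - a ^+ k.+1.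
Proof.
move=> ab; apply: (@rint_ftc _ a b (fun x => x ^+ k.+1)) => //.
  move=> x; apply: DeriveDef; first exact: exprn_derivable.
  by rewrite exp_derive -[LHS]/(_ * _) mulr1.
by move=> x; apply: cvgM; [exact: cvg_cst|exact: exprn_continuous].
Qed.

Lemma rcont_pow (a b : R) k : rcont a b (fun x => k.+1%:R * x ^+ k).
Proof.
apply: continuous_subspaceT => x.
by apply: cvgM; [exact: cvg_cst|exact: exprn_continuous].
Qed.

(* The area of the disc of squared radius s is proportional to s, so its constant (pi) never has to be computed. *)
Lemma layer_cake (K : R) k : area 1 = K%:E ->
  (\int[mu2]_(p in @plane_disc R) (1 - sqnorm p ^+ k)%:E = (k%:R / k.+1%:R * K)%:E)%E.
Proof.
move=> aE; case: k => [|k].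
  rewrite mul0r mul0r integral0_eq// => p _; by rewrite expr0 subrr.
pose I : set RR := `[0%R, 1%R]%classic.
have mI : measurable I by exact: measurable_itv.
(* The derivative of s^(k+1) on [0, 1]. Integrated over s > |p|^2 it gives 1 - |p|^(2k+2);
   integrated against the area K s of the disc of squared radius s it gives the right-hand side. *)
pose w (s : R) : R := k.+1%:R * s ^+ k * \1_I s.
have w0 s : 0 <= w s.
  rewrite /w indicE; have [/set_mem|] := boolP (s \in I); last by rewrite mulr0.
  by rewrite /I /= in_itv /= => /andP[s0 _]; rewrite mulr1 mulr_ge0 ?exprn_ge0.
have mw : measurable_fun setT (w : RR -> R).
  apply: measurable_funM; last exact: measurable_indic.
  by apply: measurable_funM => //; exact: measurable_funX.
pose S : set ((RR * RR) * RR) := [set q | sqnorm q.1 < q.2].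
have mS : measurable S.
  have mD : measurable_fun setT (fun q : (RR * RR) * RR => sqnorm q.1 - (q.2 : R)).
    apply: measurable_funB; first exact: (measurableT_comp (@measurable_sqnorm R) measurable_fst).
    exact: (@measurable_snd _ _ (RR * RR)%type RR).
  rewrite (_ : S = setT `&` (fun q : (RR * RR) * RR => sqnorm q.1 - (q.2 : R)) @^-1` `]-oo, 0[).
    by apply: mD => //; exact: measurable_itv.
  by apply/seteqP; split => q; rewrite /S /= in_itv /= subr_lt0; [split|case].
pose F (q : (RR * RR) * RR) : \bar R := (w q.2 * \1_S q)%:E.
have mF : measurable_fun setT F.
  apply/measurable_EFinP; apply: measurable_funM; last exact: measurable_indic.
  exact: (measurableT_comp mw (@measurable_snd _ _ (RR * RR)%type RR)).
have F0 q : (0 <= F q)%E by rewrite lee_fin mulr_ge0.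
have T := tonelli3 mF F0.
have c1 : rcont 0 1 (fun t => k.+1%:R / k.+2%:R * K * (k.+2%:R * t ^+ k.+1)).
  by apply: rcontM; [exact: rcont_cst|exact: rcont_pow].
have L : (\int[mu]_t \int[mu2]_p F (p, t) = (k.+1%:R / k.+2%:R * K)%:E)%E.
  transitivity (\int[mu]_(t in I) (k.+1%:R / k.+2%:R * K * (k.+2%:R * t ^+ k.+1))%:E)%E; last first.
    rewrite integral_rint// rintZ; last exact: rcont_pow.
    by rewrite rint_pow// expr1n expr0n subr0 mulr1.
  rewrite [RHS]integral_mkcond; apply: eq_integral => t _; rewrite patchE.
  transitivity ((w t)%:E * area t)%E.
    rewrite /area -ge0_integralZl.
    - by apply: eq_integral => p _; rewrite /F /= EFinM; congr (_ * _%:E)%E; rewrite !indicE.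
    - by [].
    - exact: mh.
    - by move=> p _; exact: h0.
    - by rewrite lee_fin.
  rewrite /w indicE; have [/set_mem|] := boolP (t \in I); last by rewrite mulr0 mul0e.
  rewrite /I /= in_itv /= mulr1 => /andP[+ _]; rewrite le_eqVlt => /predU1P[<-|t0].
    rewrite [in RHS]expr0n /= !mulr0 /area integral0_eq ?mule0// => p _.
    by rewrite indicE memNset//= ltNge sqnorm_ge0.
  rewrite area_scale// aE -!EFinM; congr EFin; rewrite exprS.
  have k2 : (k.+2%:R : R) != 0 by rewrite pnatr_eq0.
  by move: (k.+1%:R : R) (k.+2%:R : R) k2 (t ^+ k) => a b b0 x; field.
rewrite -L T [LHS]integral_mkcond; apply: eq_integral => p _; rewrite patchE.
have [/set_mem/plane_discP pD|pD] := boolP (p \in @plane_disc R); last first.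
  rewrite integral0_eq// => t _; rewrite /F /w /= indicE.
  have [/set_mem|_] := boolP (t \in I); last by rewrite mulr0 mul0r.
  rewrite /I /= in_itv /= => /andP[_ t1]; rewrite indicE memNset ?mulr0// /S /=.
  apply/negP; rewrite -leNgt (le_trans t1)// leNgt; apply/negP => pD'.
  by move: pD; rewrite notin_setE; apply; exact/plane_discP.
transitivity (\int[mu]_(t in `]sqnorm p, 1%R]) (k.+1%:R * t ^+ k)%:E)%E.
  rewrite integral_itv_obnd_cbnd; last first.
    apply/measurable_EFinP; apply: measurable_funM => //; exact: measurable_funX.
  by rewrite integral_rint ?rint_pow ?expr1n// ?ltW//; exact: rcont_pow.
rewrite [LHS]integral_mkcond; apply: eq_integral => t _; rewrite patchE /F /w /=.
have [/set_mem|] := boolP (t \in _).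
  rewrite /= in_itv /= => /andP[Vt t1].
  rewrite !indicE !mem_set ?mulr1// /I /= in_itv /= t1 andbT.
  by rewrite (le_trans (sqnorm_ge0 p))// ltW.
rewrite notin_setE /= in_itv /= => /negP; rewrite negb_and -!leNgt -ltNge => Ht.
rewrite !indicE; have [/set_mem|_] := boolP (t \in I); last by rewrite mulr0 mul0r.
rewrite /I /= in_itv /= => /andP[_ t1].
have [/set_mem|_] := boolP ((p, t) \in S); last by rewrite mulr0.
by rewrite /S /= => Vt; move: Ht; rewrite leNgt Vt /= ltNge t1.
Qed.

(** With V = |p|^2, V^k (1 - V) = (1 - V^(k+1)) - (1 - V^k), and the two layer-cake values differ by
    K / ((k+1)(k+2)). The identity is used in additive form, so that no infinite integrals are
    subtracted. *)
Lemma momentE : exists2 K : R, 0 < K &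
  forall k, moment R k = (K / (k.+1%:R * k.+2%:R))%:E.
Proof.
have [K K0 aE] := area1_fin; exists (2 / pi * K).
  by rewrite !mulr_gt0// invr_gt0 pi_gt0.
move=> k; have pp := pi_gt0 R.
have mV n : measurable_fun (@plane_disc R) (fun p => sqnorm p ^+ n).
  by apply: measurable_funTS; exact: (measurable_funX n (@measurable_sqnorm R)).
have L1 := layer_cake k aE; have L2 := layer_cake k.+1 aE.
pose M := (\int[mu2]_(p in @plane_disc R) (sqnorm p ^+ k * (1 - sqnorm p))%:E)%E.
have Vk p n : plane_disc p -> 0 <= 1 - sqnorm p ^+ n.
  by move=> /plane_discP pD; rewrite subr_ge0 exprn_ile1 ?sqnorm_ge0// ltW.
have Vm p : plane_disc p -> 0 <= sqnorm p ^+ k * (1 - sqnorm p).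
  by move=> pD; have := Vk p 1%N pD; rewrite expr1 => ?; rewrite mulr_ge0// exprn_ge0// sqnorm_ge0.
have mM : measurable_fun (@plane_disc R) (fun p => sqnorm p ^+ k * (1 - sqnorm p)).
  apply: measurable_funM => //; apply: measurable_funB => //.
  by apply: measurable_funTS; exact: measurable_sqnorm.
have mk n : measurable_fun (@plane_disc R) (fun p => 1 - sqnorm p ^+ n) by apply: measurable_funB.
have ME : (M + (k%:R / k.+1%:R * K)%:E = (k.+1%:R / k.+2%:R * K)%:E)%E.
  rewrite -L1 -L2 -ge0_integralD.
  - by apply: eq_integral => p _; rewrite -EFinD; congr EFin; rewrite exprS; ring.
  - exact: measurable_plane_disc.
  - by move=> p pD; rewrite lee_fin Vm.
  - exact/measurable_EFinP.
  - by move=> p pD; rewrite lee_fin Vk.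
  - exact/measurable_EFinP.
have MK : M = (K / (k.+1%:R * k.+2%:R))%:E.
  move: ME; case: M => [m| |]//= -[H]; congr EFin.
  have k1 : (k.+1%:R : R) != 0 by rewrite pnatr_eq0.
  have k2 : (k.+2%:R : R) != 0 by rewrite pnatr_eq0.
  have -> : m = k.+1%:R / k.+2%:R * K - k%:R / k.+1%:R * K by rewrite -H addrK.
  have e1 : k.+1%:R = k%:R + 1 :> R by rewrite natr1.
  have e2 : k.+2%:R = k%:R + 1 + 1 :> R by rewrite !natr1.
  rewrite e1 e2 in k1 k2 *; move: (k%:R : R) k1 k2 => x x1 x2.
  by field; rewrite x1 x2.
have -> : 2 / pi * K / (k.+1%:R * k.+2%:R) = (2 / pi) * (K / (k.+1%:R * k.+2%:R)) by rewrite !mulrA.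
rewrite /moment EFinM -MK /M -ge0_integralZl.
- by apply: eq_integral => p _; rewrite -EFinM; congr EFin; rewrite /A1_weight; ring.
- exact: measurable_plane_disc.
- exact/measurable_EFinP.
- by move=> p pD; rewrite lee_fin Vm.
- by rewrite lee_fin divr_ge0 ?ltW.
Qed.

End Moments.

(** * Littlewood-Paley equivalence *)

Section Norms.
Variable R : realType.
Local Notation mu := (@lebesgue_measure R).
Local Notation mu2 := ((@lebesgue_measure R) \x (@lebesgue_measure R))%E.
Local Notation RR := (measurableTypeR R).
Implicit Types (f g : CC R -> CC R).

(** Norms enter the argument only through real upper bounds; this form of convergence to 0 also
    tolerates infinite initial terms. *)
Definition ecvg0 (x : nat -> \bar R) := forall e : R, 0 < e ->
  exists N, forall n, (N <= n)%N -> (x n <= e%:E)%E.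

Lemma ecvg0P (x : nat -> \bar R) : (forall n, 0 <= x n)%E -> (x @ \oo --> 0%E) <-> ecvg0 x.
Proof.
move=> x0; split.
  move=> /fine_cvgP[[N1 _ H1] /cvgrPdist_le H2] e e0.
  have [N2 _ {}H2] := H2 e e0; exists (maxn N1 N2) => n; rewrite geq_max => /andP[n1 n2].
  rewrite -(fineK (H1 n n1)) lee_fin; have := H2 n n2.
  by rewrite sub0r normrN; apply: le_trans; exact: ler_norm.
move=> H; apply/fine_cvgP; split.
  have [N HN] := H 1 ltr01; exists N => // n /= /HN xn.
  by rewrite ge0_fin_numE// (le_lt_trans xn)// ltry.
apply/cvgrPdist_le => e e0; have [N HN] := H e e0; exists N => // n /= /HN xn.
rewrite sub0r normrN ger0_norm; last exact: fine_ge0.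
by rewrite -lee_fin fineK// ge0_fin_numE// (le_lt_trans xn)// ltry.
Qed.

Lemma nneseries_leP (u : nat -> R) (M : R) : (forall k, 0 <= u k) ->
  (\sum_(k <oo) (u k)%:E <= M%:E)%E <-> forall n, \sum_(k < n) u k <= M.
Proof.
move=> u0; split => H.
  move=> n; rewrite -lee_fin; apply: le_trans H.
  rewrite -sumEFin -(big_mkord xpredT (fun k => (u k)%:E)).
  by apply: nneseries_lim_ge => k _ _; rewrite lee_fin.
apply: lime_le; first by apply: is_cvg_nneseries => k _ _; rewrite lee_fin.
by apply: nearW => n; rewrite big_mkord sumEFin lee_fin.
Qed.

Lemma A1norm2_leP : exists2 K : R, 0 < K & forall f (M : R), holo f ->
  (A1norm2 f <= M%:E)%E <->
  forall n, \sum_(k < n) cabs2 (coef f k) * (K / (k.+1%:R * k.+2%:R)) <= M.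
Proof.
have [K K0 HK] := momentE R; exists K => // f M hf.
have -> : A1norm2 f = (\sum_(k <oo) (cabs2 (coef f k) * (K / (k.+1%:R * k.+2%:R)))%:E)%E.
  rewrite (A1norm2_moment hf); apply: eq_eseriesr => k _; by rewrite HK EFinM.
apply: nneseries_leP => k.
by rewrite mulr_ge0 ?cabs2_ge0// divr_ge0 ?mulr_ge0// ltW.
Qed.

(* The n-th coefficients of f' and f differ by the factor n.+1, so the weight
   of |coef f n.+1|^2 in A1norm2 (cderiv f) is K * (n + 1) / (n + 2). *)
Lemma littlewood_paley : exists2 K : R, 0 < K & forall f, holo f ->
  (forall M : R, (H2norm2 f <= M%:E)%E -> (A1norm2 (cderiv f) <= (K * M)%:E)%E) /\
  (forall M : R, (A1norm2 (cderiv f) <= M%:E)%E -> (H2norm2 f <= (cabs2 (f 0) + K * M)%:E)%E).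
Proof.
have [K K0 HK] := A1norm2_leP.
(* The weight K (n+1) / (n+2) lies between K/2 and K; the maximum serves both directions. *)
exists (Num.max K (2 / K)); first by rewrite lt_max K0.
move=> f hf; have hf' := holo_cderiv hf.
have E k : cabs2 (coef (cderiv f) k) * (K / (k.+1%:R * k.+2%:R)) =
    K * (k.+1%:R / k.+2%:R) * cabs2 (coef f k.+1).
  rewrite coef_cderiv// cabs2M -sqr_cabs cabs_nat.
  have k1 : (k.+1%:R : R) != 0 by rewrite pnatr_eq0.
  have k2 : (k.+2%:R : R) != 0 by rewrite pnatr_eq0.
  by move: (k.+1%:R : R) (k.+2%:R : R) k1 k2 => x y x0 y0; field; rewrite x0 y0.
split=> M.
  move=> /(H2norm2_leP M hf) H; apply/HK => // n.
  have M0 : 0 <= M by have := H 0%N; rewrite big_ord0.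
  apply: (@le_trans _ _ (K * M)); last by rewrite ler_wpM2r// le_max lexx.
  apply: (@le_trans _ _ (K * \sum_(k < n) cabs2 (coef f k.+1))).
    rewrite mulr_sumr; apply: ler_sum => k _; rewrite E.
    rewrite ler_wpM2r ?cabs2_ge0// ler_piMr//; first exact: ltW.
    by rewrite ler_pdivrMr// mul1r ler_nat.
  rewrite ler_pM2l//; apply: le_trans (H n.+1).
  by rewrite big_ord_recl /= lerDr cabs2_ge0.
move=> /(HK _ _ hf') H; apply/H2norm2_leP => // n.
have M0 : 0 <= M by have := H 0%N; rewrite big_ord0.
have S : K / 2 * \sum_(k < n) cabs2 (coef f k.+1) <= M.
  apply: le_trans (H n); rewrite mulr_sumr; apply: ler_sum => k _; rewrite E.
  rewrite ler_wpM2r ?cabs2_ge0// ler_pM2l// ler_pdivlMr// -[k.+2%:R]natr1 -[k.+1%:R]natr1.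
  have : (0 : R) <= k%:R by []; lra.
apply: (@le_trans _ _ (cabs2 (f 0) + 2 / K * M)); last first.
  by rewrite lerD2l ler_wpM2r// le_max lexx orbT.
case: n S => [|n] S; first by rewrite big_ord0 addr_ge0 ?cabs2_ge0// mulr_ge0// divr_ge0// ltW.
rewrite big_ord_recl /= coef0E// lerD2l.
have S' : \sum_(k < n.+1) cabs2 (coef f k.+1) <= 2 / K * M.
  by rewrite -[leRHS]mul1r mulrA mul1r -ler_pdivrMl ?divr_gt0// invf_div.
apply: le_trans S'; rewrite big_ord_recr /= lerDl; exact: cabs2_ge0.
Qed.

Lemma A1norm2_ge0 f : (0 <= A1norm2 f)%E.
Proof. by rewrite A1norm2E; apply: integral_ge0 => p _; exact: A1_density_ge0. Qed.

Lemma eq_A1norm2 f g : (forall z, in_disc z -> f z = g z) -> A1norm2 f = A1norm2 g.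
Proof.
move=> fg; rewrite !A1norm2E; apply: eq_integral => p _; rewrite /A1_density !patchE.
by case: ifPn => // /set_mem pD; rewrite fg.
Qed.

(** The common source of the estimates for sums, differences and products. *)
Lemma A1norm2_dom f g h (c d M N : R) : holo f -> holo g -> holo h -> 0 <= c -> 0 <= d ->
  (forall z, in_disc z -> cabs2 (f z) <= c * cabs2 (g z) + d * cabs2 (h z)) ->
  (A1norm2 g <= M%:E)%E -> (A1norm2 h <= N%:E)%E -> (A1norm2 f <= (c * M + d * N)%:E)%E.
Proof.
move=> hf hg hh c0 d0 H gM hN.
apply: (@le_trans _ _ (c%:E * A1norm2 g + d%:E * A1norm2 h)%E); last first.
  by rewrite EFinD !EFinM; apply: leeD; apply: lee_wpmul2l; rewrite ?lee_fin.
rewrite !A1norm2E.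
have mk e k : measurable_fun setT (A1_density k) -> measurable_fun setT (fun p => e%:E * A1_density k p)%E.
  by move=> mh; apply: emeasurable_funM => //; exact: measurable_cst.
have mg := measurable_A1_density hg; have mh := measurable_A1_density hh; have mf := measurable_A1_density hf.
have e0 e k p : 0 <= e -> (0 <= e%:E * A1_density k p)%E.
  by move=> e0; rewrite mule_ge0 ?A1_density_ge0.
rewrite -ge0_integralZl; [|by []|exact: mg|by move=> p _; exact: A1_density_ge0|by rewrite lee_fin].
rewrite -ge0_integralZl; [|by []|exact: mh|by move=> p _; exact: A1_density_ge0|by rewrite lee_fin].
rewrite -ge0_integralD; [|by []|by move=> p _; exact: e0|exact: mk|by move=> p _; exact: e0|exact: mk].
apply: ge0_le_integral; [by []|by move=> p _; exact: A1_density_ge0|exact: mf| |].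
  by apply: emeasurable_funD; exact: mk.
move=> p _; rewrite /A1_density !patchE; case: ifPn => [/set_mem pD|_]; last by rewrite !mule0 adde0.
rewrite -!EFinM -EFinD lee_fin [c * (_ * A1_weight p)]mulrA [d * (_ * A1_weight p)]mulrA -mulrDl ler_wpM2r ?A1_weight_ge0//.
exact: (H (cpoint p) pD).
Qed.

Lemma A1norm2_Dle f g (M N : R) : holo f -> holo g ->
  (A1norm2 f <= M%:E)%E -> (A1norm2 g <= N%:E)%E ->
  (A1norm2 (fun z => f z + g z)%R <= (2 * (M + N))%:E)%E.
Proof.
move=> hf hg fM gN; rewrite mulrDr.
have D z : in_disc z -> cabs2 (f z + g z) <= 2 * cabs2 (f z) + 2 * cabs2 (g z).
  by move=> _; rewrite -mulrDr; exact: le_cabs2D.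
have h2 : (0 : R) <= 2 by [].
exact: (A1norm2_dom (holoD hf hg) hf hg h2 h2 D fM gN).
Qed.

Lemma A1norm2_Mle f g (B M : R) : holo f -> holo g ->
  (forall z, in_disc z -> cabs2 (g z) <= B) ->
  (A1norm2 f <= M%:E)%E -> (A1norm2 (fun z => g z * f z)%R <= (B * M)%:E)%E.
Proof.
move=> hf hg gB fM.
have B0 : 0 <= B.
  by rewrite (le_trans _ (gB 0 _)) ?cabs2_ge0//; apply/in_discP; rewrite cabs0.
rewrite -[B * M]addr0 -(mul0r M).
have D z : in_disc z -> cabs2 (g z * f z) <= B * cabs2 (f z) + 0 * cabs2 (f z).
  by move=> zD; rewrite mul0r addr0 cabs2M ler_wpM2r ?cabs2_ge0// gB.
exact: (A1norm2_dom (holoM hg hf) hf hf B0 (lexx 0) D fM fM).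
Qed.

Lemma A1norm2_Ble f g (M N : R) : holo f -> holo g ->
  (A1norm2 f <= M%:E)%E -> (A1norm2 g <= N%:E)%E ->
  (A1norm2 (fun z => f z - g z)%R <= (2 * (M + N))%:E)%E.
Proof.
move=> hf hg fM gN; apply: (A1norm2_Dle hf (holoN hg)) => //.
rewrite (_ : A1norm2 _ = A1norm2 g)// !A1norm2E; apply: eq_integral => p _.
by rewrite /A1_density !patchE cabs2N.
Qed.

(** B times the density of v is the integrable majorant for dominated convergence. *)
Lemma A1norm2_dominated v (d : nat -> CC R -> CC R) (B M : R) : holo v -> (A1norm2 v <= M%:E)%E ->
  (forall n, holo (d n)) -> (forall n z, in_disc z -> cabs2 (d n z) <= B) ->
  (forall z, in_disc z -> ccvg (fun n => d n z) 0) ->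
  ecvg0 (fun n => A1norm2 (fun z => v z * d n z)).
Proof.
move=> hv vM hd dB d0; apply/ecvg0P; first by move=> n; exact: A1norm2_ge0.
have hvd n := holoM hv (hd n).
have B0 : 0 <= B.
  by rewrite (le_trans _ (dB 0%N 0 _)) ?cabs2_ge0//; apply/in_discP; rewrite cabs0.
have mv := measurable_A1_density hv.
have iv : mu2.-integrable setT (A1_density v).
  apply/integrableP; split => //.
  rewrite (eq_integral (A1_density v)); last by move=> p _; rewrite gee0_abs// A1_density_ge0.
  by rewrite -A1norm2E (le_lt_trans vM)// ltry.
have ig : mu2.-integrable setT (fun p => B%:E * A1_density v p)%E by exact: integrableZl.
pose F n p := A1_density (fun z => v z * d n z) p.
have Fd n p : (`|F n p| <= B%:E * A1_density v p)%E.
  rewrite gee0_abs ?A1_density_ge0// /F /A1_density !patchE; case: ifPn => [/set_mem pD|_]; last by rewrite mule0.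
  rewrite -EFinM lee_fin cabs2M mulrAC mulrC ler_wpM2r//.
    by rewrite mulr_ge0 ?cabs2_ge0 ?A1_weight_ge0.
  exact: dB.
have F0 p : setT p -> F n p @[n --> \oo] --> 0%E.
  move=> _; apply/ecvg0P => [n|]; first exact: A1_density_ge0.
  move=> e e0; rewrite /F /A1_density.
  have [pD|pD] := pselect (plane_disc p); last first.
    by exists 0%N => n _; rewrite patchE memNset// lee_fin ltW.
  have K0 : 0 <= cabs2 (v (cpoint p)) * A1_weight p by rewrite mulr_ge0 ?cabs2_ge0 ?A1_weight_ge0.
  pose K := cabs2 (v (cpoint p)) * A1_weight p + 1.
  have K1 : 0 < K by rewrite ltr_wpDl.
  have e1 : 0 < Num.min 1 (e / K) by rewrite lt_min ltr01 divr_gt0.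
  have [N HN] := d0 (cpoint p) pD _ e1; exists N => n /HN; rewrite subr0 => dn.
  rewrite patchE mem_set// lee_fin cabs2M mulrAC.
  apply: (@le_trans _ _ (K * (e / K))); last by rewrite mulrC divfK// gt_eqF.
  apply: ler_pM; rewrite ?cabs2_ge0// ?lerDl// -sqr_cabs expr2.
  have m1 : Num.min 1 (e / K) <= 1 by rewrite ge_min lexx.
  have m2 : Num.min 1 (e / K) <= e / K by rewrite ge_min lexx orbT.
  rewrite -[leRHS]mul1r; apply: ler_pM; rewrite ?cabs_ge0//.
    exact: le_trans dn m1.
  exact: le_trans dn m2.
have mF n : measurable_fun setT (F n) by exact: measurable_A1_density (hvd n).
have ae1 : {ae mu2, forall p, setT p -> F ^~ p @ \oo --> (cst 0%E : RR * RR -> \bar R) p}.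
  exact: aeW.
have ae2 : {ae mu2, forall p n, setT p -> (`|F n p| <= B%:E * A1_density v p)%E}.
  by apply: aeW => p n _; exact: Fd.
have [_ _] := dominated_convergence measurableT mF (measurable_cst _) ae1 ig ae2.
by rewrite integral0; under eq_fun do rewrite -A1norm2E.
Qed.

End Norms.

(** * Normal families, primitives and logarithms *)

Section NormalFamilies.
Variable R : realType.
Implicit Types (f g : CC R -> CC R) (a : nat -> CC R).

(** Tychonoff's theorem for a product of segments takes the place of a diagonal extraction;
    neighbourhoods constraining finitely many coordinates suffice. *)
Lemma cluster_point (x : nat -> nat -> R) (B : R) : (forall k i, `|x k i| <= B) ->
  exists p : nat -> R, forall n e, 0 < e -> forall J, exists k, (J < k)%N /\ forall i, (i <= n)%N -> `|x k i - p i| <= e.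
Proof.
move=> xB.
have cp := @tychonoff nat (fun=> R) (fun=> `[- B, B]%classic) (fun=> @segment_compact R _ _).
set PT := prod_topology (fun _ : nat => R).
have [|p [_ pc]] := cp (x @ \oo) _.
  by exists 0%N => // k _ i /=; rewrite in_itv /= -ler_norml.
exists p => n e e0 J.
have P i : nbhs (p : PT) (proj i @^-1` (ball (p i) e)).
  have H := @proj_continuous nat (fun=> R) i p.
  exact: (H _ (nbhsx_ballx (p i) e e0)).
have P' : nbhs (p : PT) [set f : PT | forall i, (i <= n)%N -> ball (p i) e (f i)].
  elim: n => [|n IH].
    apply: (@filterS _ (nbhs (p : PT)) _ _ _ _ (P 0%N)) => f fp i; rewrite leqn0 => /eqP ->.
    exact: fp.
  apply: (@filterS2 _ (nbhs (p : PT)) _ _ _ _ _ IH (P n.+1)) => f H1 H2 i; rewrite leq_eqVlt => /predU1P[->|].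
    exact: H2.
  by rewrite ltnS => /H1.
have N1 : (x @ \oo) [set x k | k in [set k | (J < k)%N]].
  by exists J.+1 => // k /= Jk; exists k.
have [_ [[k Jk <-] kp]] := pc _ _ N1 P'.
exists k; split => // i /kp; rewrite /ball /= distrC; exact: ltW.
Qed.

Lemma bounded_subseq (x : nat -> nat -> R) (B : R) : (forall k i, `|x k i| <= B) ->
  exists (s : nat -> nat) (p : nat -> R), (forall n, (s n < s n.+1)%N) /\
    forall n i, (i <= n)%N -> `|x (s n) i - p i| <= n.+1%:R^-1.
Proof.
move=> xB; have [p Hp] := cluster_point xB.
have [F HF] : exists F : nat -> nat -> nat, forall n J, (J < F n J)%N /\
    forall i, (i <= n)%N -> `|x (F n J) i - p i| <= n.+1%:R^-1.
  have /choice[F HF] : forall nJ : nat * nat, exists j, (nJ.2 < j)%N /\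
      forall i, (i <= nJ.1)%N -> `|x j i - p i| <= nJ.1.+1%:R^-1.
    by case=> n J /=; apply: Hp; rewrite invr_gt0.
  by exists (fun n J => F (n, J)) => n J; exact: HF (n, J).
pose s := fix s n := if n is m.+1 then F m.+1 (s m) else F 0%N 0%N.
exists s, p; split; first by move=> n; exact: (HF n.+1 (s n)).1.
by case=> [|n] i; [exact: (HF 0%N 0%N).2|exact: (HF n.+1 (s n)).2].
Qed.

Lemma cvg_inv_succ (e : R) : 0 < e -> exists N, forall n, (N <= n)%N -> n.+1%:R^-1 <= e.
Proof.
move=> e0; have : (fun n => n.+1%:R^-1 : R) @ \oo --> (0 : R) by exact: cvg_harmonic.
move=> /cvgrPdist_le/(_ e e0)[N _ HN]; exists N => n /HN.
by rewrite sub0r normrN ger0_norm// invr_ge0.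
Qed.

(** Normal families by coefficients: extract so that every coefficient converges. The common bound
    on coefficients makes the tails at z uniformly small, and finite sums converge. *)
Lemma H2_subseq (fs : nat -> CC R -> CC R) (M : R) :
  (forall n, holo (fs n)) -> (forall n, (H2norm2 (fs n) <= M%:E)%E) ->
  exists (s : nat -> nat) f, [/\ forall n, (s n < s n.+1)%N, holo f, (H2norm2 f <= M%:E)%E &
    forall z, in_disc z -> ccvg (fun n => fs (s n) z) (f z)].
Proof.
move=> hfs fM; pose B := Num.sqrt M.
(* Real parts at even indices and imaginary parts at odd ones, to fit the extraction for real
   arrays. *)
pose x k i : R := if odd i then complex.Im (coef (fs k) i./2) else complex.Re (coef (fs k) i./2).
have cB k n : cabs (coef (fs k) n) <= B by exact: coef_le.
have xB k i : `|x k i| <= B.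
  rewrite /x; case: ifP => _; apply: le_trans (cB k i./2).
    exact: Im_le_cabs.
  exact: Re_le_cabs.
have [s [p [sS sp]]] := bounded_subseq xB.
pose a n : CC R := (p n.*2 +i* p n.*2.+1)%C.
have ca n : ccvg (fun k => coef (fs (s k)) n) (a n).
  move=> e e0; have e2 : 0 < e / 2 by rewrite divr_gt0.
  have [N HN] := cvg_inv_succ e2; exists (maxn N n.*2.+1) => k.
  rewrite geq_max => /andP[kN kn].
  rewrite (le_trans (cabs_le_ReIm _))// [leRHS]splitr /a lerD//.
    have := sp k n.*2 (ltnW kn); rewrite /x odd_double doubleK ReD ReN /= => /le_trans; apply.
    exact: HN.
  have := sp k n.*2.+1 kn; rewrite /x oddS odd_double [n.*2.+1./2]uphalf_double ImD ImN /= => /le_trans; apply.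
  exact: HN.
have ga : growth a.
  apply: (@bounded_growth _ _ B) => n; rewrite -[a n]subr0.
  apply: (ccvg_le (N := 0%N) (ca n)) => k _; rewrite subr0; exact: cB.
have hf := holo_ps ga; exists s, (ps a); split => //.
  apply/H2norm2_leP => // n.
  have -> : \sum_(k < n) cabs2 (coef (ps a) k) = \sum_(k < n) cabs2 (a k).
    by apply: eq_bigr => k _; rewrite coef_ps.
  have cs : (fun k => \sum_(i < n) cabs2 (coef (fs (s k)) i)) @ \oo --> \sum_(i < n) cabs2 (a i).
    elim: n => [|n IH].
      by under eq_fun do rewrite big_ord0; rewrite big_ord0; exact: cvg_cst.
    under eq_fun do rewrite big_ord_recr /=.
    by rewrite big_ord_recr /=; apply: cvgD => //; exact: cvg_cabs2.
  apply: (cvgr_to_le cs); apply: nearW => k.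
  by have /(H2norm2_leP M (hfs _)) := fM (s k).
move=> z zD e e0; move/in_discP: (zD) => z1.
have z01 : 0 <= cabs z < 1 by rewrite cabs_ge0.
have e3 : 0 < e / 3 by rewrite divr_gt0.
have [N HN] := expr_to0 (B / (1 - cabs z)) z01 e3.
have zz : cabs z <= cabs z * 1 by rewrite mulr1.
have tail b : (forall n, cabs (b n) <= B) -> cabs (ps b z - psum b N z) <= e / 3.
  move=> bB; apply: le_trans (HN N (leqnn _)).
  apply: (ps_tail _ ltr01 z01 _ zz) => n.
  by rewrite expr1n mulr1.
have aB n : cabs (a n) <= B.
  rewrite -[a n]subr0; apply: (ccvg_le (N := 0%N) (ca n)) => k _; rewrite subr0; exact: cB.
have cps m : ccvg (fun k => psum (coef (fs (s k))) m z) (psum a m z).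
  elim: m => [|m IH].
    by move=> d d0; exists 0%N => k _; rewrite /psum !big_ord0 subrr cabs0 ltW.
  move=> d d0; have d2 : 0 < d / 2 by rewrite divr_gt0.
  have [N1 H1] := IH _ d2; have [N2 H2] := ca m _ d2.
  exists (maxn N1 N2) => k; rewrite geq_max => /andP[k1 k2].
  rewrite !psumS opprD addrACA -mulrBl (le_trans (cabsD _ _))// [leRHS]splitr lerD ?H1//.
  rewrite cabsM (le_trans _ (H2 k k2))// ler_piMr ?cabs_ge0// cabsX exprn_ile1 ?cabs_ge0//.
  exact: ltW.
have [N1 H1] := cps N _ e3; exists N1 => k k1.
rewrite (holo_psE (hfs _) zD).
have -> : ps (coef (fs (s k))) z - ps a z =
    (ps (coef (fs (s k))) z - psum (coef (fs (s k))) N z)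
    + ((psum (coef (fs (s k))) N z - psum a N z) - (ps a z - psum a N z)).
  by move: (ps _ _) (ps _ _) (psum _ _ _) (psum _ _ _) => p1 p2 p3 p4; rewrite opprB !addrA !subrK.
apply: (@le_trans _ _ (e / 3 + (e / 3 + e / 3))); last by rewrite -!mulrDl; lra.
apply: le_trans (cabsD _ _) _; apply: lerD; first by apply: tail; exact: cB.
by apply: le_trans (cabsB _ _) _; apply: lerD; [exact: H1|exact: tail].
Qed.

Lemma primitive g (c : CC R) : holo g -> exists f, [/\ holo f, f 0 = c &
  forall z, in_disc z -> cderiv f z = g z].
Proof.
move=> hg; pose a n : CC R := if n is m.+1 then (m.+1%:R)^-1 * coef g m else c.
have ga : growth a.
  move=> r r01; have [M HM] := growth_coef hg r01.
  case/andP: r01 => r0 r1.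
  exists (Num.max M (cabs c)) => -[|n]; first by rewrite expr0 mulr1 /= le_max lexx orbT.
  rewrite (@le_trans _ _ M)//; last by rewrite le_max lexx.
  apply: le_trans (HM n); rewrite /= cabsM cabsV cabs_nat exprS.
  rewrite [_ * cabs _]mulrC -mulrA ler_wpM2l ?cabs_ge0// mulrA ler_piMl ?exprn_ge0 ?(ltW r0)//.
  by rewrite mulr_ile1 ?invr_ge0 ?(ltW r0) ?(ltW r1)// invf_le1// ler1n.
have hf := holo_ps ga; exists (ps a); split => //.
  by rewrite -coef0E// coef_ps.
move=> z zD; rewrite (cderivE hf zD) (holo_psE hg zD).
suff -> : dcoef (coef (ps a)) = coef g by [].
apply/funext => n; rewrite /dcoef (coef_ps _ ga) /a mulrA mulfV ?mul1r//.
Qed.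

Lemma cderiv0_const f z : holo f -> (forall w, in_disc w -> cderiv f w = 0) ->
  in_disc z -> f z = f 0.
Proof.
move=> hf f'0 zD; rewrite (holo_psE hf zD) -coef0E//.
have c0 n : coef f n.+1 = 0.
  have : coef (cderiv f) n = 0.
    have E := @eq_coef R (cderiv f) (fun=> 0) n (holo_cderiv hf) f'0; rewrite E.
    by rewrite /coef (eq_mean (g := fun=> 0)) ?mean_cst// => t; rewrite mul0r.
  rewrite coef_cderiv// => /eqP; rewrite mulf_eq0 => /orP[|/eqP//].
  by rewrite -cabs_eq0 cabs_nat pnatr_eq0.
apply: (@ccvg_unique _ (fun N => psum (coef f) N z)).
  by apply: ps_cvg; [exact: growth_coef|exact/in_discP].
move=> e e0; exists 1%N => -[//|n] _; rewrite /psum big_ord_recl expr0 mulr1 big1.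
  by rewrite addr0 subrr cabs0 ltW.
by move=> i _; rewrite c0 mul0r.
Qed.

(* The continuous function Im L cannot cross +-pi/2, where the real part of e^L vanishes. *)
Lemma holo_log f : holo f -> (forall z, in_disc z -> 0 < complex.Re (f z)) ->
  exists L, [/\ holo L, forall z, in_disc z -> cexp (L z) = f z &
    forall z, in_disc z -> `|complex.Im (L z)| <= pi / 2].
Proof.
move=> hf f0.
have fn0 z : in_disc z -> f z != 0.
  by move=> zD; apply: contraTneq (f0 z zD) => ->; rewrite ltxx.
have D0 : in_disc (0 : CC R) by apply/in_discP; rewrite cabs0.
pose x := complex.Re (f 0); pose y := complex.Im (f 0).
have x0 : 0 < x by exact: f0.
(* The argument of f 0, an arctangent because Re f(0) > 0. L will be the primitive of f'/f with
   value l0 at 0. *)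
pose th := atan (y / x).
pose l0 : CC R := (ln (x * Num.sqrt (1 + (y / x) ^+ 2)) +i* th)%C.
have q0 : 0 < Num.sqrt (1 + (y / x) ^+ 2) by rewrite sqrtr_gt0 ltr_wpDr ?sqr_ge0.
have ct : cos th = (Num.sqrt (1 + (y / x) ^+ 2))^-1 by rewrite /th cos_atan.
have st : sin th = y / x * (Num.sqrt (1 + (y / x) ^+ 2))^-1.
  have := atanK (y / x); rewrite -/th /tan ct => /(congr1 (fun u => u * (Num.sqrt (1 + (y / x) ^+ 2))^-1)).
  by rewrite divfK// invr_neq0// gt_eqF.
have el0 : cexp l0 = f 0.
  rewrite /cexp /l0 /= lnK ?posrE ?mulr_gt0// ct st.
  have qn := gt_eqF q0; have xn := gt_eqF x0.
  apply: ccP => /=; first by rewrite mulfK// qn.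
  by rewrite -/y; field; rewrite xn qn.
have hg : holo (fun z => cderiv f z * (f z)^-1) by exact: (holoM (holo_cderiv hf) (holoV hf fn0)).
have [L [hL L0 L']] := primitive l0 hg.
have eL z : in_disc z -> cexp (L z) = f z.
  (* This product has derivative 0, hence keeps its value 1 at the origin. *)
  move=> zD; pose k z := f z * cexp (- L z).
  have dk w : in_disc w -> cdiff k w 0.
    move=> wD; have h1 := @cdiff_comp _ (@cexp R) (fun w => - L w) w _ _ (cdiff_cexp _) (cdiffN (holo_cdiff hL wD)).
    have := cdiffM (holo_cdiff hf wD) h1; rewrite L'//.
    rewrite (_ : _ + _ = 0)// mulrN mulrN mulrCA [_ * (_ * (f w)^-1)]mulrCA divff ?fn0// mulr1.
    by rewrite mulrC subrr.
  have hk : holo k by move=> w wD; exact: cdiff_derivable (dk w wD).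
  have kz : k z = k 0.
    by apply: cderiv0_const => // w wD; exact: cdiff_cderiv (dk w wD).
  move: kz; rewrite /k L0 -el0 -cexpD subrr cexp0 => /(congr1 (fun u => u * cexp (L z))).
  by rewrite -mulrA -cexpD addNr cexp0 mulr1 mul1r.
have cI z : in_disc z -> 0 < cos (complex.Im (L z)).
  move=> zD; have := f0 z zD; rewrite -eL// /cexp /= pmulr_rgt0//.
  exact: expR_gt0.
exists L; split=> // z zD; rewrite leNgt; apply/negP => Lz.
pose h (t : R) := complex.Im (L ((t%:C)%C * z)).
have tD (t : R) : 0 <= t <= 1 -> in_disc ((t%:C)%C * z).
  move=> /andP[t0 t1]; apply/in_discP; rewrite cabsM cabs_real ger0_norm//.
  rewrite (le_lt_trans (ler_piMl (cabs_ge0 _) t1))//; exact/in_discP.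
have ch : rcont 0 1 h.
  suff [_ //] : ccont 0 1 (fun t => L ((t%:C)%C * z)).
  apply: ccont_dist => t t01 e e0.
  have [d d0 Hd] := cdiff_continuous (holo_cdiff hL (tD t t01)) e0.
  exists d => // u _ ut; apply: Hd; rewrite -mulrBl -rmorphB /= cabsM cabs_real.
  rewrite (le_lt_trans _ ut)// ler_piMr// ltW//; exact/in_discP.
have h0 : h 0 = th by rewrite /h mul0r L0.
have h1 : h 1 = complex.Im (L z) by rewrite /h mul1r.
have p2 : cos (pi / 2) = 0 :> R by exact: cos_pihalf.
have thl : - (pi / 2) < th := atan_gtNpi2 _.
have thu : th < pi / 2 := atan_ltpi2 _.
have hit v : cos v = 0 -> Num.min (h 0) (h 1) <= v <= Num.max (h 0) (h 1) -> False.
  move=> cv /(IVT ler01 ch)[t]; rewrite in_itv /= => t01 ht.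
  by have := cI _ (tD t t01); rewrite -/(h t) ht cv ltxx.
move: Lz; rewrite lter_normr => /orP[Lz|Lz].
  apply: (hit (pi / 2)) => //; rewrite h0 h1 ge_min le_max (ltW thu) /=.
  by rewrite (ltW Lz) orbT.
apply: (hit (- (pi / 2))); first by rewrite cosN.
by rewrite h0 h1 ge_min le_max (ltW thl) /= andbT; apply/orP; right; rewrite lerNr ltW.
Qed.

End NormalFamilies.

(** * Herglotz decomposition *)

Section Herglotz.
Variable R : realType.
Implicit Types (f g : CC R -> CC R) (z w : CC R).

(** The Taylor coefficients of (1 + w) / (1 - w). *)
Definition herglotz_factor n : CC R := if n is 0 then 1 else 2.

Lemma cabs2_herglotz_factor n : cabs2 (herglotz_factor n) <= 4.
Proof.
rewrite -sqr_cabs; case: n => [|n]; first by rewrite /herglotz_factor cabs1 expr1n ler1n.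
by rewrite /herglotz_factor cabs_nat -natrX ler_nat.
Qed.

Definition herglotz_kernel N w : CC R := psum herglotz_factor N w.

(** The truncated kernel is (1 + w) / (1 - w), whose real part is nonnegative, minus the geometric
    tail 2 w^(N+1) / (1 - w). *)
Lemma herglotz_kernel_ge w N : cabs w < 1 ->
  - (2 / (1 - cabs w) * cabs w ^+ N.+1) <= complex.Re (herglotz_kernel N.+1 w).
Proof.
move=> w1; have w10 : 1 - w != 0.
  by rewrite subr_eq0; apply: contraTneq w1 => <-; rewrite cabs1 ltxx.
have E : (1 - w) * herglotz_kernel N.+1 w = (1 + w) - 2 * w ^+ N.+1.
  elim: N => [|N IH].
    rewrite /herglotz_kernel /psum big_ord_recr big_ord0 /= expr0 expr1; ring.
  rewrite /herglotz_kernel psumS mulrDr IH !exprS; move: (w ^+ N) => x /=; ring.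
have -> : herglotz_kernel N.+1 w = (1 + w) / (1 - w) - 2 * w ^+ N.+1 / (1 - w).
  by rewrite -mulrBl -E mulrAC divff// mul1r.
set p := 2 * _ / _.
have pq : cabs p <= 2 / (1 - cabs w) * cabs w ^+ N.+1.
  rewrite /p !cabsM cabs_nat cabsX cabsV mulrAC ler_wpM2r ?exprn_ge0 ?cabs_ge0//.
  rewrite ler_wpM2l// lef_pV2 ?posrE ?subr_gt0 ?cabs_gt0//.
  by have := ler_dist_cabs 1 w; rewrite cabs1; apply: le_trans; exact: ler_norm.
have cc (a : CC R) : a * a^*%C = ((cabs2 a)%:C)%C by apply: ccP; rewrite /cabs2 ?ccE; case: a => x y /=; ring.
have n0 : cabs2 (1 - w) != 0 by rewrite -sqr_cabs sqrf_eq0 cabs_eq0.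
have h1 : 0 <= complex.Re ((1 + w) / (1 - w)).
  have w2 : cabs2 w < 1 by exact/in_discP.
  have -> : (1 + w) / (1 - w) = (((cabs2 (1 - w))^-1)%:C)%C * ((1 + w) * (1 - w)^*%C).
    apply: (mulIf w10); rewrite divfK// -mulrA -[X in _ * X]mulrA [_^*%C * _]mulrC cc.
    by rewrite mulrCA -rmorphM /= mulVf// mulr1.
  rewrite ReM /= mul0r subr0 mulr_ge0 ?invr_ge0 ?cabs2_ge0//.
  by move: w2; rewrite /cabs2; case: (w) => x y /= h; lra.
have := ler_norm (complex.Re p); have := Re_le_cabs p; rewrite ReD ReN.
move: pq h1; move: (_ * _ ^+ _) (cabs p) (complex.Re p) (complex.Re _) => *; lra.
Qed.

(* Coefficients of the Herglotz integral of the values of V on the circle of radius r, rescaled to the unit disc. *)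
Definition herglotz_coef (V : CC R -> R) (r : R) n : CC R :=
  herglotz_factor n * mean (fun z => ((V z)%:C)%C * z ^- n) r * ((r ^+ n)%:C)%C.

Section Kernel.
Variables (V : CC R -> R) (r M : R).
Hypotheses (r01 : 0 < r < 1) (cV : rcont 0 (2 * pi) (fun t => V (polar r t))).
Hypothesis VM : rmean2 (fun z => ((V z)%:C)%C) r <= M.

Let r0 : 0 < r. Proof. by case/andP: r01. Qed.

Let cVc : ccont 0 (2 * pi) (fun t => ((V (polar r t))%:C)%C : CC R).
Proof. by split => //=; exact: rcont_cst. Qed.

Lemma herglotz_coef_sum N : \sum_(n < N) cabs2 (herglotz_coef V r n) <= 4 * M.
Proof.
apply: (@le_trans _ _ (4 * \sum_(n < N) cabs2 (mean (fun z => ((V z)%:C)%C * z ^- n) r) * r ^+ n ^+ 2)).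
  rewrite mulr_sumr; apply: ler_sum => n _.
  rewrite /herglotz_coef; move: (mean _ _) => x; rewrite !cabs2M -[cabs2 ((r ^+ n)%:C)%C]sqr_cabs cabs_real real_normK ?num_real//.
  rewrite [leRHS]mulrA ler_wpM2r ?sqr_ge0// ler_wpM2r ?cabs2_ge0//.
  exact: cabs2_herglotz_factor.
by rewrite ler_pM2l// (le_trans (bessel N r01 cVc)).
Qed.

Lemma herglotz_coef_growth : growth (herglotz_coef V r).
Proof.
apply: (@bounded_growth R _ (Num.sqrt (4 * M))) => n.
have := herglotz_coef_sum n.+1; rewrite big_ord_recr /= => H.
rewrite /cabs ler_wsqrtr// (le_trans _ H)// lerDr.
by apply: sumr_ge0 => k _; exact: cabs2_ge0.
Qed.

Lemma herglotz_coef_H2 : (H2norm2 (ps (herglotz_coef V r)) <= (4 * M)%:E)%E.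
Proof.
apply/(H2norm2_leP (4 * M) (holo_ps herglotz_coef_growth)) => N.
rewrite (eq_bigr (fun n : 'I_N => cabs2 (herglotz_coef V r n))) ?herglotz_coef_sum// => n _.
by rewrite coef_ps//; exact: herglotz_coef_growth.
Qed.

(** Continuity of the integrand is proved in the same induction because additivity of the mean
    requires it. *)
Lemma psum_herglotz_coef N z : psum (herglotz_coef V r) N z =
  mean (fun w => ((V w)%:C)%C * herglotz_kernel N ((r%:C)%C * z * w^-1)) r /\
  ccont 0 (2 * pi) (fun t => ((V (polar r t))%:C)%C * herglotz_kernel N ((r%:C)%C * z * (polar r t)^-1)).
Proof.
elim: N => [|N [IH1 IH2]].
  rewrite /herglotz_kernel /psum; split; last first.
    by apply: ccontM => //; under eq_fun do rewrite big_ord0; exact: ccont_cst.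
  by rewrite big_ord0 (eq_mean (g := fun=> 0)) ?mean_cst// => t; rewrite big_ord0 mulr0.
pose c : CC R := herglotz_factor N * ((r ^+ N)%:C)%C * z ^+ N.
have E w : ((V w)%:C)%C * herglotz_kernel N.+1 ((r%:C)%C * z * w^-1) =
    ((V w)%:C)%C * herglotz_kernel N ((r%:C)%C * z * w^-1) + c * (((V w)%:C)%C * w ^- N).
  rewrite /herglotz_kernel psumS mulrDr; congr (_ + _).
  rewrite /c !exprMn exprVn rmorphXn /=.
  by move: (herglotz_factor _) (_ ^- _) (_ ^+ _) (_ ^+ _) => a1 a2 a3 a4; ring.
have c1 : ccont 0 (2 * pi) (fun t => ((V (polar r t))%:C)%C * polar r t ^- N).
  by apply: ccontM => //; exact: ccont_NX.
have c2 : ccont 0 (2 * pi) (fun t => c * (((V (polar r t))%:C)%C * polar r t ^- N)).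
  by apply: ccontM => //; exact: ccont_cst.
split; last by under eq_fun do rewrite E; exact: ccontD.
under [in RHS]eq_fun do rewrite E.
rewrite (@meanD R (fun w => ((V w)%:C)%C * herglotz_kernel N ((r%:C)%C * z * w^-1))
  (fun w => c * (((V w)%:C)%C * w ^- N)) r IH2 c2) -IH1.
rewrite (@meanZ R c (fun w => ((V w)%:C)%C * w ^- N) r c1) psumS; congr (_ + _).
by rewrite /herglotz_coef /c; move: (herglotz_factor _) (mean _ _) => a1 a2; ring.
Qed.

(** Against V >= 0 the negative part of the truncated kernel costs at most the mean of V times a
    geometric tail, which disappears as N grows. *)
Lemma herglotz_Re_ge0 z : (forall t, 0 <= V (polar r t)) -> in_disc z -> 0 <= complex.Re (ps (herglotz_coef V r) z).
Proof.
move=> V0 /in_discP z1.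
have tp := twopi_gt0 R; have it0 : 0 <= (2 * pi)^-1 :> R by rewrite invr_ge0 ltW.
pose m := (2 * pi)^-1 * rint 0 (2 * pi) (fun t => V (polar r t)).
have lb N : - (2 / (1 - cabs z) * m * cabs z ^+ N.+1) <= complex.Re (psum (herglotz_coef V r) N.+1 z).
  have [-> [cN _]] := psum_herglotz_coef N.+1 z.
  rewrite /mean ReM /= mul0r subr0 -mulrA [m * _]mulrC mulrA -mulNr /m mulrCA ler_wpM2l//.
  rewrite -rintZ//; apply: rint_le => //; first by apply: rcontM => //; exact: rcont_cst.
  move=> t _; rewrite ReM /= mul0r subr0 mulrC ler_wpM2l//.
  have q : cabs ((r%:C)%C * z / polar r t) = cabs z.
    rewrite !cabsM cabsV cabs_polar ?(ltW r0)// cabs_real gtr0_norm// mulrAC divff ?mul1r//.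
    by rewrite gt_eqF.
  by have := @herglotz_kernel_ge ((r%:C)%C * z / polar r t) N; rewrite q; exact.
apply: le_epsP => e e0; have e2 : 0 < e / 2 by rewrite divr_gt0.
have z01 : 0 <= cabs z < 1 by rewrite cabs_ge0.
have [N1 H1] := expr_to0 (2 / (1 - cabs z) * m) z01 e2.
have [N2 H2] := ps_cvg herglotz_coef_growth z1 e2.
have := H1 (maxn N1 N2).+1 (leq_trans (leq_maxl _ _) (leqnSn _)).
have := H2 (maxn N1 N2).+1 (leq_trans (leq_maxr _ _) (leqnSn _)).
have := lb (maxn N1 N2); set P := psum _ _ _; set Q := ps _ _.
move=> l1 l2 l3; have := Re_le_cabs (P - Q); rewrite ReD ReN ler_norml => /andP[_].
move: l1 l2 l3; set x1 := _ * _ ^+ _; move: (cabs (P - Q)) (complex.Re P) (complex.Re Q) x1 => *; lra.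
Qed.

End Kernel.

(* On the circle conj(f) z^-n is r^(-2n) times the conjugate of f z^n, whose mean is its value at 0. *)
Lemma mean_conj f n (r : R) : holo f -> 0 < r < 1 ->
  mean (fun z => (f z)^*%C * z ^- n) r = if n is 0 then (f 0)^*%C else 0.
Proof.
move=> hf r01; move/andP: (r01) => [r0 r1].
pose g z := f z * z ^+ n.
have hX : holo (fun z : CC R => z ^+ n) := @holoX R (fun z => z) n (@holo_id R).
have hg : holo g := holoM hf hX.
have mg : mean g r = g 0.
  rewrite -(coef0E hg) (coefE 0 hg r01); apply: eq_mean => t.
  by rewrite expr0 invr1 mulr1.
have r1u : (0 : R) <= r < 1 by rewrite ltW.
have cg := ccont_holo 0 (2 * pi) hg r1u.
have cgc : ccont 0 (2 * pi) (fun t => (g (polar r t))^*%C : CC R).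
  case: cg => cg1 cg2; split.
    by apply: (eq_rcont _ cg1) => t; case: (g _).
  by apply: (eq_rcont _ (rcontN cg2)) => t; case: (g _).
pose k : CC R := (((r ^+ n ^+ 2)^-1)%:C)%C.
have rn0 : r ^+ n ^+ 2 != 0 by rewrite !expf_neq0// gt_eqF.
have E t : (f (polar r t))^*%C * polar r t ^- n = k * (g (polar r t))^*%C.
  rewrite /g conjM circ_conjX// /k [RHS]mulrCA; congr (_ * _).
  by rewrite mulrA -rmorphM /= mulVf// mul1r.
rewrite (eq_mean (g := fun z => k * (g z)^*%C) E) (@meanZ R k (fun z => (g z)^*%C) r cgc).
have -> : mean (fun z => (g z)^*%C) r = (g 0)^*%C.
  rewrite -mg /mean (circ_int_conj cg) conjM; congr (_ * _).
  by apply: ccP => //=; rewrite oppr0.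
rewrite /g /k; case: (n) => [|m]; last by rewrite [0 ^+ m.+1]exprS mul0r mulr0 rmorph0 mulr0.
by rewrite !expr0 expr1n invr1 mulr1 mul1r.
Qed.

(** h1 and h2 are the Herglotz functions of the positive and negative parts of Re f on the circle of
    radius r, rescaled. Their difference is that of Re f itself, which recovers f(r z) up to an
    imaginary constant. *)
Lemma herglotz_circle f (M r : R) : holo f -> (H2norm2 f <= M%:E)%E -> 0 < r < 1 ->
  exists h1 h2, [/\ holo h1 /\ holo h2,
    (H2norm2 h1 <= (4 * M)%:E)%E /\ (H2norm2 h2 <= (4 * M)%:E)%E,
    forall z, in_disc z -> 0 <= complex.Re (h1 z) /\ 0 <= complex.Re (h2 z) &
    forall z, in_disc z -> f ((r%:C)%C * z) = h1 z - h2 z + (0 +i* complex.Im (f 0))%C].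
Proof.
move=> hf fM r01; move/andP: (r01) => [r0 r1].
have r1u : (0 : R) <= r < 1 by rewrite ltW.
have cf := ccont_holo 0 (2 * pi) hf r1u.
have [cR cI] := cf.
have fr : rmean2 f r <= M.
  move: fM; rewrite H2norm2E// => fM; rewrite -lee_fin; apply: le_trans fM.
  by apply: ereal_sup_ubound; exists r => //=; rewrite in_itv /=.
pose V1 z := Num.max (complex.Re (f z)) 0.
pose V2 z := Num.max (- complex.Re (f z)) 0.
have c1 : rcont 0 (2 * pi) (fun t => V1 (polar r t)).
  by move=> t; exact: (continuous_max (cR t) (@rcont_cst R 0 (2 * pi) 0 t)).
have c2 : rcont 0 (2 * pi) (fun t => V2 (polar r t)).
  have cN : rcont 0 (2 * pi) (fun t => - complex.Re (f (polar r t))) by exact: rcontN.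
  by move=> t; exact: (continuous_max (cN t) (@rcont_cst R 0 (2 * pi) 0 t)).
have bnd (V : CC R -> R) : rcont 0 (2 * pi) (fun t => V (polar r t)) ->
    (forall z, `|V z| <= `|complex.Re (f z)|) -> rmean2 (fun z => ((V z)%:C)%C) r <= M.
  move=> cV VR; apply: le_trans fr; rewrite ler_wpM2l ?invr_ge0 ?(ltW (twopi_gt0 R))//.
  apply: rint_le; try exact: rcont_cabs2.
    by apply: rcont_cabs2; split => //=; exact: rcont_cst.
  move=> t _; rewrite /cabs2 /= expr0n addr0.
  apply: (@le_trans _ _ (complex.Re (f (polar r t)) ^+ 2)); last by rewrite lerDl sqr_ge0.
  by rewrite -[leLHS]real_normK ?num_real// -[leRHS]real_normK ?num_real// ler_expn.
have b1 : rmean2 (fun z => ((V1 z)%:C)%C) r <= M.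
  apply: bnd => // z; rewrite /V1; case: (leP (complex.Re (f z)) 0) => h; rewrite ?normr0//.
have b2 : rmean2 (fun z => ((V2 z)%:C)%C) r <= M.
  apply: bnd => // z; rewrite /V2; case: (leP (- complex.Re (f z)) 0) => h; rewrite ?normr0 ?normrN//.
have g1 := herglotz_coef_growth r01 c1 b1; have g2 := herglotz_coef_growth r01 c2 b2.
exists (ps (herglotz_coef V1 r)), (ps (herglotz_coef V2 r)); split.
- by split; exact: holo_ps.
- by split; exact: herglotz_coef_H2.
- move=> z zD; split.
    by apply: (herglotz_Re_ge0 r01 c1 b1) => // t; rewrite le_max lexx orbT.
  by apply: (herglotz_Re_ge0 r01 c2 b2) => // t; rewrite le_max lexx orbT.
move=> z /in_discP z1; pose I0 : CC R := (0 +i* complex.Im (f 0))%C.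
(* Re f is half the sum of f and its conjugate. The conjugate contributes only for n = 0, and for n
   > 0 the kernel coefficient 2 cancels the 1/2. *)
have hc n : herglotz_coef V1 r n - herglotz_coef V2 r n = coef f n * ((r ^+ n)%:C)%C - (if n is 0 then I0 else 0).
  have cN := @ccont_NX R r 0 (2 * pi) n r0.
  have d1 : ccont 0 (2 * pi) (fun t => ((V1 (polar r t))%:C)%C * polar r t ^- n).
    by apply: ccontM => //; split => //=; exact: rcont_cst.
  have d2 : ccont 0 (2 * pi) (fun t => -1 * (((V2 (polar r t))%:C)%C * polar r t ^- n)).
    apply: ccontM; first exact: ccont_cst.
    by apply: ccontM => //; split => //=; exact: rcont_cst.
  have d2' : ccont 0 (2 * pi) (fun t => ((V2 (polar r t))%:C)%C * polar r t ^- n).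
    by apply: ccontM => //; split => //=; exact: rcont_cst.
  have d3 : ccont 0 (2 * pi) (fun t => 2^-1 * (f (polar r t) * polar r t ^- n)).
    by apply: ccontM; [exact: ccont_cst|exact: ccontM].
  have d3' : ccont 0 (2 * pi) (fun t => f (polar r t) * polar r t ^- n) by exact: ccontM.
  have cfc : ccont 0 (2 * pi) (fun t => (f (polar r t))^*%C : CC R).
    split; first by apply: (eq_rcont _ cR) => t; case: (f _).
    by apply: (eq_rcont _ (rcontN cI)) => t; case: (f _).
  have d4' : ccont 0 (2 * pi) (fun t => (f (polar r t))^*%C * polar r t ^- n) by exact: ccontM.
  have d4 : ccont 0 (2 * pi) (fun t => 2^-1 * ((f (polar r t))^*%C * polar r t ^- n)).
    by apply: ccontM; [exact: ccont_cst|].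
  have E : mean (fun z => ((V1 z)%:C)%C * z ^- n) r - mean (fun z => ((V2 z)%:C)%C * z ^- n) r =
      2^-1 * (coef f n + (if n is 0 then (f 0)^*%C else 0)).
    rewrite -(mean_conj n hf r01) (coefE n hf r01) mulrDr.
    rewrite -(@meanZ R _ (fun z => f z * z ^- n) r d3') -(@meanZ R _ (fun z => (f z)^*%C * z ^- n) r d4').
    rewrite -(@meanD R (fun z => 2^-1 * (f z * z ^- n)) (fun z => 2^-1 * ((f z)^*%C * z ^- n)) r d3 d4).
    rewrite -[X in _ - X]mul1r -mulNr -(@meanZ R (-1) (fun z => ((V2 z)%:C)%C * z ^- n) r d2').
    rewrite -(@meanD R (fun z => ((V1 z)%:C)%C * z ^- n) (fun z => -1 * (((V2 z)%:C)%C * z ^- n)) r d1 d2).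
    apply: eq_mean => t; set q := _ ^- n.
    have -> : ((V1 (polar r t))%:C)%C = 2^-1 * (f (polar r t) + (f (polar r t))^*%C) + ((V2 (polar r t))%:C)%C :> CC R.
      have h2 : (2^-1 : CC R) = ((2^-1 : R)%:C)%C by rewrite fmorphV rmorph_nat.
      rewrite h2 /V1 /V2; case: (f _) => x y /=; apply: ccP => /=; last by rewrite ?mul0r; ring.
      rewrite maxr_absE maxr_absE subr0 addr0 subr0 normrN; lra.
    move: q (f _) (_^*%C) ((V2 _)%:C)%C (2^-1) => q a b c d; ring.
  rewrite /herglotz_coef; move: E; set m1 := mean _ _; set m2 := mean _ _ => E.
  rewrite -mulrBl -mulrBr E; case: n {cN d1 d2 d2' d3 d3' d4 d4' E m1 m2} => [|n].
    rewrite expr0 mulr1 /herglotz_factor mul1r mulr1 (coef0E hf) /I0.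
    have h2 : (2^-1 : CC R) = ((2^-1 : R)%:C)%C by rewrite fmorphV rmorph_nat.
    by rewrite h2; case: (f 0) => x y; apply: ccP => /=; lra.
  by rewrite /herglotz_factor addr0 mulrA mulfV ?mul1r ?subr0// -cabs_eq0 cabs_nat pnatr_eq0.
have ps_eq N : psum (herglotz_coef V1 r) N.+1 z - psum (herglotz_coef V2 r) N.+1 z + I0 = psum (coef f) N.+1 ((r%:C)%C * z).
  elim: N => [|N IH].
    rewrite /psum !big_ord_recr !big_ord0 /= !add0r !expr0 !mulr1 hc expr0 mulr1 subrK //.
  rewrite !(psumS _ N.+1) -IH exprMn -rmorphXn /= mulrA.
  have := hc N.+1; rewrite subr0 => <-.
  move: (psum _ _ _) (psum _ _ _) (herglotz_coef _ _ _) (herglotz_coef _ _ _) (z ^+ _) (I0) => x1 x2 x3 x4 x5 x6; ring.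
have rz1 : cabs ((r%:C)%C * z) < 1.
  by rewrite cabsM cabs_real gtr0_norm// mulr_ilt1// ?cabs_ge0// ltW.
rewrite (holo_psE hf); last exact/in_discP.
apply: (@ccvg_unique R (fun N => psum (coef f) N ((r%:C)%C * z))).
  by apply: ps_cvg => //; exact: growth_coef.
move=> e e0; have e2 : 0 < e / 2 by rewrite divr_gt0.
have [N1 H1] := ps_cvg g1 z1 e2; have [N2 H2] := ps_cvg g2 z1 e2.
exists (maxn N1 N2).+1 => -[//|N]; rewrite ltnS geq_max => /andP[n1 n2].
rewrite -ps_eq.
have := H1 N.+1 (leq_trans n1 (leqnSn _)); have := H2 N.+1 (leq_trans n2 (leqnSn _)).
move: (psum _ _ _) (psum _ _ _) (ps _ _) (ps _ _) => x1 x2 x3 x4 l1 l2.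
have -> : x1 - x2 + I0 - (x3 - x4 + I0) = (x1 - x3) - (x2 - x4) by ring.
by rewrite (le_trans (cabsB _ _))// [leRHS]splitr lerD.
Qed.

Lemma ccvg_Re_ge0 (x : nat -> CC R) (l : CC R) : ccvg x l ->
  (forall n, 0 <= complex.Re (x n)) -> 0 <= complex.Re l.
Proof.
move=> xl x0; apply: le_epsP => e /xl[N /(_ N (leqnn _)) H]; rewrite (le_trans (x0 N))//.
by have := Re_le_cabs (x N - l); rewrite ReD ReN ler_norml => /andP[_]; lra.
Qed.

Lemma ccvg_sub (x : nat -> CC R) (l : CC R) (s : nat -> nat) : ccvg x l ->
  (forall n, (s n < s n.+1)%N) -> ccvg (fun n => x (s n)) l.
Proof.
move=> xl sS e /xl[N H]; exists N => n Nn; apply: H; apply: leq_trans Nn _.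
by elim: n => [//|n IH]; exact: leq_ltn_trans IH (sS n).
Qed.

Lemma ccvgD (x y : nat -> CC R) (l m : CC R) : ccvg x l -> ccvg y m ->
  ccvg (fun n => x n + y n) (l + m).
Proof.
move=> xl ym e e0; have e2 : 0 < e / 2 by rewrite divr_gt0.
have [N1 H1] := xl _ e2; have [N2 H2] := ym _ e2.
exists (maxn N1 N2) => n; rewrite geq_max => /andP[n1 n2].
by rewrite opprD addrACA (le_trans (cabsD _ _))// [leRHS]splitr lerD ?H1 ?H2.
Qed.

Lemma ccvgZ (k : CC R) (x : nat -> CC R) (l : CC R) : ccvg x l -> ccvg (fun n => k * x n) (k * l).
Proof.
move=> xl e e0; have k1 : 0 < cabs k + 1 by rewrite ltr_wpDl ?cabs_ge0.
have [N H] := xl (e / (cabs k + 1)) (divr_gt0 e0 k1).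
exists N => n /H h; rewrite -mulrBr cabsM (le_trans (ler_wpM2l (cabs_ge0 k) h))//.
by rewrite mulrA ler_pdivrMr// mulrC ler_wpM2l ?(ltW e0)// lerDl.
Qed.

Lemma ccvg_cst (k : CC R) : ccvg (fun=> k) k.
Proof. by move=> e e0; exists 0%N => n _; rewrite subrr cabs0 ltW. Qed.

(** No boundary values of f are used: the decompositions on circles of radius tending to 1 have
    bounds independent of the radius, and normal families give limits of both pieces. *)
Lemma herglotz f (M : R) : holo f -> (H2norm2 f <= M%:E)%E ->
  exists h1 h2, [/\ holo h1 /\ holo h2,
    (H2norm2 h1 <= (4 * M)%:E)%E /\ (H2norm2 h2 <= (4 * M)%:E)%E,
    forall z, in_disc z -> 0 <= complex.Re (h1 z) /\ 0 <= complex.Re (h2 z) &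
    forall z, in_disc z -> f z = h1 z - h2 z + (0 +i* complex.Im (f 0))%C].
Proof.
move=> hf fM; pose r k : R := 1 - k.+2%:R^-1.
have r01 k : 0 < r k < 1.
  by rewrite /r subr_gt0 gtrBl invr_gt0 ltr0n andbT invf_lt1 ?ltr0n ?ltr1n.
have /choice[h1 /choice[h2 H]] := fun k => herglotz_circle hf fM (r01 k).
have hh1 k : holo (h1 k) by have [[]] := H k.
have hh2 k : holo (h2 k) by have [[]] := H k.
have n1 k : (H2norm2 (h1 k) <= (4 * M)%:E)%E by have [_ []] := H k.
have n2 k : (H2norm2 (h2 k) <= (4 * M)%:E)%E by have [_ []] := H k.
have [s [g1 [sS hg1 g1M g1c]]] := H2_subseq hh1 n1.
have [s' [g2 [sS' hg2 g2M g2c]]] := H2_subseq (fun k => hh2 (s k)) (fun k => n2 (s k)).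
exists g1, g2; split => //.
  move=> z zD; split.
    by apply: (ccvg_Re_ge0 (g1c z zD)) => n; have [_ _ /(_ z zD)[]] := H (s n).
  by apply: (ccvg_Re_ge0 (g2c z zD)) => n; have [_ _ /(_ z zD)[]] := H (s (s' n)).
move=> z zD; pose I0 : CC R := (0 +i* complex.Im (f 0))%C; rewrite -/I0.
have cr : ccvg (fun k => f (((r k)%:C)%C * z)) (f z).
  move=> e e0; have [d d0 Hd] := cdiff_continuous (holo_cdiff hf zD) e0.
  have [N HN] := cvg_inv_succ (divr_gt0 d0 (ltr0n R 2)); exists N => k Nk.
  have E : ((r k)%:C)%C * z - z = ((r k - 1)%:C)%C * z.
    by move: (r k) => x; rewrite rmorphB rmorph1 mulrBl mul1r.
  apply/ltW/Hd; rewrite E cabsM cabs_real.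
  move/in_discP: zD => z1; rewrite (@le_lt_trans _ _ (d / 2))//; last by lra.
  rewrite /r addrAC subrr add0r normrN ger0_norm ?invr_ge0// (le_trans _ (HN k.+1 (leqW Nk)))//.
  by rewrite ler_piMr ?invr_ge0// ltW.
have sS2 n : (s (s' n) < s (s' n.+1))%N.
  have mono m p : (m < p)%N -> (s m < s p)%N.
    elim: p => [//|p IH]; rewrite ltnS leq_eqVlt => /predU1P[->//|/IH h].
    exact: ltn_trans h (sS p).
  exact: mono (sS' n).
apply: (ccvg_unique (ccvg_sub cr sS2)).
have -> : (fun n => f (((r (s (s' n)))%:C)%C * z)) =
    (fun n => h1 (s (s' n)) z + (- 1) * h2 (s (s' n)) z + I0).
  by apply/funext => n; have [_ _ _ ->//] := H (s (s' n)); rewrite mulN1r.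
rewrite -[X in g1 z - X]mul1r -mulNr.
apply: ccvgD; last exact: ccvg_cst.
by apply: ccvgD; [exact: (ccvg_sub (g1c z zD) sS')|exact: (ccvgZ _ (g2c z zD))].
Qed.

End Herglotz.

(** * The twisting estimate *)

Section Key.
Variable R : realType.
Implicit Types (f g L : CC R -> CC R) (z w : CC R).

Definition imag_unit : CC R := (0 +i* 1)%C.

Lemma imag_unit2 : imag_unit * imag_unit = -1.
Proof. by apply: ccP; rewrite ?ccE /=; ring. Qed.

Lemma holo_cexp L : holo L -> holo (fun z => cexp (L z)).
Proof.
move=> hL z zD.
exact: cdiff_derivable (@cdiff_comp R (@cexp R) L z _ _ (cdiff_cexp _) (holo_cdiff hL zD)).
Qed.

Definition diff_op (u phi psi : CC R -> CC R) f z := u z * f (phi z) - f (psi z).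

Section Operator.
Variables (u phi psi : CC R -> CC R).
Hypotheses (hu : holo u) (sphi : selfmap phi) (spsi : selfmap psi).
Notation T := (diff_op u phi psi).

Lemma holo_diff_op f : holo f -> holo (T f).
Proof. by move=> hf; exact: (holoB (holoM hu (holo_comp hf sphi)) (holo_comp hf spsi)). Qed.

Lemma cderiv_diff_op f z : holo f -> in_disc z ->
  cderiv (T f) z = cderiv u z * f (phi z) +
    (u z * cderiv phi z * cderiv f (phi z) - cderiv psi z * cderiv f (psi z)).
Proof.
move=> hf zD.
have d1 := @cdiff_comp R f phi z _ _ (holo_cdiff hf (sphi.2 z zD)) (holo_cdiff sphi.1 zD).
have d2 := @cdiff_comp R f psi z _ _ (holo_cdiff hf (spsi.2 z zD)) (holo_cdiff spsi.1 zD).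
have := cdiffB (cdiffM (holo_cdiff hu zD) d1) d2 => /cdiff_cderiv ->.
move: (cderiv u z) (cderiv f _) (cderiv f _) (cderiv phi z) (cderiv psi z) => *; ring.
Qed.

(** The function g q^k with g = e^L and q = e^(iL). *)
Definition twist L k z : CC R := cexp (L z) * cexp (imag_unit * L z) ^+ k.

Lemma twistE L k z : twist L k z = cexp ((1 + k%:R * imag_unit) * L z).
Proof.
rewrite /twist mulrDl mul1r cexpD; congr (_ * _).
elim: k => [|k IH]; first by rewrite expr0 !mul0r cexp0.
by rewrite exprS IH -cexpD -natr1; congr cexp; ring.
Qed.

Lemma holo_twist L k : holo L -> holo (twist L k).
Proof.
move=> hL; have h : holo (fun z => (1 + k%:R * imag_unit) * L z) := holoM (@holo_cst R _) hL.
by apply: (eq_holo _ (holo_cexp h)) => z _; rewrite twistE.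
Qed.

Lemma cderiv_twist L k z : holo L -> in_disc z ->
  cderiv (twist L k) z = (1 + k%:R * imag_unit) * cderiv L z * twist L k z.
Proof.
move=> hL zD; have -> : twist L k = fun z => cexp ((1 + k%:R * imag_unit) * L z).
  by apply/funext => w; exact: twistE.
have := @cdiff_comp R (@cexp R) (fun z => (1 + k%:R * imag_unit) * L z) z _ _ (cdiff_cexp _)
  (cdiffZ (1 + k%:R * imag_unit) (holo_cdiff hL zD)).
by move=> /cdiff_cderiv ->; rewrite mulrC.
Qed.

(* With H_k = T (g q^k), X = q(phi) and Y = q(psi), the function P_k = X H_k - H_{k+1} satisfies P_1 = Y P_0, so that
   P_1' - Y P_0' isolates the psi-terms; u' g(phi) is then a combination of H_1', H_0' and this function with bounded
   coefficients. *)
Lemma key_estimate (b : R) : exists2 C : R, 0 < C & forall L (m : R), holo L ->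
  (forall z, in_disc z -> `|complex.Im (L z)| <= b) ->
  (forall k, (k < 3)%N -> (H2norm2 (T (twist L k)) <= m%:E)%E) ->
  (A1norm2 (fun z => cderiv u z * cexp (L (phi z)))%R <= (C * m)%:E)%E.
Proof.
have [K K0 LP] := littlewood_paley R.
(* Since |e^(iL)|^2 = e^(-2 Im L), this bounds the squared moduli of q(phi), q(psi) and their
   inverses. *)
pose be : R := expR (b *+ 2).
have be0 : 0 < be by exact: expR_gt0.
(* m1, m2 and C are the costs of P_k', of W and of the final combination: 2 for each sum or
   difference, [be] for each multiplication by X, Y, Xi or Yi, K for each passage from H^2 to
   A^2_1. *)
pose m1 : R := K * (2 * (be * 1 + 1)).
pose m2 : R := 2 * (m1 + be * m1).
pose C : R := 2 * (be * K + 2 * (2 * K + 2 * (be * (be * m2)))).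
have m10 : 0 < m1 by rewrite mulr_gt0// mulr_gt0// addr_gt0// mulr1.
have m20 : 0 < m2 by rewrite mulr_gt0// addr_gt0// mulr_gt0.
have p1 : 0 < be * (be * m2) by rewrite mulr_gt0// mulr_gt0.
have p2 : 0 < be * K by rewrite mulr_gt0.
exists C; first by rewrite /C; move: p1 p2; move: (be * _) (be * _) => x y *; lra.
move=> L m hL Lb Hm.
pose H k := T (twist L k); pose E k := cderiv (H k).
have hH k : holo (H k) by apply: holo_diff_op; exact: holo_twist.
have hE k : holo (E k) := holo_cderiv (hH k).
pose X z := cexp (imag_unit * L (phi z)); pose Y z := cexp (imag_unit * L (psi z)).
pose Xi z := cexp (- (imag_unit * L (phi z))); pose Yi z := cexp (- (imag_unit * L (psi z))).
have hCL p : selfmap p -> holo (fun z => imag_unit * L (p z)).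
  by move=> sp; exact: (holoM (@holo_cst R imag_unit) (holo_comp hL sp)).
have hX : holo X := holo_cexp (hCL phi sphi).
have hY : holo Y := holo_cexp (hCL psi spsi).
have hXi : holo Xi := holo_cexp (holoN (hCL phi sphi)).
have hYi : holo Yi := holo_cexp (holoN (hCL psi spsi)).
have bd w (s : bool) : `|complex.Im w| <= b -> cabs2 (cexp ((-1) ^+ s * (imag_unit * w))) <= be.
  move=> wb; rewrite -sqr_cabs cabs_cexp -expRM_natl ler_expR mulr_natl ler_wMn2r//.
  move: wb; rewrite ler_norml => /andP[]; case: s => /=; rewrite ?expr1 ?expr0 ?mulN1r ?mul1r ?ReN ReM /=; lra.
have bX z : in_disc z -> cabs2 (X z) <= be.
  by move=> zD; have := bd _ false (Lb _ (sphi.2 z zD)); rewrite expr0 mul1r.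
have bY z : in_disc z -> cabs2 (Y z) <= be.
  by move=> zD; have := bd _ false (Lb _ (spsi.2 z zD)); rewrite expr0 mul1r.
have bXi z : in_disc z -> cabs2 (Xi z) <= be.
  by move=> zD; have := bd _ true (Lb _ (sphi.2 z zD)); rewrite expr1 mulN1r.
have bYi z : in_disc z -> cabs2 (Yi z) <= be.
  by move=> zD; have := bd _ true (Lb _ (spsi.2 z zD)); rewrite expr1 mulN1r.
have XXi z : X z * Xi z = 1 by rewrite /X /Xi -cexpD subrr cexp0.
have YYi z : Y z * Yi z = 1 by rewrite /Y /Yi -cexpD subrr cexp0.
have EA k : (k < 3)%N -> (A1norm2 (E k) <= (K * m)%:E)%E.
  by move=> k3; have [h _] := LP _ (hH k); exact: h (Hm k k3).
pose P k z := X z * H k z - H k.+1 z.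
have hP k : holo (P k) := holoB (holoM hX (hH k)) (hH k.+1).
have PA k : (k < 2)%N -> (A1norm2 (cderiv (P k)) <= (m1 * m)%:E)%E.
  move=> k2; have -> : m1 * m = K * (2 * (be * m + m)).
    by rewrite /m1; move: (be) (K) => *; ring.
  have [h _] := LP _ (hP k); apply: h.
  have h1 := H2norm2_Mle (hH k) hX bX (Hm k (ltnW k2)).
  have h2 : (H2norm2 (fun z => (-1) * H k.+1 z)%R <= (1 * m)%:E)%E.
    apply: (H2norm2_Mle (g := fun=> -1) (hH k.+1) (@holo_cst R _) _ (Hm k.+1 k2)) => z _.
    by rewrite cabs2N /cabs2 /= expr0n expr1n addr0.
  have hN : holo (fun z => (-1) * H k.+1 z) := holoM (@holo_cst R _) (hH k.+1).
  have := H2norm2_Dle (holoM hX (hH k)) hN h1 h2; rewrite mul1r; apply: le_trans.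
  rewrite le_eqVlt; apply/orP; left; apply/eqP; congr H2norm2.
  by apply/funext => z; rewrite mulN1r.
pose W z := cderiv (P 1) z - Y z * cderiv (P 0) z.
have hPd k : holo (cderiv (P k)) := holo_cderiv (hP k).
have hW : holo W := holoB (hPd 1%N) (holoM hY (hPd 0%N)).
have WA : (A1norm2 W <= (m2 * m)%:E)%E.
  have h1 := A1norm2_Mle (hPd 0%N) hY bY (PA 0%N isT).
  have := A1norm2_Ble (hPd 1%N) (holoM hY (hPd 0%N)) (PA 1%N isT) h1.
  by rewrite (_ : 2 * (m1 * m + be * (m1 * m)) = m2 * m)// /m2; move: (m1) (be) => *; ring.
have AE z : in_disc z -> cderiv u z * cexp (L (phi z)) =
    imag_unit * Xi z * E 1%N z + ((1 - imag_unit) * E 0%N z + (1 + imag_unit) * (Xi z * (Yi z * W z))).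
  move=> zD.
  pose x := cderiv L (phi z); pose y := cderiv L (psi z).
  pose F := cexp (L (phi z)); pose G := cexp (L (psi z)).
  have HE k w : H k w = u w * (cexp (L (phi w)) * X w ^+ k) - cexp (L (psi w)) * Y w ^+ k by [].
  have P0E w : P 0%N w = - (cexp (L (psi w)) * (X w - Y w)).
    rewrite /P !HE !expr1 !expr0; move: (X w) (Y w) (u w) (cexp _) (cexp _) => *; ring.
  have P1E : P 1%N = fun w => Y w * P 0%N w.
    apply/funext => w; rewrite P0E /P !HE !expr1 expr2.
    move: (X w) (Y w) (u w) (cexp _) (cexp _) => *; ring.
  have dY : cdiff Y z (Y z * (imag_unit * (y * cderiv psi z))).
    apply: (@cdiff_comp R (@cexp R) (fun z => imag_unit * L (psi z)) z _ _ (cdiff_cexp _)).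
    apply: cdiffZ; exact: (@cdiff_comp R L psi z _ _ (holo_cdiff hL (spsi.2 z zD)) (holo_cdiff spsi.1 zD)).
  have WE : W z = Y z * (imag_unit * (y * cderiv psi z)) * (- (G * (X z - Y z))).
    have dP := cdiff_cderiv (cdiffM dY (holo_cdiff (hP 0%N) zD)); rewrite -P1E in dP.
    by rewrite /W dP (P0E z) addrK.
  have EE k : E k z = cderiv u z * (F * X z ^+ k) +
      (u z * cderiv phi z * ((1 + k%:R * imag_unit) * x * (F * X z ^+ k))
       - cderiv psi z * ((1 + k%:R * imag_unit) * y * (G * Y z ^+ k))).
    rewrite /E /H (cderiv_diff_op (holo_twist (k := k) hL) zD).
    by rewrite (cderiv_twist k hL (sphi.2 z zD)) (cderiv_twist k hL (spsi.2 z zD)).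
  (* The combination (1 + i) E_0 - E_1 / X eliminates B and leaves i A - (1 + i) c (X - Y) / X; the
     last term is a constant multiple of W / (X Y). Solving for A gives the identity. *)
  have gen (s A B c Xz Yz Xj Yj : CC R) : s * s = -1 -> Xz * Xj = 1 -> Yz * Yj = 1 ->
      A = s * Xj * (A * Xz + ((1 + s) * B * Xz - (1 + s) * c * Yz)) +
        ((1 - s) * (A + (B - c)) + (1 + s) * (Xj * (Yj * (- (s * c * Yz * (Xz - Yz)))))).
    move=> s2 XX YY.
    have -> : s * Xj * (A * Xz + ((1 + s) * B * Xz - (1 + s) * c * Yz)) =
        s * (A * (Xz * Xj) + ((1 + s) * B * (Xz * Xj) - (1 + s) * c * (Yz * Xj))) by ring.
    have -> : Xj * (Yj * (- (s * c * Yz * (Xz - Yz)))) =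
        - (s * c * (Yz * Yj) * (Xz * Xj - Yz * Xj)) by ring.
    rewrite XX YY; move: (Yz * Xj) => t.
    apply/eqP; rewrite eq_sym -subr_eq0; apply/eqP.
    transitivity ((s * s + 1) * (B - c)); first ring.
    by rewrite s2 addNr mul0r.
  pose A := cderiv u z * F; pose B := u z * cderiv phi z * (x * F); pose c := cderiv psi z * (y * G).
  have E0 : E 0%N z = A + (B - c).
    have := EE 0%N; rewrite /A /B /c => ->.
    move: (cderiv u z) (u z) (cderiv phi z) (cderiv psi z) (X z) (Y z) (x) (y) (F) (G) (imag_unit) => *; ring.
  have E1 : E 1%N z = A * X z + ((1 + imag_unit) * B * X z - (1 + imag_unit) * c * Y z).
    have := EE 1%N; rewrite /A /B /c => ->.
    move: (cderiv u z) (u z) (cderiv phi z) (cderiv psi z) (X z) (Y z) (x) (y) (F) (G) (imag_unit) => *; ring.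
  have W1 : W z = - (imag_unit * c * Y z * (X z - Y z)).
    rewrite WE /c; move: (cderiv psi z) (X z) (Y z) (y) (G) (imag_unit) => *; ring.
  rewrite E0 E1 W1; exact: (gen imag_unit A B c _ _ _ _ imag_unit2 (XXi z) (YYi z)).
rewrite (eq_A1norm2 AE).
have n2 (c : CC R) : cabs2 c <= 2 -> holo (fun z => c * E 0%N z) /\
    (A1norm2 (fun z => c * E 0%N z)%R <= (2 * (K * m))%:E)%E.
  move=> c2; split; first exact: (holoM (@holo_cst R c) (hE 0%N)).
  exact: (A1norm2_Mle (g := fun=> c) (hE 0%N) (@holo_cst R c) (fun z _ => c2) (EA 0%N isT)).
have [h2 A2] : holo (fun z => (1 - imag_unit) * E 0%N z) /\ (A1norm2 (fun z => (1 - imag_unit) * E 0%N z)%R <= (2 * (K * m))%:E)%E.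
  by apply: n2; rewrite /cabs2 /=; lra.
have h3a := holoM hYi hW; have A3a := A1norm2_Mle hW hYi bYi WA.
have h3b := holoM hXi h3a; have A3b := A1norm2_Mle h3a hXi bXi A3a.
have h3 : holo (fun z => (1 + imag_unit) * (Xi z * (Yi z * W z))) := holoM (@holo_cst R (1 + imag_unit)) h3b.
have A3 : (A1norm2 (fun z => (1 + imag_unit) * (Xi z * (Yi z * W z)))%R <= (2 * (be * (be * (m2 * m))))%:E)%E.
  apply: (A1norm2_Mle (g := fun=> 1 + imag_unit) h3b (@holo_cst R (1 + imag_unit)) _ A3b) => z _.
  by rewrite /cabs2 /=; lra.
have hCX : holo (fun z => imag_unit * Xi z) := holoM (@holo_cst R imag_unit) hXi.
have h1 := holoM hCX (hE 1%N).
have A1 : (A1norm2 (fun z => imag_unit * Xi z * E 1%N z)%R <= (be * (K * m))%:E)%E.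
  apply: (A1norm2_Mle (hE 1%N) hCX _ (EA 1%N isT)) => z zD.
  by rewrite cabs2M (_ : cabs2 imag_unit = 1) ?mul1r ?bXi// /cabs2 /= expr0n expr1n add0r.
have := A1norm2_Dle h1 (holoD h2 h3) A1 (A1norm2_Dle h2 h3 A2 A3).
rewrite (_ : 2 * _ = C * m)// /C; move: (be) (m2) (K) => *; ring.
Qed.

End Operator.
End Key.

(** * Compactness of the weighted part *)

Section Necessity.
Variable R : realType.
Implicit Types (f g h : CC R -> CC R) (z w : CC R).

(** A concrete form of weak convergence to 0 in H^2. *)
Definition null_seq (d : nat -> CC R -> CC R) (M : R) :=
  [/\ forall n, holo (d n), forall n, (H2norm2 (d n) <= M%:E)%E &
    forall z, in_disc z -> ccvg (fun n => d n z) 0].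

Lemma null_sub d M (t : nat -> nat) : null_seq d M -> (forall n, (n <= t n)%N) ->
  null_seq (fun n => d (t n)) M.
Proof.
move=> [hd dM d0] tn; split=> [n|n|z zD e /(d0 z zD)[N HN]]; [exact: hd|exact: dM|].
by exists N => n Nn; exact: HN (leq_trans Nn (tn n)).
Qed.

Lemma ecvg0_contra (x : nat -> \bar R) : ~ ecvg0 x ->
  exists e : R, 0 < e /\ exists t : nat -> nat, forall n, (n <= t n)%N /\ (e%:E < x (t n))%E.
Proof.
move=> /existsNP[e /not_implyP[e0 /forallNP H]]; exists e; split => //.
suff /choice[t Ht] : forall n, exists k, (n <= k)%N /\ (e%:E < x k)%E by exists t.
move=> n; have /existsNP[k /not_implyP[nk /negP]] := H n.
by rewrite -ltNge => xk; exists k.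
Qed.

Lemma incr_ge (s : nat -> nat) : (forall n, (s n < s n.+1)%N) -> forall n, (n <= s n)%N.
Proof. by move=> sS; elim=> [//|n IH]; exact: leq_ltn_trans IH (sS n). Qed.

Lemma incr_comp (s t : nat -> nat) : (forall n, (s n < s n.+1)%N) ->
  (forall n, (t n < t n.+1)%N) -> forall n, (s (t n) < s (t n.+1))%N.
Proof.
move=> sS tS n; have mono m p : (m < p)%N -> (s m < s p)%N.
  elim: p => [//|p IH]; rewrite ltnS leq_eqVlt => /predU1P[->//|/IH h].
  exact: ltn_trans h (sS p).
exact: mono (tS n).
Qed.

Lemma inH2_bound f : inH2 f -> exists M : R, (H2norm2 f <= M%:E)%E.
Proof.
move=> [hf fo]; exists (fine (H2norm2 f)); rewrite fineK// ge0_fin_numE//.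
exact: H2norm2_ge0.
Qed.

Lemma inA12_bound f : inA12 f -> exists M : R, (A1norm2 f <= M%:E)%E.
Proof.
move=> [hf fo]; exists (fine (A1norm2 f)); rewrite fineK// ge0_fin_numE//.
exact: A1norm2_ge0.
Qed.

Lemma inH2P f (M : R) : holo f -> (H2norm2 f <= M%:E)%E -> inH2 f.
Proof. by move=> hf fM; split; [exact: hf|exact: le_lt_trans fM (ltry _)]. Qed.

Lemma inA12P f (M : R) : holo f -> (A1norm2 f <= M%:E)%E -> inA12 f.
Proof. by move=> hf fM; split; [exact: hf|exact: le_lt_trans fM (ltry _)]. Qed.

Lemma ecvg0_ccvg (d : nat -> CC R -> CC R) z : (forall n, holo (d n)) -> in_disc z ->
  ecvg0 (fun n => H2norm2 (d n)) -> ccvg (fun n => d n z) 0.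
Proof.
move=> hd zD d0 e e0; move/in_discP: (zD) => z1.
have k0 : 0 < 1 - cabs z by rewrite subr_gt0.
have [N HN] := d0 ((e * (1 - cabs z)) ^+ 2) (exprn_gt0 2 (mulr_gt0 e0 k0)).
exists N => n /HN /(point_eval (hd n))/(_ zD).
by rewrite subr0 sqrtr_sqr ger0_norm ?(ltW (mulr_gt0 e0 k0))// mulfK// gt_eqF.
Qed.

Lemma H2norm2_cst (k : CC R) : (H2norm2 (fun=> k) <= (cabs2 k)%:E)%E.
Proof.
rewrite (H2norm2E (@holo_cst R k)); apply: ge_ereal_sup => _ [r _ <-].
have tp := twopi_gt0 R.
by rewrite lee_fin /rmean2 rint_cst ?(ltW tp)// subr0 mulrCA mulVf ?mulr1// gt_eqF.
Qed.

Section Compact.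
Variables (u phi psi : CC R -> CC R).
Hypotheses (hu : holo u) (sphi : selfmap phi) (spsi : selfmap psi).
Notation T := (diff_op u phi psi).
Hypothesis Tc : compact_op (@inH2 R) (@inH2 R) (@H2norm2 R) (@H2norm2 R) T.

(** Otherwise some subsequence of images stays away from 0 in norm. Compactness gives it a norm
    limit point, which is also a pointwise limit and therefore 0. *)
Lemma compact_null d (M : R) : null_seq d M -> ecvg0 (fun n => H2norm2 (T (d n))).
Proof.
move=> dn; apply: contrapT => /ecvg0_contra[e [e0 [t Ht]]].
have [hd dM d0] := null_sub dn (fun n => (Ht n).1).
have [_ /(_ (fun n => d (t n)))] := Tc.
case=> [n||s [g [sS [[hg go] cg]]]]; first exact: (inH2P (hd n) (dM n)).
  by exists M.
have hT n : holo (T (d (t (s n)))) := holo_diff_op hu sphi spsi (hd (s n)).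
have hTg n : holo (fun z => T (d (t (s n))) z - g z) := holoB (hT n) hg.
have {}cg : ecvg0 (fun n => H2norm2 (fun z => T (d (t (s n))) z - g z)%R).
  exact: (ecvg0P (fun n => H2norm2_ge0 (hTg n))).1 cg.
have g0 z : in_disc z -> g z = 0.
  move=> zD.
  have c1 : ccvg (fun n => T (d (t (s n))) z) 0.
    have q1 := ccvgZ (u z) (ccvg_sub (d0 _ (sphi.2 z zD)) sS).
    have q2 := ccvgZ (-1) (ccvg_sub (d0 _ (spsi.2 z zD)) sS).
    have := ccvgD q1 q2; rewrite !mulr0 addr0; congr (ccvg _ _).
    by apply/funext => n; rewrite mulN1r.
  have c2 := ecvg0_ccvg hTg zD cg.
  have := ccvgD c2 (ccvg_cst (g z)); rewrite add0r.
  rewrite (_ : (fun n => _) = (fun n => T (d (t (s n))) z)).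
    by move=> c3; exact: ccvg_unique c3 c1.
  by apply/funext => n; rewrite subrK.
have [N /(_ N (leqnn _))] := cg e e0.
have -> : H2norm2 (fun z => T (d (t (s N))) z - g z)%R = H2norm2 (T (d (t (s N)))).
  by apply: (eq_H2norm2 (hTg N)) => z zD; rewrite g0// subr0.
by rewrite leNgt (Ht (s N)).2.
Qed.

(* h = lam h / (h + lam) + large_part lam h, the first summand being bounded by lam when Re h >= 0. *)
Definition large_part (lam : R) z : CC R := z ^+ 2 / (z + (lam%:C)%C).

Lemma shift_bounds (lam : R) z : 0 < lam -> 0 <= complex.Re z ->
  [/\ z + (lam%:C)%C != 0, lam <= cabs (z + (lam%:C)%C) & cabs z <= cabs (z + (lam%:C)%C)].
Proof.
move=> l0 z0; have h1 : lam <= cabs (z + (lam%:C)%C).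
  have := Re_le_cabs (z + (lam%:C)%C); rewrite ReD /= ler_norml => /andP[_]; lra.
split=> //; first by rewrite -cabs_gt0 (lt_le_trans l0).
rewrite -(@ler_sqr R) ?nnegrE ?cabs_ge0// !sqr_cabs /cabs2 ReD ImD /= addr0 lerD2r.
by rewrite ler_sqr ?nnegrE ?lerDl ?addr_ge0// ltW.
Qed.

Lemma large_partE (lam : R) z : 0 < lam -> 0 <= complex.Re z ->
  large_part lam z = z - (lam%:C)%C + (lam%:C)%C ^+ 2 / (z + (lam%:C)%C).
Proof.
move=> l0 z0; have [n0 _ _] := shift_bounds l0 z0.
apply: (mulIf n0); rewrite mulrDl /large_part !divfK//; move: ((lam%:C)%C) => x; ring.
Qed.

(** The difference is (z - w)(1 - lam^2 / ((z + lam)(w + lam))), and both quotients lam / (z + lam)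
    and lam / (w + lam) have modulus at most 1. *)
Lemma large_part_lipschitz (lam : R) z w : 0 < lam -> 0 <= complex.Re z -> 0 <= complex.Re w ->
  cabs (large_part lam z - large_part lam w) <= 2 * cabs (z - w).
Proof.
move=> l0 z0 w0; have [zn zl _] := shift_bounds l0 z0; have [wn wl _] := shift_bounds l0 w0.
rewrite !large_partE//; set l := (lam%:C)%C in zn zl wn wl *.
have -> : z - l + l ^+ 2 / (z + l) - (w - l + l ^+ 2 / (w + l)) =
    (z - w) + (- (l / (z + l) * (l / (w + l)) * (z - w))).
  apply: (mulIf zn); apply: (mulIf wn).
  have -> : (z - l + l ^+ 2 / (z + l) - (w - l + l ^+ 2 / (w + l))) * (z + l) * (w + l) =
    (z - w) * (z + l) * (w + l) + l ^+ 2 / (z + l) * (z + l) * (w + l) - l ^+ 2 / (w + l) * (w + l) * (z + l).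
    move: (_ / _) (_ / _) => *; ring.
  have -> : (z - w + - (l / (z + l) * (l / (w + l)) * (z - w))) * (z + l) * (w + l) =
     (z - w) * (z + l) * (w + l) - (l / (z + l) * (z + l)) * (l / (w + l) * (w + l)) * (z - w).
    move: (_ / _) (_ / _) => *; ring.
  rewrite !divfK//; ring.
rewrite (le_trans (cabsD _ _))// cabsN [2 * _]mulr_natl mulr2n lerD2l cabsM ler_piMl ?cabs_ge0//.
have q v : lam <= cabs (v + l) -> cabs (l / (v + l)) <= 1.
  move=> lv; rewrite cabsM cabsV cabs_real gtr0_norm// ler_pdivrMr ?mul1r//.
  exact: lt_le_trans l0 lv.
by rewrite cabsM mulr_ile1 ?cabs_ge0 ?q.
Qed.

Lemma large_part_dist (lam : R) z : 0 < lam -> 0 <= complex.Re z -> cabs (z - large_part lam z) <= lam.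
Proof.
move=> l0 z0; have [n0 h1 h2] := shift_bounds l0 z0.
have -> : z - large_part lam z = (lam%:C)%C * (z / (z + (lam%:C)%C)).
  apply: (mulIf n0); rewrite [LHS]mulrBl -[RHS]mulrA /large_part !divfK//; move: ((lam%:C)%C) => x; ring.
rewrite cabsM cabs_real gtr0_norm// ler_piMr ?(ltW l0)// cabsM cabsV.
by rewrite ler_pdivrMr ?mul1r// (lt_le_trans l0).
Qed.

(** The logarithm is 2 log h - log(h + lam), each logarithm having imaginary part at most pi/2 in
    modulus. *)
Lemma large_part_log h (lam : R) : holo h -> (forall z, in_disc z -> 0 < complex.Re (h z)) -> 0 < lam ->
  exists L, [/\ holo L, forall z, in_disc z -> cexp (L z) = large_part lam (h z) &
    forall z, in_disc z -> `|complex.Im (L z)| <= 3 * (pi / 2)].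
Proof.
move=> hh h0 l0; have [L1 [hL1 e1 b1]] := holo_log hh h0.
have [|z zD|L2 [hL2 e2 b2]] := @holo_log R (fun z => h z + (lam%:C)%C).
- exact: (holoD hh (@holo_cst R _)).
- by rewrite ReD /= addr_gt0 ?h0.
exists (fun z => L1 z + L1 z - L2 z); split.
- exact: (holoB (holoD hL1 hL1) hL2).
- move=> z zD; rewrite !cexpD e1// /large_part expr2; congr (_ * _).
  have en := cexp_neq0 (L2 z); apply: (mulIf en).
  by rewrite -cexpD addNr cexp0 e2// mulVf// -e2.
- move=> z zD; have := b1 z zD; have := b2 z zD; rewrite ccE ccE ImN !ler_norml.
  by move=> /andP[p1 p2] /andP[p3 p4]; apply/andP; split; lra.
Qed.

(** The bound 1, rather than strict positivity, survives pointwise limits and still provides the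
    logarithm of h. *)
Definition large_re_ball h (M : R) := [/\ holo h, forall z, in_disc z -> 1 <= complex.Re (h z) &
  (H2norm2 h <= M%:E)%E].

Lemma holo_large_part h M (lam : R) : large_re_ball h M -> 0 < lam -> holo (fun z => large_part lam (h z)).
Proof.
move=> [hh h1 _] l0.
have hl : holo (fun z => h z + (lam%:C)%C) := holoD hh (@holo_cst R _).
have n0 z : in_disc z -> h z + (lam%:C)%C != 0.
  by move=> zD; have [] := shift_bounds l0 (le_trans ler01 (h1 z zD)).
have hX : holo (fun z => h z ^+ 2) := @holoX R h 2 hh.
exact: (holoM hX (holoV hl n0)).
Qed.

(** If no lam works, choose a bad h_n for lam = n + 1. The three twists of the large parts are null
    sequences, so T sends them to 0 in norm and [key_estimate] contradicts the choice. *)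
Lemma uniform_small (M e : R) : 0 < e -> exists lam : R, 0 < lam /\ forall h, large_re_ball h M ->
  (A1norm2 (fun z => cderiv u z * large_part lam (h (phi z)))%R <= e%:E)%E.
Proof.
move=> e0; apply: contrapT => /forallNP H.
have /choice[h Hh] : forall n : nat, exists h, large_re_ball h M /\
    ~ (A1norm2 (fun z => cderiv u z * large_part n.+1%:R (h (phi z)))%R <= e%:E)%E.
  move=> n; have /not_andP[|/existsNP[h /not_implyP[h1 h2]]] := H n.+1%:R.
    by rewrite ltr0n.
  by exists h.
have l0 n : (0 : R) < n.+1%:R by rewrite ltr0n.
have hh n : holo (h n) by have [[]] := Hh n.
have h1 n z : in_disc z -> 1 <= complex.Re (h n z) by have [[_ + _] _] := Hh n; apply.
have hM n : (H2norm2 (h n) <= M%:E)%E by have [[]] := Hh n.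
have hp n z : in_disc z -> 0 < complex.Re (h n z) by move=> /(h1 n); exact: lt_le_trans ltr01.
have /choice[L HL] := fun n => large_part_log (hh n) (hp n) (l0 n).
have hL n : holo (L n) by have [] := HL n.
have eL n z : in_disc z -> cexp (L n z) = large_part n.+1%:R (h n z) by have [_ + _] := HL n; apply.
pose b : R := 3 * (pi / 2).
have bL n z : in_disc z -> `|complex.Im (L n z)| <= b by have [_ _] := HL n; apply.
pose be := expR b; have be0 : 0 < be by exact: expR_gt0.
have tw k n z : in_disc z -> cabs (cexp (imag_unit R * L n z) ^+ k) <= be ^+ k.
  move=> zD; rewrite cabsX ler_expn ?cabs_ge0// cabs_cexp ler_expR.
  have := bL n z zD; rewrite ler_norml ReM /= => /andP[]; lra.
have nul k : null_seq (fun n => twist (L n) k) (be ^+ k ^+ 2 * M).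
  (* The twist is q_n h_n with |q_n| <= be^k, which bounds it in H^2; pointwise it is at most
     |h_n|^2 be^k / (n + 1). *)
  pose q n z := h n z / (h n z + ((n.+1%:R)%:C)%C) * cexp (imag_unit R * L n z) ^+ k.
  have hq n : holo (q n).
    have hl : holo (fun z => h n z + ((n.+1%:R)%:C)%C) := holoD (hh n) (@holo_cst R _).
    have n0 z : in_disc z -> h n z + ((n.+1%:R)%:C)%C != 0.
      by move=> zD; have [] := shift_bounds (l0 n) (ltW (hp n z zD)).
    have hC : holo (fun z => imag_unit R * L n z) := holoM (@holo_cst R _) (hL n).
    have hX : holo (fun z => cexp (imag_unit R * L n z) ^+ k) := @holoX R _ k (holo_cexp hC).
    exact: (holoM (holoM (hh n) (holoV hl n0)) hX).
  have tq n z : in_disc z -> q n z * h n z = twist (L n) k z.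
    move=> zD; rewrite /twist (eL n z zD) /q /large_part expr2.
    by rewrite mulrAC; congr (_ * _); rewrite mulrAC.
  have ht n : holo (twist (L n) k) := holo_twist (hL n).
  split; first exact: ht.
    move=> n; rewrite -(eq_H2norm2 (holoM (hq n) (hh n)) (tq n)).
    apply: (H2norm2_Mle (hh n) (hq n) _ (hM n)) => z zD.
    have [n0 c1 c2] := shift_bounds (l0 n) (ltW (hp n z zD)).
    rewrite -sqr_cabs ler_expn ?cabs_ge0// /q !cabsM -[leRHS]mul1r.
    rewrite ler_pM ?mulr_ge0 ?cabs_ge0 ?tw// cabsV ler_pdivrMr ?mul1r//.
    exact: lt_le_trans (l0 n) c1.
  move=> z zD d d0.
  pose B := Num.sqrt M / (1 - cabs z).
  have hB n : cabs (h n z) <= B by exact: point_eval (hh n) (hM n) zD.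
  have [|N HN] := @cvg_inv_succ R (d / (B ^+ 2 * be ^+ k + 1)).
    by rewrite divr_gt0// ltr_wpDl// mulr_ge0 ?sqr_ge0// exprn_ge0// ltW.
  exists N => n Nn; rewrite subr0 /twist (eL n z zD) cabsM /large_part cabsM cabsX cabsV.
  have [n0 c1 c2] := shift_bounds (l0 n) (ltW (hp n z zD)).
  have p0 : 0 < B ^+ 2 * be ^+ k + 1 by rewrite ltr_wpDl// mulr_ge0 ?sqr_ge0// exprn_ge0// ltW.
  apply: (@le_trans _ _ (B ^+ 2 * n.+1%:R^-1 * be ^+ k)).
    apply: ler_pM; rewrite ?mulr_ge0 ?exprn_ge0 ?invr_ge0 ?cabs_ge0 ?tw//.
    apply: ler_pM; rewrite ?exprn_ge0 ?invr_ge0 ?cabs_ge0//.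
      by rewrite ler_expn ?cabs_ge0.
    by rewrite lef_pV2 ?posrE// (lt_le_trans (l0 n)).
  have := HN n Nn; rewrite ler_pdivlMr// mulrDr mulr1; apply: le_trans.
  by rewrite -[leLHS]addr0 lerD ?invr_ge0// mulrAC [leRHS]mulrC.
have [C C0 HC] := key_estimate hu sphi spsi b.
have e1 : 0 < e / C by rewrite divr_gt0.
have [N0 H0] := compact_null (nul 0%N) e1.
have [N1 H1] := compact_null (nul 1%N) e1.
have [N2 H2] := compact_null (nul 2%N) e1.
pose N := (N0 + N1 + N2)%N.
apply: (Hh N).2; have := HC (L N) (e / C) (hL N) (bL N).
rewrite mulrCA divff ?mulr1 ?gt_eqF// => K.
rewrite -(@eq_A1norm2 R (fun z => cderiv u z * cexp (L N (phi z)))); last first.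
  by move=> z zD; rewrite (eL N _ (sphi.2 z zD)).
apply: K => -[|[|[|//]]] _.
- by apply: H0; rewrite /N -addnA leq_addr.
- by apply: H1; rewrite /N addnAC leq_addl.
- by apply: H2; rewrite /N leq_addl.
Qed.

(** Adding 1 to both Herglotz functions lifts their real parts to at least 1 and leaves the
    difference unchanged. *)
Lemma herglotz_big f (M : R) : holo f -> (H2norm2 f <= M%:E)%E ->
  exists h1 h2 (c : CC R), [/\ large_re_ball h1 (2 * (4 * M + 1)), large_re_ball h2 (2 * (4 * M + 1)),
    cabs c <= Num.sqrt M & forall z, in_disc z -> f z = h1 z - h2 z + c].
Proof.
move=> hf fM; have [h1 [h2 [[hh1 hh2] [n1 n2] h0 fE]]] := herglotz hf fM.
have bg h : holo h -> (H2norm2 h <= (4 * M)%:E)%E ->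
    (forall z, in_disc z -> 0 <= complex.Re (h z)) -> large_re_ball (fun z => h z + 1) (2 * (4 * M + 1)).
  move=> hh hM hz; split; first exact: (holoD hh (@holo_cst R 1)).
    by move=> z zD; rewrite ReD /= lerDr hz.
  have c1 : (H2norm2 (fun=> (1 : CC R)%R) <= (1%R)%:E)%E.
    by have := H2norm2_cst (1 : CC R); rewrite /cabs2 /= expr1n expr0n addr0.
  exact: (H2norm2_Dle hh (@holo_cst R 1) hM c1).
exists (fun z => h1 z + 1), (fun z => h2 z + 1), (0 +i* complex.Im (f 0))%C; split.
- by apply: (bg _ hh1 n1) => z /h0[].
- by apply: (bg _ hh2 n2) => z /h0[].
- apply: (@le_trans _ _ `|complex.Im (f 0)|).
    by rewrite /cabs /cabs2 /= expr0n add0r sqrtr_sqr.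
  rewrite (le_trans (Im_le_cabs _))// -(coef0E hf); exact: coef_le.
- move=> z zD; rewrite (fE z zD); congr (_ + _).
  by rewrite opprD addrACA subrr addr0.
Qed.

(** u' is the derivative of T 1, and T 1 lies in H^2. *)
Lemma cderiv_weight_A12 : exists M : R, (A1norm2 (cderiv u) <= M%:E)%E.
Proof.
have [K K0 LP] := littlewood_paley R; have h1 := @holo_cst R 1.
have [hT [M HM]] : holo (T (fun=> 1)) /\ exists M : R, (H2norm2 (T (fun=> 1%R)) <= M%:E)%E.
  have hT := Tc.1 _ (inH2P h1 (H2norm2_cst 1)).
  by split; [exact: hT.1|exact: inH2_bound].
have E z : in_disc z -> cderiv u z = cderiv (T (fun=> 1)) z.
  move=> zD; have c0 w : cderiv (fun=> 1 : CC R) w = 0 := cdiff_cderiv (cdiff_cst 1 w).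
  have D : cderiv (T (fun=> 1)) z = cderiv u z * 1 + (u z * cderiv phi z * cderiv (fun=> 1 : CC R) (phi z) -
    cderiv psi z * cderiv (fun=> 1 : CC R) (psi z)) := cderiv_diff_op hu sphi spsi h1 zD.
  rewrite D (c0 (phi z)) (c0 (psi z)).
  move: (cderiv u z) (u z) (cderiv phi z) (cderiv psi z) => *; ring.
exists (K * M); rewrite (eq_A1norm2 E); have [H _] := LP _ hT; exact: H M HM.
Qed.

(* After extraction, d_n is the sum of P_n, which is bounded and tends to 0 pointwise, and of Q_n, made of large parts. *)
Lemma compose_null d (M : R) : null_seq d M ->
  ecvg0 (fun n => A1norm2 (fun z => cderiv u z * d n (phi z))%R).
Proof.
move=> dn; apply: contrapT => /ecvg0_contra[e [e0 [t Ht]]].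
have [hd dM d0] := null_sub dn (fun n => (Ht n).1).
pose M' : R := 2 * (4 * M + 1); pose v := cderiv u; have hv : holo v := holo_cderiv hu.
have /choice[h1 /choice[h2 /choice[c HH]]] := fun n => herglotz_big (hd n) (dM n).
have B1 n : large_re_ball (h1 n) M' by have [] := HH n.
have B2 n : large_re_ball (h2 n) M' by have [] := HH n.
have hh1 n : holo (h1 n) by case: (B1 n).
have hh2 n : holo (h2 n) by case: (B2 n).
have n1 n : (H2norm2 (h1 n) <= M'%:E)%E by case: (B1 n).
have n2 n : (H2norm2 (h2 n) <= M'%:E)%E by case: (B2 n).
have [s1 [g1 [s1S hg1 g1M g1c]]] := H2_subseq hh1 n1.
have [s2 [g2 [s2S hg2 g2M g2c]]] := H2_subseq (fun n => hh2 (s1 n)) (fun n => n2 (s1 n)).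
pose s n := s1 (s2 n); have sS n : (s n < s n.+1)%N := incr_comp s1S s2S n.
have c1 z : in_disc z -> ccvg (fun n => h1 (s n) z) (g1 z).
  by move=> zD; exact: (ccvg_sub (g1c z zD) s2S).
have c2 z : in_disc z -> ccvg (fun n => h2 (s n) z) (g2 z) by exact: g2c.
have Re1 (h : nat -> CC R -> CC R) g z : (forall n, large_re_ball (h n) M') -> in_disc z ->
    ccvg (fun n => h (s n) z) (g z) -> 1 <= complex.Re (g z).
  move=> Bh zD hc; rewrite -subr_ge0; have := ccvg_Re_ge0 (ccvgD hc (ccvg_cst (-1))).
  rewrite ReD /=; apply=> n; rewrite ReD /= subr_ge0.
  by have [_ /(_ z zD)] := Bh (s n).
have bg1 : large_re_ball g1 M' by split; [exact: hg1|move=> z zD|exact: g1M]; exact: Re1 B1 zD (c1 z zD).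
have bg2 : large_re_ball g2 M' by split; [exact: hg2|move=> z zD|exact: g2M]; exact: Re1 B2 zD (c2 z zD).
(* Three nested sums or differences of two terms, each multiplying the bound by 4, bring e/64 up to
   e. *)
have e64 : 0 < e / 64 by rewrite divr_gt0.
have [lam [l0 small]] := uniform_small M' e64.
have R0 h z : large_re_ball h M' -> in_disc z -> 0 <= complex.Re (h z).
  by move=> [_ H _] zD; exact: le_trans ler01 (H z zD).
pose G h1 h2 z := large_part lam (h1 z) - large_part lam (h2 z).
have hG k1 k2 : large_re_ball k1 M' -> large_re_ball k2 M' -> holo (G k1 k2).
  by move=> b1 b2; exact: (holoB (holo_large_part b1 l0) (holo_large_part b2 l0)).
have hvc f : holo f -> holo (fun z => v z * f (phi z)) by move=> hf; exact: (holoM hv (holo_comp hf sphi)).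
have GA k1 k2 : large_re_ball k1 M' -> large_re_ball k2 M' -> (A1norm2 (fun z => v z * G k1 k2 (phi z))%R <= (e / 16)%:E)%E.
  move=> b1 b2; have := A1norm2_Ble (hvc _ (holo_large_part b1 l0)) (hvc _ (holo_large_part b2 l0)) (small _ b1) (small _ b2).
  rewrite (_ : 2 * _ = e / 16); last by field.
  by congr (A1norm2 _ <= _)%E; apply/funext => z; rewrite /G mulrBr.
(* Adding the large parts of the limits makes P_n tend to 0 pointwise: d_n does, and G (h1, h2)
   converges to G (g1, g2). *)
pose P n z := d (t (s n)) z - G (h1 (s n)) (h2 (s n)) z + G g1 g2 z.
pose Q n z := G (h1 (s n)) (h2 (s n)) z - G g1 g2 z.
have hP n : holo (P n) := holoD (holoB (hd (s n)) (hG _ _ (B1 _) (B2 _))) (hG _ _ bg1 bg2).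
have hQ n : holo (Q n) := holoB (hG _ _ (B1 _) (B2 _)) (hG _ _ bg1 bg2).
have QA n : (A1norm2 (fun z => v z * Q n (phi z))%R <= (e / 4)%:E)%E.
  have := A1norm2_Ble (hvc _ (hG _ _ (B1 (s n)) (B2 (s n)))) (hvc _ (hG _ _ bg1 bg2))
    (GA _ _ (B1 (s n)) (B2 (s n))) (GA _ _ bg1 bg2).
  rewrite (_ : 2 * _ = e / 4); last by field.
  by congr (A1norm2 _ <= _)%E; apply/funext => z; rewrite -mulrBr.
have gc (h : nat -> CC R -> CC R) g z : (forall n, large_re_ball (h n) M') -> large_re_ball g M' -> in_disc z ->
    ccvg (fun n => h (s n) z) (g z) -> ccvg (fun n => large_part lam (h (s n) z)) (large_part lam (g z)).
  move=> Bh bg zD hc r r0; have [|N HN] := hc (r / 2); first by rewrite divr_gt0.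
  exists N => n /HN hn; rewrite (le_trans (large_part_lipschitz l0 (R0 _ _ (Bh _) zD) (R0 _ _ bg zD)))//.
  by rewrite mulrC -ler_pdivlMr.
pose x n z := d (t (s n)) z - G (h1 (s n)) (h2 (s n)) z.
have xc z : in_disc z -> ccvg (fun n => x n z) (- G g1 g2 z).
  move=> zD; have G1 := ccvgD (gc _ _ z B1 bg1 zD (c1 z zD)) (ccvgZ (-1) (gc _ _ z B2 bg2 zD (c2 z zD))).
  have := ccvgD (ccvg_sub (d0 z zD) sS) (ccvgZ (-1) G1).
  rewrite add0r !mulN1r; congr (ccvg _ _); apply/funext => n.
  by rewrite /x /G !mulN1r.
(* Each of h1 and h2 differs from its large part by at most lam, and the constant c is at most the
   square root of M. *)
pose B := lam + lam + Num.sqrt M.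
have xB n z : in_disc z -> cabs (x n z) <= B.
  move=> zD; have [_ _ cM fE] := HH (s n).
  have -> : x n z = ((h1 (s n) z - large_part lam (h1 (s n) z)) - (h2 (s n) z - large_part lam (h2 (s n) z))) + c (s n).
    rewrite /x /G fE//; move: (h1 _ z) (h2 _ z) (large_part _ _) (large_part _ _) (c _) => *; ring.
  rewrite (le_trans (cabsD _ _))// lerD// (le_trans (cabsB _ _))// lerD// large_part_dist// R0//.
have GB z : in_disc z -> cabs (G g1 g2 z) <= B.
  move=> zD; rewrite -cabsN -[- G g1 g2 z]subr0.
  by apply: (ccvg_le (N := 0%N) (xc z zD)) => n _; rewrite subr0 xB.
have [Mv HMv] := cderiv_weight_A12.
have PA : ecvg0 (fun n => A1norm2 (fun z => v z * P n (phi z))%R).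
  apply: (@A1norm2_dominated R v (fun n z => P n (phi z)) ((B + B) ^+ 2) Mv hv HMv).
  - move=> n; exact: (holo_comp (hP n) sphi).
  - move=> n z zD; rewrite -sqr_cabs ler_expn ?cabs_ge0//.
    by rewrite (le_trans (cabsD _ _))// lerD ?xB ?GB//; exact: sphi.2.
  - move=> z zD; have zD' := sphi.2 z zD.
    by have := ccvgD (xc _ zD') (ccvg_cst (G g1 g2 (phi z))); rewrite addNr.
have e4 : 0 < e / 4 by rewrite divr_gt0.
have [N /(_ N (leqnn _)) PN] := PA _ e4.
have := A1norm2_Dle (hvc _ (hP N)) (hvc _ (hQ N)) PN (QA N).
rewrite (_ : 2 * _ = e); last by field.
apply/negP; rewrite -ltNge; have := (Ht (s N)).2.
congr (_ < A1norm2 _)%E; apply/funext => z.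
by rewrite -mulrDr; congr (_ * _); rewrite /P /Q; move: (d _ _) (G _ _ _) (G _ _ _) => *; ring.
Qed.

End Compact.
End Necessity.

(** * The equivalence *)

Section Main.
Variable R : realType.
Implicit Types (f g h : CC R -> CC R) (z w : CC R).

Lemma ecvg0_sub (x : nat -> \bar R) (s : nat -> nat) : (forall n, (s n < s n.+1)%N) ->
  ecvg0 x -> ecvg0 (fun n => x (s n)).
Proof.
move=> sS x0 e /x0[N HN]; exists N => n Nn; apply: HN.
exact: leq_trans Nn (incr_ge sS n).
Qed.

Lemma ecvg0_dom (x : nat -> \bar R) (y1 y2 : nat -> \bar R) (C1 C2 : R) : 0 < C1 -> 0 < C2 ->
  (forall n (e1 e2 : R), (y1 n <= e1%:E)%E -> (y2 n <= e2%:E)%E -> (x n <= (C1 * e1 + C2 * e2)%:E)%E) ->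
  ecvg0 y1 -> ecvg0 y2 -> ecvg0 x.
Proof.
move=> c1 c2 H t1 t2 e e0.
have [|N1 H1] := t1 (e / 2 / C1); first by rewrite !divr_gt0.
have [|N2 H2] := t2 (e / 2 / C2); first by rewrite !divr_gt0.
exists (maxn N1 N2) => n; rewrite geq_max => /andP[/H1 h1 /H2 h2].
have := H n _ _ h1 h2; rewrite ![_ * (e / 2 / _)]mulrC !divfK ?gt_eqF//.
by rewrite -splitr.
Qed.

Variables (u phi psi : CC R -> CC R).
Hypotheses (hu : holo u) (sphi : selfmap phi) (spsi : selfmap psi).
Notation T := (diff_op u phi psi).
Notation C1 := (wcomp (cderiv u) phi).
Definition deriv_op f z := wcomp (fun w => u w * cderiv phi w) phi f z - wcomp (cderiv psi) psi f z.
Notation S := deriv_op.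

Lemma cderiv_diff_opE f z : holo f -> in_disc z -> cderiv (T f) z = C1 f z + S (cderiv f) z.
Proof. by move=> hf zD; exact: (cderiv_diff_op hu sphi spsi hf zD). Qed.

Lemma holo_weight f : holo f -> holo (C1 f).
Proof. by move=> hf; exact: (holoM (holo_cderiv hu) (holo_comp hf sphi)). Qed.

Lemma holo_deriv_op f : holo f -> holo (S f).
Proof.
move=> hf; have h1 := holoM (holoM hu (holo_cderiv sphi.1)) (holo_comp hf sphi).
exact: (holoB h1 (holoM (holo_cderiv spsi.1) (holo_comp hf spsi))).
Qed.

Section Necessary.
Hypothesis Tc : compact_op (@inH2 R) (@inH2 R) (@H2norm2 R) (@H2norm2 R) T.

(* The multiples f / (n + 1) form a null sequence. *)
Lemma weight_inA12 f : inH2 f -> inA12 (C1 f).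
Proof.
move=> ff; have [M fM] := inH2_bound ff; have hf := ff.1.
pose k n : CC R := ((n.+1%:R^-1 : R)%:C)%C.
have kc n : cabs (k n) = n.+1%:R^-1 by rewrite cabs_real ger0_norm ?invr_ge0.
have k1 n : cabs2 (k n) <= 1.
  by rewrite -sqr_cabs kc exprn_ile1 ?invr_ge0// invf_le1 ?ler1n.
have nul : null_seq (fun n z => k n * f z) (1 * M).
  split=> [n|n|z zD e e0]; first exact: (holoM (@holo_cst R (k n)) hf).
    exact: (H2norm2_Mle (g := fun=> k n) hf (@holo_cst R (k n)) (fun z _ => k1 n) fM).
  have p0 : 0 < cabs (f z) + 1 by rewrite ltr_wpDl ?cabs_ge0.
  have [N HN] := cvg_inv_succ (divr_gt0 e0 p0); exists N => n /HN.
  rewrite ler_pdivlMr// subr0 cabsM kc; apply: le_trans.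
  by rewrite ler_wpM2l ?invr_ge0// lerDl.
have [N /(_ N (leqnn _)) HN] := compose_null hu sphi spsi Tc nul ltr01.
have h1 := holo_weight (holoM (@holo_cst R (k N)) hf).
have hA := A1norm2_Mle (g := fun=> ((N.+1%:R)%:C)%C) h1 (@holo_cst R _) (fun z _ => lexx _) HN.
have K : ((N.+1%:R)%:C)%C * k N = 1 :> CC R by rewrite -rmorphM /= mulfV.
have E : (fun z => ((N.+1%:R)%:C)%C * C1 (fun z => k N * f z) z) = C1 f.
  apply/funext => z; rewrite /wcomp -[RHS]mul1r -K; move: ((N.+1%:R)%:C)%C (k N) => *; ring.
move: hA; rewrite E; exact: (inA12P (holo_weight hf)).
Qed.

(** After extraction fs converges pointwise to some f in H^2; the differences form a null sequence,
    to which [compose_null] applies. *)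
Lemma weight_compact (fs : nat -> CC R -> CC R) (M : R) :
  (forall n, holo (fs n)) -> (forall n, (H2norm2 (fs n) <= M%:E)%E) ->
  exists (s : nat -> nat) g, [/\ forall n, (s n < s n.+1)%N, inA12 g &
    ecvg0 (fun n => A1norm2 (fun z => C1 (fs (s n)) z - g z)%R)].
Proof.
move=> hfs fM; have [s [f [sS hf fB fc]]] := H2_subseq hfs fM.
exists s, (C1 f); split; [exact: sS|exact: (weight_inA12 (inH2P hf fB))|].
have hN : holo (fun z => (-1) * f z) := holoM (@holo_cst R _) hf.
have NB : (H2norm2 (fun z => (-1) * f z)%R <= (1 * M)%:E)%E.
  apply: (H2norm2_Mle (g := fun=> -1) hf (@holo_cst R _) _ fB) => z _.
  by rewrite cabs2N /cabs2 /= expr0n expr1n addr0.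
have nul : null_seq (fun n z => fs (s n) z + (-1) * f z) (2 * (M + 1 * M)).
  split=> [n|n|z zD]; first exact: (holoD (hfs _) hN).
    exact: (H2norm2_Dle (hfs (s n)) hN (fM (s n)) NB).
  have := ccvgD (fc z zD) (ccvg_cst (-1 * f z)); rewrite (_ : f z + -1 * f z = 0)//.
  by rewrite mulN1r subrr.
have := compose_null hu sphi spsi Tc nul; congr ecvg0; apply/funext => n.
congr A1norm2; apply/funext => z; rewrite /wcomp.
by move: (cderiv u z) (fs _ _) (f _) => *; ring.
Qed.

(** With F a primitive of f, which lies in H^2 by Littlewood-Paley, S f = (T F)' - u' F(phi). *)
Lemma deriv_op_inA12 f : inA12 f -> inA12 (S f).
Proof.
move=> [hf fo]; have [M fM] := inA12_bound (conj hf fo).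
have [K K0 LP] := littlewood_paley R.
have [F [hF F0 F']] := primitive 0 hf.
have FB : (H2norm2 F <= (cabs2 (F 0) + K * M)%:E)%E.
  by apply: (LP F hF).2; rewrite (eq_A1norm2 F').
have FF := inH2P hF FB.
have [hT _] := Tc.1 _ FF; have [M1 HM1] := inH2_bound (Tc.1 _ FF).
have [M2 HM2] := inA12_bound (weight_inA12 FF).
have HT := (LP _ hT).1 _ HM1.
have := A1norm2_Ble (holo_cderiv hT) (holo_weight hF) HT HM2.
have E z : in_disc z -> cderiv (T F) z - C1 F z = S f z.
  move=> zD; rewrite (cderiv_diff_opE hF zD) addrC addKr /deriv_op /wcomp.
  by rewrite (F' _ (sphi.2 z zD)) (F' _ (spsi.2 z zD)).
rewrite (eq_A1norm2 E); exact: (inA12P (holo_deriv_op hf)).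
Qed.

(** Primitives vanishing at 0 are bounded in H^2. One extraction for T and one for [C1] give limits
    g1 and g2, and S converges to g1' - g2. *)
Lemma deriv_op_compact (fs : nat -> CC R -> CC R) (M : R) :
  (forall n, holo (fs n)) -> (forall n, (A1norm2 (fs n) <= M%:E)%E) ->
  exists (s : nat -> nat) g, [/\ forall n, (s n < s n.+1)%N, inA12 g &
    ecvg0 (fun n => A1norm2 (fun z => S (fs (s n)) z - g z)%R)].
Proof.
move=> hfs fM; have [K K0 LP] := littlewood_paley R.
have /choice[F HF] := fun n => primitive 0 (hfs n).
have hF n : holo (F n) by case: (HF n).
have F' n z : in_disc z -> cderiv (F n) z = fs n z by case: (HF n) => _ _; apply.
have FB n : (H2norm2 (F n) <= (K * M)%:E)%E.
  have F0 : F n 0 = 0 by case: (HF n).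
  rewrite (_ : K * M = cabs2 (F n 0) + K * M); last by rewrite F0 /cabs2 /= expr0n !add0r.
  by apply: (LP _ (hF n)).2; rewrite (eq_A1norm2 (F' n)).
have FF n := inH2P (hF n) (FB n).
have [|s1 [g1 [s1S [[hg1 g1o] c1]]]] := Tc.2 F FF; first by exists (K * M).
have [s2 [g2 [s2S gA2 c2]]] := weight_compact (fun n => hF (s1 n)) (fun n => FB (s1 n)).
have hg2 := gA2.1.
pose s n := s1 (s2 n).
have hT n : holo (T (F n)) := holo_diff_op hu sphi spsi (hF n).
have hTg n : holo (fun z => T (F (s1 n)) z - g1 z) := holoB (hT _) hg1.
have {}c1 := (ecvg0P (fun n => H2norm2_ge0 (hTg n))).1 c1.
have [M1 HM1] := inH2_bound (conj hg1 g1o); have [M2 HM2] := inA12_bound gA2.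
exists s, (fun z => cderiv g1 z - g2 z); split; first exact: incr_comp s1S s2S.
  apply: (inA12P (holoB (holo_cderiv hg1) hg2)).
  exact: (A1norm2_Ble (holo_cderiv hg1) hg2 ((LP _ hg1).1 _ HM1) HM2).
have p1 : 0 < 2 * K by rewrite mulr_gt0.
apply: (ecvg0_dom p1 (ltr0n R 2) _ (ecvg0_sub s2S c1) c2) => n e1 e2 h1 h2.
have h3 := (LP _ (hTg (s2 n))).1 _ h1.
have h4 : holo (fun z => C1 (F (s n)) z - g2 z) := holoB (holo_weight (hF _)) hg2.
have := A1norm2_Ble (holo_cderiv (hTg (s2 n))) h4 h3 h2.
rewrite mulrDr mulrA.
have E z : in_disc z -> cderiv (fun z => T (F (s1 (s2 n))) z - g1 z) z - (C1 (F (s n)) z - g2 z) =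
    S (fs (s n)) z - (cderiv g1 z - g2 z).
  move=> zD; rewrite (cdiff_cderiv (cdiffB (holo_cdiff (hT _) zD) (holo_cdiff hg1 zD))).
  rewrite (cderiv_diff_opE (hF _) zD).
  have -> : S (fs (s n)) z = S (cderiv (F (s n))) z.
    by rewrite /deriv_op /wcomp (F' _ _ (sphi.2 z zD)) (F' _ _ (spsi.2 z zD)).
  rewrite /s; move: (C1 _ _) (S _ _) (cderiv g1 z) (g2 z) => *; ring.
by rewrite (eq_A1norm2 E).
Qed.

End Necessary.

Section Sufficient.
Hypothesis C1c : compact_op (@inH2 R) (@inA12 R) (@H2norm2 R) (@A1norm2 R) C1.
Hypothesis Sc : compact_op (@inA12 R) (@inA12 R) (@A1norm2 R) (@A1norm2 R) S.

Lemma cderiv_inA12 f : inH2 f -> inA12 (cderiv f).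
Proof.
move=> ff; have hf := ff.1; have [M HM] := inH2_bound ff.
have [K K0 LP] := littlewood_paley R.
exact: (inA12P (holo_cderiv hf) ((LP f hf).1 M HM)).
Qed.

Lemma diff_op_inH2 f : inH2 f -> inH2 (T f).
Proof.
move=> ff; have hf := ff.1; have [K K0 LP] := littlewood_paley R.
have [M1 HM1] := inA12_bound (C1c.1 f ff).
have [M2 HM2] := inA12_bound (Sc.1 _ (cderiv_inA12 ff)).
have hT := holo_diff_op hu sphi spsi hf.
have hS := holo_deriv_op (holo_cderiv hf).
have H := A1norm2_Dle (holo_weight hf) hS HM1 HM2.
apply: (inH2P hT ((LP _ hT).2 (2 * (M1 + M2)) _)).
by rewrite (eq_A1norm2 (fun z zD => cderiv_diff_opE hf zD)).
Qed.

Lemma diff_op_compact (fs : nat -> CC R -> CC R) (M : R) :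
  (forall n, inH2 (fs n)) -> (forall n, (H2norm2 (fs n) <= M%:E)%E) ->
  exists (s : nat -> nat) g, [/\ forall n, (s n < s n.+1)%N, inH2 g &
    ecvg0 (fun n => H2norm2 (fun z => T (fs (s n)) z - g z)%R)].
Proof.
move=> ff fM; have hfs n : holo (fs n) := (ff n).1.
have [K K0 LP] := littlewood_paley R.
have [|s1 [g1 [s1S [gA1 c1]]]] := C1c.2 fs ff; first by exists M.
have [||s2 [g2 [s2S [gA2 c2]]]] := Sc.2 (fun n => cderiv (fs (s1 n))).
- by move=> n; exact: cderiv_inA12.
- by exists (K * M) => n; exact: (LP _ (hfs (s1 n))).1 _ (fM (s1 n)).
(* The first two extractions control derivatives only; this third one makes the values T (fs) 0
   converge, and its limit fixes the constant of integration of g. *)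
have [s3 [f [s3S hf fB fc]]] := H2_subseq (fun n => hfs (s1 (s2 n))) (fun n => fM (s1 (s2 n))).
have {}c1 := (ecvg0P (fun n => A1norm2_ge0 _)).1 c1.
have {}c2 := (ecvg0P (fun n => A1norm2_ge0 _)).1 c2.
have s23 := incr_comp s2S s3S.
have [hg1 _] := gA1; have [hg2 _] := gA2.
have [g [hg g0 g']] := primitive (T f 0) (holoD hg1 hg2).
pose s n := s1 (s2 (s3 n)).
have [M1 HM1] := inA12_bound gA1; have [M2 HM2] := inA12_bound gA2.
have D0 : in_disc (0 : CC R) by apply/in_discP; rewrite cabs0.
exists s, g; split; first exact: incr_comp s1S s23.
  apply: (inH2P hg ((LP _ hg).2 (2 * (M1 + M2)) _)).
  by rewrite (eq_A1norm2 g'); exact: A1norm2_Dle.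
have t0 : ecvg0 (fun n => (cabs2 (T (fs (s n)) 0 - g 0))%:E).
  move=> e e0; have q0 : 0 < Num.sqrt e by rewrite sqrtr_gt0.
  have q1 := ccvgZ (u 0) (fc _ (sphi.2 0 D0)); have q2 := ccvgZ (-1) (fc _ (spsi.2 0 D0)).
  have [N HN] := ccvgD q1 q2 q0; exists N => n /HN; rewrite g0 !mulN1r => h.
  rewrite lee_fin -sqr_cabs -[e]sqr_sqrtr ?(ltW e0)// ler_expn ?cabs_ge0//.
pose y n := A1norm2 (fun z => (C1 (fs (s n)) z - g1 z) + (S (cderiv (fs (s n))) z - g2 z))%R.
have hT n : holo (T (fs n)) := holo_diff_op hu sphi spsi (hfs n).
have hC n : holo (fun z => C1 (fs (s n)) z - g1 z) := holoB (holo_weight (hfs _)) hg1.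
have hS n : holo (fun z => S (cderiv (fs (s n))) z - g2 z) := holoB (holo_deriv_op (holo_cderiv (hfs _))) hg2.
have ty : ecvg0 y.
  apply: (ecvg0_dom (ltr0n R 2) (ltr0n R 2) _ (ecvg0_sub s23 c1) (ecvg0_sub s3S c2)) => n e1 e2 h1 h2.
  by rewrite -mulrDr; exact: (A1norm2_Dle (hC n) (hS n) h1 h2).
apply: (ecvg0_dom ltr01 K0 _ t0 ty) => n e1 e2 h1 h2.
have hTg : holo (fun z => T (fs (s n)) z - g z) := holoB (hT _) hg.
have E z : in_disc z -> cderiv (fun z => T (fs (s n)) z - g z) z =
    (C1 (fs (s n)) z - g1 z) + (S (cderiv (fs (s n))) z - g2 z).
  move=> zD; rewrite (cdiff_cderiv (cdiffB (holo_cdiff (hT _) zD) (holo_cdiff hg zD))).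
  rewrite (cderiv_diff_opE (hfs _) zD) (g' z zD).
  by move: (C1 _ _) (S _ _) (g1 z) (g2 z) => *; ring.
have := (LP _ hTg).2 e2; rewrite (eq_A1norm2 E) => /(_ h2) /le_trans; apply.
by rewrite lee_fin lerD2r mul1r -lee_fin.
Qed.

End Sufficient.

End Main.

Theorem theorem1p4 (R : realType) (u phi psi : CC R -> CC R) :
  holo u -> selfmap phi -> selfmap psi ->
  (compact_op (@inH2 R) (@inH2 R) (@H2norm2 R) (@H2norm2 R)
     (fun f => fun z => wcomp u phi f z - cop psi f z)
   <->
   compact_op (@inH2 R) (@inA12 R) (@H2norm2 R) (@A1norm2 R)
     (wcomp (cderiv u) phi)
   /\
   compact_op (@inA12 R) (@inA12 R) (@A1norm2 R) (@A1norm2 R)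
     (fun f => fun z => wcomp (fun w => u w * cderiv phi w) phi f z
                        - wcomp (cderiv psi) psi f z)).
Proof.
move=> hu sphi spsi; split => [Tc|[C1c Sc]].
- split; split.
  + exact: (weight_inA12 hu sphi spsi Tc).
  + move=> fs ff [M fM].
    have [s [g [sS gA c]]] := weight_compact hu sphi spsi Tc (fun n => (ff n).1) fM.
    exists s, g; split=> //; split=> //.
    exact: (ecvg0P (fun n => A1norm2_ge0 _)).2 c.
  + exact: (deriv_op_inA12 hu sphi spsi Tc).
  + move=> fs ff [M fM].
    have [s [g [sS gA c]]] := deriv_op_compact hu sphi spsi Tc (fun n => (ff n).1) fM.
    exists s, g; split=> //; split=> //.
    exact: (ecvg0P (fun n => A1norm2_ge0 _)).2 c.
split; first exact: (diff_op_inH2 hu sphi spsi C1c Sc).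
move=> fs ff [M fM]; have [s [g [sS gA c]]] := diff_op_compact hu sphi spsi C1c Sc ff fM.
exists s, g; split=> //; split=> //.
have hTg n := holoB (holo_diff_op hu sphi spsi (ff (s n)).1) gA.1.
exact: (ecvg0P (fun n => H2norm2_ge0 (hTg n))).2 c.
Qed.
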